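(* Let $\Gamma$ be a two-player zero-sum game, a potential game, or a generic $2\times m$ game (finite, in normal form). Consider the strongly convergent variant of classical fictitious play on $\Gamma$ (defined in the context), and assume that its probabilities of deliberate best response satisfy, almost surely, $\lim_{t\to\infty}\rho_i(t)=0$ for all $i\in N$, $\sum_{t\ge1}\rho_i(t)=\infty$ for all $i\in N$, and $\lim_{t\to\infty}\frac{\sum_{k=1}^t\rho_i(k)}{\sum_{k=1}^t\rho_j(k)}=1$ for all $i,j\in N$. Then the period-by-period mixed strategies $g(t)=(g_1(t),\dots,g_n(t))$ satisfy $\lim_{t\to\infty}d(g(t),NE)=0$ almost surely, where $NE$ is the set of (mixed) Nash equilibria of $\Gamma$.
   Context: Game notation. $\Gamma=(N,(Y_i,u_i)_{i\in N})$ with $N=\{1,\dots,n\}$, finite action sets $Y_i$ of cardinality $m_i$, utilities $u_i:Y\to\mathbb R$, $Y=\prod_iY_i$. $\Delta_i$ is the simplex of probability vectors in $\mathbb R^{m_i}$, $A_i=\{e_1,\dots,e_{m_i}\}\subset\Delta_i$ the pure strategies (standard basis vectors), $\Delta^n=\prod_i\Delta_i$. $U_i(p)=\sum_{y\in Y}u_i(y)p_1(y_1)\cdots p_n(y_n)$. $NE=\{p\in\Delta^n:U_i(p_i,p_{-i})\ge U_i(p_i',p_{-i})\ \forall p_i'\in\Delta_i,\forall i\}$. $BR_i(p_{-i})=\arg\max_{a_i\in A_i}U_i(a_i,p_{-i})\subset A_i$. $d(p,S)=\inf_{p'\in S}\|p-p'\|$ (Euclidean norm). Potential game: there is $\phi:Y\to\mathbb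 R$ with $u_i(y_i',y_{-i})-u_i(y_i'',y_{-i})=\phi(y_i',y_{-i})-\phi(y_i'',y_{-i})$ for all $i,y_i',y_i'',y_{-i}$. Generic $2\times m$ game: a two-player game in which one player has two actions and the other has $m$ actions, with payoffs generic in the usual sense (outside a closed Lebesgue-null exceptional set of payoff vectors). Strongly convergent variant of classical FP. A random process with random variables $X_i(t)\in\{0,1\}$ ($X_i(t)=1$ meaning that player $i$ plays a deliberate best response in round $t$), actions $a_i(t)\in A_i$ and selections $b_i(t)\in A_i$. Initialization: $a_i(1)$ arbitrary, $q_i(1)=a_i(1)$, $X_i(1)=1$ for all $i$. With $\ell_i(t)=\sum_{k=1}^tX_i(k)$, the empirical distributions are updated by $q_i(t+1)=q_i(t)+\frac1{\ell_i(t+1)}\left(a_i(t+1)-q_i(t)\right)X_i(t+1)$. For $t\ge2$, $b_i(t-1)\in BR_i(q_{-i}(t-1))$; the action is $a_i(t)=b_i(t-1)$ if $X_i(t)=1$, while if $X_i(t)=0$, $a_i(t)$ is drawn at random from the distribution $q_i(t-1)$. With $\mathcal F_t=\sigma(\{a(s),X_1(s),\dots,X_n(s),b_1(s),\dots,b_n(s)\}_{s\le t})$, define $\rho_i(t)=\mathbb P(X_i(t)=1\mid\mathcal F_{t-1})$ and $g_i(t)=\rho_i(t)\,b_i(t-1)+(1-\rho_i(t))\,q_i(t-1)$, so that $g_i(t)$ is the conditional distribution of $a_i(t)$ given $\mathcal F_{t-1}$. *)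

(* Defs.v *)
From HB Require Import structures.
From mathcomp Require Import all_boot all_order all_algebra.
From mathcomp Require Import all_classical all_reals all_analysis.

Set Implicit Arguments.
Unset Strict Implicit.
Unset Printing Implicit Defensive.
Import Order.TTheory GRing.Theory Num.Theory.
Import numFieldNormedType.Exports.

Local Open Scope classical_set_scope.
Local Open Scope ring_scope.

Section Games.
Context {R : realType} {n : nat} {Y : 'I_n -> finType}.

Definition profile := {dffun forall i, Y i}.

(* The payoff vector of a game: coordinate (i, y) is u_i(y).  The pointwise
   topology on this function type is the usual topology of the
   finite-dimensional payoff space. *)
Definition payoffs := {ptws ('I_n * profile) -> R}.

(* A vector of R^{m_i} is a function Y i -> R. *)
Definition mixed := forall i, Y i -> R.

Definition simplex (T : finType) : set (T -> R) :=
  [set x | (forall y, 0 <= x y) /\ \sum_y x y = 1].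

(* The standard basis vector e_y. *)
Definition pure (T : finType) (y : T) : T -> R := fun y' => (y' == y)%:R.

Definition expected_payoff (u : payoffs) (i : 'I_n) (p : mixed) : R :=
  \sum_(y : profile) u (i, y) * \prod_(j < n) p j (y j).

(* [dfwith p i x] is (x, p_{-i}). *)
Definition nash_equilibria (u : payoffs) : set mixed :=
  [set p | (forall i, simplex (p i)) /\
     forall i (x : Y i -> R), simplex x ->
       expected_payoff u i (dfwith p i x) <= expected_payoff u i p].

(* The pure action y stands for the vertex e_y of the simplex. *)
Definition best_replies (u : payoffs) (i : 'I_n) (p : mixed) : set (Y i) :=
  [set y | forall y' : Y i,
     expected_payoff u i (dfwith p i (pure y')) <=
     expected_payoff u i (dfwith p i (pure y))].

Definition euclidean_dist (p p' : mixed) : R :=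
  Num.sqrt (\sum_(i < n) \sum_(y : Y i) (p i y - p' i y) ^+ 2).

(* Extended-real infimum, so that the distance to the empty set is +oo
   (a real-valued [inf] would give 0). *)
Definition dist_to (p : mixed) (S : set mixed) : \bar R :=
  ereal_inf [set (euclidean_dist p p')%:E | p' in S].

Definition two_player_zero_sum (u : payoffs) : Prop :=
  n = 2%N /\ forall y : profile, \sum_(i < n) u (i, y) = 0.

Definition potential_game (u : payoffs) : Prop :=
  exists phi : profile -> R, forall (i : 'I_n) (y' y'' : profile),
    (forall j, j != i -> y' j = y'' j) ->
    u (i, y') - u (i, y'') = phi y' - phi y''.

Definition two_by_m : Prop := n = 2%N /\ exists i : 'I_n, #|Y i| = 2%N.

End Games.

Arguments profile {n} Y.
Arguments payoffs R {n} Y.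
Arguments mixed R {n} Y.
Arguments two_by_m {n} Y.
Arguments best_replies {R n Y} u i p _.

(* Null sets of R^I for n-dimensional Lebesgue measure: countable covers by
   closed boxes of arbitrarily small total volume.  The boxes are indexed by a
   subset D of nat so that the empty cover is allowed (when I is empty every
   box has volume 1). *)
Definition lebesgue_null {R : realType} {I : finType} (E : set (I -> R)) : Prop :=
  forall e : R, 0 < e ->
    exists (D : set nat) (lo hi : nat -> I -> R),
      [/\ forall k i, lo k i <= hi k i,
          E `<=` \bigcup_(k in D) [set x | forall i, lo k i <= x i <= hi k i]
        & (\esum_(k in D) (\prod_(i : I) (hi k i - lo k i))%:E <= e%:E)%E].

Section Process.
Context {R : realType} {n : nat} {Y : 'I_n -> finType}.
Context {d : measure_display} {Omega : measurableType d}.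

(* Rounds are numbered from 1; values at index 0 are unconstrained and enter
   only g(0) and g(1), hence no limit. *)
Definition actions := forall i : 'I_n, nat -> Omega -> Y i.
Definition indicators := 'I_n -> nat -> Omega -> bool.

(* l_i(t) *)
Definition deliberate_rounds (x : nat -> bool) (t : nat) : nat :=
  (\sum_(1 <= k < t.+1) x k)%N.

Fixpoint empirical (T : finType) (a : nat -> T) (x : nat -> bool) (t : nat)
    : T -> R :=
  match t with
  | 0 => fun=> 0
  | 1 => pure (a 1%N)
  | s.+1 => fun y =>
      empirical a x s y +
      (deliberate_rounds x s.+1)%:R^-1 * (pure (a s.+1) y - empirical a x s y)
        * (x s.+1)%:R
  end.

(* q(t) *)
Definition empirical_profile (a : actions) (X : indicators) (t : nat)
    (w : Omega) : mixed R Y :=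
  fun i => empirical (fun k => a i k w) (fun k => X i k w) t.
Arguments empirical_profile a X t w i _ : clear implicits.

(* F_t; in particular F_0 is trivial. *)
Definition history (a b : actions) (X : indicators) (t : nat)
    : set (set Omega) :=
  <<s \bigcup_(s in [set s | (1 <= s <= t)%N]) \bigcup_(i in [set: 'I_n])
       (preimage_set_system setT (a i s) setT `|`
        preimage_set_system setT (X i s) setT `|`
        preimage_set_system setT (b i s) setT) >>.

(* f is a version of the conditional probability P(E | F). *)
Definition is_conditional_probability (P : probability Omega R)
    (F : set (set Omega)) (E : set Omega) (f : Omega -> R) : Prop :=
  [/\ forall B : set R, measurable B -> F (f @^-1` B),
      P.-integrable setT (EFin \o f)
    & forall A, F A -> (\int[P]_(w in A) (f w)%:E)%E = P (A `&` E)].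

Record strongly_convergent_fp (P : probability Omega R) (u : payoffs R Y)
    (a b : actions) (X : indicators) : Prop := {
  fp_measurable : forall t, history a b X t `<=` measurable;
  fp_init : forall i w, X i 1%N w = true;
  fp_best_reply : forall i t w, (2 <= t)%N ->
    best_replies u i (empirical_profile a X t.-1 w) (b i t.-1 w);
  fp_deliberate : forall i t w, (2 <= t)%N ->
    X i t w = true -> a i t w = b i t.-1 w;
  (* On {X_i(t) = 0}, the conditional law of a_i(t) given F_{t-1} is
     q_i(t-1). *)
  fp_random : forall i t (y : Y i) (A : set Omega), (2 <= t)%N ->
    history a b X t.-1 A ->
    P (A `&` [set w | X i t w = false] `&` [set w | a i t w = y]) =
    (\int[P]_(w in A `&` [set w | X i t w = false])
       (empirical_profile a X t.-1 w i y)%:E)%E }.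

(* g(t) *)
Definition period_strategy (a b : actions) (X : indicators)
    (rho : 'I_n -> nat -> Omega -> R) (t : nat) (w : Omega) : mixed R Y :=
  fun i y => rho i t w * pure (b i t.-1 w) y +
             (1 - rho i t w) * empirical_profile a X t.-1 w i y.

End Process.

Arguments actions {n} Y {d} Omega.
Arguments indicators n {d} Omega.
Arguments empirical_profile {R n Y d Omega} a X t w i _.
Arguments period_strategy {R n Y d Omega} a b X rho t w i _.

(* Main.v *)
(* The number of deliberate rounds of player i minus the sum of the rho_i is a
   martingale whose increments have conditional variance at most rho_i.
   Stopping it when the sum passes the cubes m^3 bounds its second moment
   there, and interpolating between these times gives l_i(t) ~ sum rho_i
   almost surely.  So the clocks l_i tend to infinity and are asymptotic to each
   other, and along almost every trajectory the q_i follow a fictitious play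
   with asynchronous but asymptotically equal clocks.  As rho_i -> 0, g(t) is
   close to q(t-1), and by compactness it is enough that the gain from a best
   reply against q tends to 0.

   In zero-sum games this is Robinson's induction on the number of actions,
   which tolerates asynchronous clocks.  In potential games the multilinear
   potential increases by the gains times the step sizes, up to summable second
   order terms; the gains are thus summable against the step sizes and vary
   slowly.  For 2 x m games with distinct payoffs, let p be the weight of the
   first action of the two-action player, and F the primitive of her payoff
   advantage against the best reply to p.  While she keeps playing the same
   action, F(p) essentially cannot decrease, and it grows by a definite amount
   if p moves by a definite amount; as F is bounded, p converges. *)

Require Import Defs.
From HB Require Import structures.
From mathcomp Require Import all_boot all_order all_algebra.
From mathcomp Require Import all_classical all_reals all_analysis.
From mathcomp Require Import measurable_realfun.
From mathcomp Require Import zify ring lra.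

Set Implicit Arguments.
Unset Strict Implicit.
Unset Printing Implicit Defensive.
Import Order.TTheory GRing.Theory Num.Theory.
Import numFieldNormedType.Exports.

Local Open Scope classical_set_scope.
Local Open Scope ring_scope.

(** * Robinson's theorem for asynchronous clocks *)

(** An empirical strategy changes only in a deliberate round, and then by the best reply to the
    current profile; once the clocks are controlled, everything is pathwise and deterministic. The
    clocks agree only up to o(l), an error that may be unbounded, so each estimate charges it
    explicitly: Robinson's bound has an error [C * (D + 1)] with [C] independent of the
    desynchronization [D], and a phase carries a parameter [eta] dominating all relative errors.

    In 2 x m games a phase may lose potential of order [eta], and these losses need not be summable.
    They are beaten by the fixed gain of a long phase, except while [p] lingers near a point where
    player 2 switches replies. There are finitely many such points, so barriers for [F] can be
    placed between their values.

    For the probability, the history of finitely many rounds takes finitely many values, so a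
    conditional probability is one number per atom. Cubes are used because a second moment at most
    m^3 divided by m^5 is summable: the deviation is O(m^(5/2)), hence o(m^3), while the ratio of
    consecutive cubes tends to 1. *)

Section Clocks.
Context {R : realFieldType} (x : nat -> bool) (l : nat -> R).

Lemma clock_le (s t : nat) :
  (forall k, (s <= k < t)%N -> l k.+1 = l k + (x k)%:R) -> (s <= t)%N ->
  l s <= l t.
Proof.
elim: t => [|t IH] H; first by rewrite leqn0 => /eqP ->.
rewrite leq_eqVlt => /predU1P[->//|st].
rewrite (H t); last by rewrite -ltnS st ltnS leqnn.
apply: (@le_trans _ _ (l t)); last by case: (x t) => /=; lra.
by apply: IH st => k /andP[sk kt]; apply: H; rewrite sk ltnS ltnW.
Qed.

Lemma clock_sub_sum (s t : nat) :
  (forall k, (s <= k < t)%N -> l k.+1 = l k + (x k)%:R) -> (s <= t)%N ->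
  l t - l s = \sum_(s <= k < t) (x k)%:R.
Proof.
move=> H st; rewrite -telescope_sumr //; apply: eq_big_nat => k /H ->.
by rewrite addrAC subrr add0r.
Qed.

(* Clocks advance by at most one, so every amount [L] of elapsed time is
   attained up to one unit. *)
Lemma clock_split (s t : nat) (L : R) :
  (forall k, (s <= k < t)%N -> l k.+1 = l k + (x k)%:R) -> (s <= t)%N ->
  0 <= L <= l t - l s ->
  exists2 k, (s <= k <= t)%N & L <= l t - l k <= L + 1.
Proof.
move=> H st; move Em : (t - s)%N => m; elim: m s H st Em => [|m IH] s H st Em HL.
  have {}st : s = t by lia.
  by exists s; [rewrite st !leqnn|move: HL; rewrite st subrr; lra].
have st' : (s < t)%N by lia.
have Hs := H s; rewrite leqnn st' /= in Hs; move: (Hs isT) => {}Hs.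
have [L1|L1] := leP L (l t - l s.+1); last first.
  exists s; first by rewrite leqnn.
  by move: Hs HL L1; case: (x s) => /=; lra.
have [||||k /andP[sk kt] Hk] := IH s.+1 => //; last 1 first.
- by exists k => //; rewrite kt andbT ltnW.
- by move=> k /andP[sk kt]; apply: H; rewrite kt ltnW.
- by lia.
- by lra.
Qed.

End Clocks.

Lemma sub_range (s s' t T' T : nat) :
  (s <= s')%N -> (T' <= T)%N -> (s' <= t <= T')%N -> (s <= t <= T)%N.
Proof. by lia. Qed.

Section Robinson.
Context {R : realFieldType} {Y1 Y2 : finType} (A : Y1 -> Y2 -> R) (K : R).
Hypothesis A_le : forall y z, `|A y z| <= K.

(** [V] and [U] are cumulative, not averaged, payoffs: the row player maximizes [V] on [S1], the
    column player minimizes [U] on [S2]. Their values at [s] are arbitrary, so a path can be cut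
    anywhere and restarted with fewer actions. *)
Record fp_path (S1 : {set Y1}) (S2 : {set Y2}) (s T : nat)
    (r : nat -> Y1) (c : nat -> Y2) (x1 x2 : nat -> bool) (l1 l2 : nat -> R)
    (V : nat -> Y1 -> R) (U : nat -> Y2 -> R) : Prop := FpPath {
  fp_path_le : (s <= T)%N;
  fp_path_l1 : forall t, (s <= t < T)%N -> l1 t.+1 = l1 t + (x1 t)%:R;
  fp_path_l2 : forall t, (s <= t < T)%N -> l2 t.+1 = l2 t + (x2 t)%:R;
  fp_path_V : forall t y, (s <= t < T)%N ->
    V t.+1 y = V t y + (x2 t)%:R * A y (c t);
  fp_path_U : forall t z, (s <= t < T)%N ->
    U t.+1 z = U t z + (x1 t)%:R * A (r t) z;
  fp_path_r : forall t, (s <= t <= T)%N ->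
    r t \in S1 /\ forall y, y \in S1 -> V t y <= V t (r t);
  fp_path_c : forall t, (s <= t <= T)%N ->
    c t \in S2 /\ forall z, z \in S2 -> U t (c t) <= U t z }.

Lemma fp_path_sub S1 S2 s T r c x1 x2 l1 l2 V U s' T' :
  fp_path S1 S2 s T r c x1 x2 l1 l2 V U ->
  (s <= s')%N -> (s' <= T')%N -> (T' <= T)%N ->
  fp_path S1 S2 s' T' r c x1 x2 l1 l2 V U.
Proof.
case=> _ H1 H2 H3 H4 H5 H6 ss sT TT; split=> //.
- by move=> t /andP[a b]; apply: H1; lia.
- by move=> t /andP[a b]; apply: H2; lia.
- by move=> t y /andP[a b]; apply: H3; lia.
- by move=> t y /andP[a b]; apply: H4; lia.
- by move=> t /andP[a b]; apply: H5; lia.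
- by move=> t /andP[a b]; apply: H6; lia.
Qed.

Section Path.
Context {S1 : {set Y1}} {S2 : {set Y2}} {s T : nat}
  {r : nat -> Y1} {c : nat -> Y2} {x1 x2 : nat -> bool} {l1 l2 : nat -> R}
  {V : nat -> Y1 -> R} {U : nat -> Y2 -> R}.
Hypothesis H : fp_path S1 S2 s T r c x1 x2 l1 l2 V U.

Let K0 : 0 <= K.
Proof. by apply: le_trans (A_le (r 0%N) (c 0%N)). Qed.

Lemma fp_path_V_var t y : (s <= t <= T)%N ->
  `|V T y - V t y| <= K * (l2 T - l2 t).
Proof.
move=> /andP[st tT]; have [_ Hl1 Hl2 HV _ _ _] := fp_path_sub H st tT (leqnn T).
rewrite (clock_sub_sum Hl2 tT) -(telescope_sumr (fun k => V k y)) //.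
apply: le_trans (ler_norm_sum _ _ _) _; rewrite mulr_sumr.
apply: ler_sum_nat => k /HV -> ; rewrite addrAC subrr add0r.
by case: (x2 k); rewrite ?mul1r ?mul0r ?normr0 ?mulr1 ?mulr0.
Qed.

Lemma fp_path_U_var t z : (s <= t <= T)%N ->
  `|U T z - U t z| <= K * (l1 T - l1 t).
Proof.
move=> /andP[st tT]; have [_ Hl1 Hl2 _ HU _ _] := fp_path_sub H st tT (leqnn T).
rewrite (clock_sub_sum Hl1 tT) -(telescope_sumr (fun k => U k z)) //.
apply: le_trans (ler_norm_sum _ _ _) _; rewrite mulr_sumr.
apply: ler_sum_nat => k /HU -> ; rewrite addrAC subrr add0r.
by case: (x1 k); rewrite ?mul1r ?mul0r ?normr0 ?mulr1 ?mulr0.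
Qed.

(** The action that is best at [T] was already available at [s], and no component of [V] or [U]
    moves by more than [K] per tick of the opposing clock. *)
Lemma fp_path_gap_trivial :
  V T (r T) - U T (c T) <=
  V s (r s) - U s (c s) + K * ((l1 T - l1 s) + (l2 T - l2 s)).
Proof.
have sT := fp_path_le H.
have sI : (s <= s <= T)%N by rewrite leqnn.
have TI : (s <= T <= T)%N by rewrite leqnn sT.
have h1 := fp_path_V_var (r T) sI; have h2 := fp_path_U_var (c T) sI.
have h3 := (fp_path_r H sI).2 _ (fp_path_r H TI).1.
have h4 := (fp_path_c H sI).2 _ (fp_path_c H TI).1.
by move: h1 h2 h3 h4; rewrite !ler_norml; lra.
Qed.

(* If every action is a best reply at some time of [s', T], then at time [T] all
   components of V agree up to the length of that block, and likewise for U;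
   then both max V and min U are compared with the bilinear form evaluated at
   the two empirical play counts. *)
Lemma fp_path_gap_eligible (s' : nat) (D : R) :
  (s <= s' <= T)%N -> 1 <= l1 T - l1 s ->
  `|(l1 T - l1 s) - (l2 T - l2 s)| <= D ->
  (forall y, y \in S1 -> exists2 t, (s' <= t <= T)%N & V t (r t) <= V t y) ->
  (forall z, z \in S2 -> exists2 t, (s' <= t <= T)%N & U t z <= U t (c t)) ->
  V T (r T) - U T (c T) <=
  V s (r s) - U s (c s) + 4 * K * ((l1 T - l1 s') + (l2 T - l2 s'))
   + 5 * K * D.
Proof.
move=> /andP[ss' s'T] N1 HD E1 E2.
have sT := fp_path_le H.
have sI : (s <= s <= T)%N by rewrite leqnn.
have TI : (s <= T <= T)%N by rewrite leqnn sT.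
set d1 := l1 T - l1 s'; set d2 := l2 T - l2 s'.
have d10 : 0 <= d1.
  rewrite subr_ge0; apply: (clock_le (x := x1)) s'T => k hk.
  by apply: (fp_path_l1 H); lia.
have d20 : 0 <= d2.
  rewrite subr_ge0; apply: (clock_le (x := x2)) s'T => k hk.
  by apply: (fp_path_l2 H); lia.
have rT t : (s <= t <= T)%N -> r t \in S1 by case/(fp_path_r H).
have cT t : (s <= t <= T)%N -> c t \in S2 by case/(fp_path_c H).
have lV y : y \in S1 -> V T (r T) - 2 * K * d2 <= V T y.
  move=> yS; have [t /andP[s't tT] ht] := E1 _ yS.
  have tI : (s <= t <= T)%N by lia.
  have tt : l2 s' <= l2 t.
    by apply: (clock_le (x := x2)) s't => k hk; apply: (fp_path_l2 H); lia.
  have := fp_path_V_var y tI; have := fp_path_V_var (r T) tI.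
  have := (fp_path_r H tI).2 _ (rT _ TI).
  have : K * (l2 T - l2 t) <= K * d2 by rewrite ler_wpM2l // /d2; lra.
  by rewrite !ler_norml; lra.
have lU z : z \in S2 -> U T z <= U T (c T) + 2 * K * d1.
  move=> zS; have [t /andP[s't tT] ht] := E2 _ zS.
  have tI : (s <= t <= T)%N by lia.
  have tt : l1 s' <= l1 t.
    by apply: (clock_le (x := x1)) s't => k hk; apply: (fp_path_l1 H); lia.
  have := fp_path_U_var z tI; have := fp_path_U_var (c T) tI.
  have := (fp_path_c H tI).2 _ (cT _ TI).
  have : K * (l1 T - l1 t) <= K * d1 by rewrite ler_wpM2l // /d1; lra.
  by rewrite !ler_norml; lra.
set n1 := l1 T - l1 s in N1 HD *; set n2 := l2 T - l2 s in HD.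
set B := \sum_(s <= k < T) \sum_(s <= m < T)
          (x1 k)%:R * ((x2 m)%:R * A (r k) (c m)).
have n1E : n1 = \sum_(s <= k < T) (x1 k)%:R by apply: clock_sub_sum (fp_path_l1 H) _.
have n2E : n2 = \sum_(s <= k < T) (x2 k)%:R by apply: clock_sub_sum (fp_path_l2 H) _.
have [_ rs] := fp_path_r H sI; have [_ cs] := fp_path_c H sI.
have B1 : n1 * (V T (r T) - 2 * K * d2 - V s (r s)) <= B.
  rewrite n1E mulr_suml; apply: ler_sum_nat => k /andP[sk kT].
  rewrite -mulr_sumr; case: (x1 k); rewrite ?mul0r // !mul1r.
  have kI : (s <= k <= T)%N by rewrite sk ltnW.
  have -> : \sum_(s <= m < T) (x2 m)%:R * A (r k) (c m) = V T (r k) - V s (r k).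
    rewrite -(telescope_sumr (fun m => V m (r k))) //.
    by apply: eq_big_nat => m /(fp_path_V H) ->; rewrite addrAC subrr add0r.
  have := lV _ (rT _ kI); have := rs _ (rT _ kI); lra.
have B2 : B <= n2 * (U T (c T) + 2 * K * d1 - U s (c s)).
  rewrite /B exchange_big /= n2E mulr_suml; apply: ler_sum_nat => m /andP[sm mT].
  under eq_bigr do rewrite mulrCA.
  rewrite -mulr_sumr; case: (x2 m); rewrite ?mul0r // !mul1r.
  have mI : (s <= m <= T)%N by rewrite sm ltnW.
  have -> : \sum_(s <= k < T) (x1 k)%:R * A (r k) (c m) = U T (c m) - U s (c m).
    rewrite -(telescope_sumr (fun k => U k (c m))) //.
    by apply: eq_big_nat => k /(fp_path_U H) ->; rewrite addrAC subrr add0r.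
  have := lU _ (cT _ mI); have := cs _ (cT _ mI); lra.
set P := V T (r T) - _ - _ in B1; set Q := U T (c T) + _ - _ in B2.
have Qle : `|Q| <= 5 * K * n1.
  have := fp_path_U_var (c T) sI; have := fp_path_U_var (c s) sI.
  have := cs _ (cT _ TI); have := (fp_path_c H TI).2 _ (cT _ sI).
  have : K * d1 <= K * n1.
    rewrite ler_wpM2l // /d1 /n1 lerD2l lerN2.
    by apply: (clock_le (x := x1)) ss' => k hk; apply: (fp_path_l1 H); lia.
  have : 0 <= K * d1 by rewrite mulr_ge0.
  rewrite /Q -/n1 !ler_norml; lra.
(* Here [n1 * P <= B <= n2 * Q]. Exchanging [n2] for [n1] costs at most [D] times the size of [Q],
   which is of order [n1]; after division by [n1] only a multiple of [D] remains. *)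
have PQ : P <= Q + 5 * K * D.
  have n10 : 0 < n1 by lra.
  rewrite -(ler_pM2l n10); apply: le_trans B1 _; apply: le_trans B2 _.
  have : (n2 - n1) * Q <= D * (5 * K * n1).
    apply: le_trans (ler_norm _) _; rewrite normrM ler_pM //.
    by rewrite distrC.
  lra.
have : K * d1 >= 0 by rewrite mulr_ge0.
have : K * d2 >= 0 by rewrite mulr_ge0.
move: PQ; rewrite /P /Q; lra.
Qed.

End Path.

(* Asynchronous version of Robinson's theorem.  Over a block on which
   some action is never a best reply, that action can be removed, so the gap
   grows slowly by induction on the number of actions; the last block on which
   all actions are best replies resets the gap. *)
Lemma robinson (S1 : {set Y1}) (S2 : {set Y2}) (e : R) : 0 < e ->
  exists C : R, forall s T r c x1 x2 l1 l2 V U (D : R),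
    fp_path S1 S2 s T r c x1 x2 l1 l2 V U ->
    (forall t t', (s <= t <= T)%N -> (s <= t' <= T)%N ->
      `|(l1 t - l1 t') - (l2 t - l2 t')| <= D) ->
    V T (r T) - U T (c T) <=
    V s (r s) - U s (c s) + e * (l1 T - l1 s) + C * (D + 1).
Proof.
move Em : (#|S1| + #|S2|)%N => m; elim/ltn_ind: m S1 S2 Em e => m IH S1 S2 Em e e0.
(* There are finitely many pairs of action sets, so one constant [C'] serves all smaller ones. It is
   taken at the rate [e / 2]; the other half of the rate will absorb [C'] itself. *)
have {}IH : exists2 C' : R, 0 <= C' & forall (S1' : {set Y1}) (S2' : {set Y2}),
    (#|S1'| + #|S2'| < m)%N -> S1' \subset S1 -> S2' \subset S2 ->
    forall s T r c x1 x2 l1 l2 V U (D : R),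
    fp_path S1' S2' s T r c x1 x2 l1 l2 V U ->
    (forall t t', (s <= t <= T)%N -> (s <= t' <= T)%N ->
      `|(l1 t - l1 t') - (l2 t - l2 t')| <= D) ->
    V T (r T) - U T (c T) <=
    V s (r s) - U s (c s) + e / 2 * (l1 T - l1 s) + C' * (D + 1).
  have e20 : 0 < e / 2 by lra.
  have /choice[C' HC'] : forall S : {set Y1} * {set Y2}, exists C : R,
      (#|S.1| + #|S.2| < m)%N -> forall s T r c x1 x2 l1 l2 V U (D : R),
      fp_path S.1 S.2 s T r c x1 x2 l1 l2 V U ->
      (forall t t', (s <= t <= T)%N -> (s <= t' <= T)%N ->
        `|(l1 t - l1 t') - (l2 t - l2 t')| <= D) ->
      V T (r T) - U T (c T) <=
      V s (r s) - U s (c s) + e / 2 * (l1 T - l1 s) + C * (D + 1).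
    case=> S1' S2' /=; have [lt|_] := boolP (#|S1'| + #|S2'| < m)%N; last by exists 0.
    by have [C HC] := IH _ lt S1' S2' erefl _ e20; exists C.
  exists (\sum_S `|C' S|); first by apply: sumr_ge0.
  move=> S1' S2' lt _ _ s T r c x1 x2 l1 l2 V U D H HD.
  apply: le_trans (HC' (S1', S2') lt _ _ _ _ _ _ _ _ _ _ _ H HD) _.
  rewrite lerD2l ler_wpM2r //.
    have := HD s s; rewrite leqnn (fp_path_le H) => /(_ isT isT).
    by rewrite !subrr normr0; lra.
  rewrite (bigD1 (S1', S2')) //=; apply: le_trans (ler_norm _) _.
  by rewrite lerDl sumr_ge0.
case: IH => C' C'0 IH.
have [K0|K0] := leP 0 K; last first.
  exists 0 => s T r c *; exfalso.
  by have := le_trans (normr_ge0 _) (A_le (r 0%N) (c 0%N)); lra.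
(* Blocks will have length about [L * (D + 1)], long enough for the error [C' * (D + 1)] of one
   removal to be paid by the spare rate [e / 2]. *)
have [L [L1 LC]] : exists L : R, 1 <= L /\ C' <= e / 2 * L.
  have Ce : 0 <= C' / e by rewrite divr_ge0 // ltW.
  exists (1 + 2 * (C' / e)); split; first by lra.
  have -> : e / 2 * (1 + 2 * (C' / e)) = e / 2 + C' by field; rewrite gt_eqF.
  by lra.
exists (9 * K * (2 * L + 3)) => s T r c x1 x2 l1 l2 V U D H HD.
(* Inner induction on the end of the path: blocks are peeled off from the right until the rest is
   short or a block is met on which every action is at some time a best reply. *)
move: H HD; elim/ltn_ind: T => T IHT H HD.
have sT := fp_path_le H.
have D0 : 0 <= D.
  by have := HD s s; rewrite leqnn sT => /(_ isT isT); rewrite !subrr normr0; lra.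
have LD : L <= L * (D + 1) by rewrite ler_peMr //; lra.
have KLD : 0 <= K * (L * (D + 1)) by rewrite mulr_ge0 //; lra.
have KD : 0 <= K * D by rewrite mulr_ge0 //; lra.
have mono1 t t' : (s <= t)%N -> (t <= t')%N -> (t' <= T)%N -> l1 t <= l1 t'.
  move=> st tt' t'T.
  by apply: (clock_le (x := x1)) tt' => k hk; apply: (fp_path_l1 H); lia.
have dist21 t : (s <= t <= T)%N -> l2 T - l2 t <= l1 T - l1 t + D.
  move=> tI; have := HD T t; rewrite sT leqnn tI => /(_ isT isT).
  by rewrite ler_norml; lra.
have [small|big] := ltP (l1 T - l1 s) (L * (D + 1)).
  apply: le_trans (fp_path_gap_trivial H) _.
  have h1 := dist21 s (introT andP (conj (leqnn s) sT)).
  have h2 := mono1 s T (leqnn s) sT (leqnn T).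
  have : 0 <= e * (l1 T - l1 s) by rewrite mulr_ge0 ?subr_ge0 // ltW.
  have : K * ((l1 T - l1 s) + (l2 T - l2 s)) <= K * (2 * (L * (D + 1)) + D).
    by rewrite ler_wpM2l //; lra.
  lra.
have [|s' /andP[ss' s'T] Hs'] := clock_split (fp_path_l1 H) sT (L := L * (D + 1)).
  by rewrite big andbT; lra.
have s'I : (s <= s' <= T)%N by rewrite ss' s'T.
have s'ltT : (s' < T)%N.
  rewrite ltn_neqAle s'T andbT; apply/eqP => E.
  by move: Hs'; rewrite E subrr; lra.
have Hsub := fp_path_sub H ss' s'T (leqnn T).
have HDsub : forall t t', (s' <= t <= T)%N -> (s' <= t' <= T)%N ->
    `|(l1 t - l1 t') - (l2 t - l2 t')| <= D.
  by move=> t t' h h'; apply: HD; apply: (sub_range ss' (leqnn T)).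
have removal : V T (r T) - U T (c T) <= V s' (r s') - U s' (c s') +
    e / 2 * (l1 T - l1 s') + C' * (D + 1) ->
    V T (r T) - U T (c T) <= V s (r s) - U s (c s) + e * (l1 T - l1 s)
      + 9 * K * (2 * L + 3) * (D + 1).
  move=> h; have := IHT s' s'ltT (fp_path_sub H (leqnn s) ss' s'T) _.
  have HD2 : forall t t', (s <= t <= s')%N -> (s <= t' <= s')%N ->
    `|(l1 t - l1 t') - (l2 t - l2 t')| <= D by move=> t t' ht ht'; apply: HD; apply: (sub_range (leqnn s) s'T).
  move=> /(_ HD2).
  have : C' * (D + 1) <= e / 2 * (L * (D + 1)).
    by rewrite mulrA ler_wpM2r //; lra.
  have : e / 2 * (L * (D + 1)) <= e / 2 * (l1 T - l1 s').
    by rewrite ler_wpM2l //; lra.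
  lra.
(* If some action is never a best reply on the last block, that block is also a path of the game
   without this action. *)
have [E1|/existsNP[y /not_implyP[yS NE1]]] := pselect (forall y, y \in S1 ->
    exists2 t, (s' <= t <= T)%N & V t (r t) <= V t y); last first.
  have Hrem : fp_path (S1 :\ y) S2 s' T r c x1 x2 l1 l2 V U.
    case: (Hsub) => ? h1 h2 h3 h4 h5 h6; split=> // t tI.
    have [rS rmax] := h5 t tI; split; last by move=> y' /setD1P[_]; apply: rmax.
    rewrite in_setD1 rS andbT; apply/eqP => E; apply: NE1; exists t => //.
    by rewrite -E.
  apply: removal; apply: IH Hrem HDsub; rewrite ?subD1set //.
  by rewrite -Em (cardsD1 y S1) yS add1n addSn.
have [E2|/existsNP[z /not_implyP[zS NE2]]] := pselect (forall z, z \in S2 ->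
    exists2 t, (s' <= t <= T)%N & U t z <= U t (c t)); last first.
  have Hrem : fp_path S1 (S2 :\ z) s' T r c x1 x2 l1 l2 V U.
    case: (Hsub) => ? h1 h2 h3 h4 h5 h6; split=> // t tI.
    have [cS cmin] := h6 t tI; split; last by move=> z' /setD1P[_]; apply: cmin.
    rewrite in_setD1 cS andbT; apply/eqP => E; apply: NE2; exists t => //.
    by rewrite -E.
  apply: removal; apply: IH Hrem HDsub; rewrite ?subD1set //.
  by rewrite -Em (cardsD1 z S2) zS add1n addnS.
have := fp_path_gap_eligible H s'I _ _ E1 E2 (D := D).
have -> : 1 <= l1 T - l1 s by lra.
have HDTs : `|(l1 T - l1 s) - (l2 T - l2 s)| <= D by apply: HD; rewrite leqnn sT.
move=> /(_ isT HDTs) h; apply: le_trans h _.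
have : 0 <= e * (l1 T - l1 s) by apply: mulr_ge0; lra.
have : K * ((l1 T - l1 s') + (l2 T - l2 s')) <= K * (2 * (L * (D + 1) + 1) + D).
  have h21 := dist21 s' s'I; rewrite ler_wpM2l //; lra.
lra.
Qed.

End Robinson.

(** * One phase of a 2 x m play *)

Section NatRangeSums.
Context {R : realFieldType}.

(** Applied to the visits of [p] to a level and to the uses of a reply: all of them lie between the
    first and the last one, where interval sums telescope. *)
Lemma first_last (P : pred nat) (s t : nat) :
  (forall k, (s <= k < t)%N -> ~~ P k) \/
  exists f g, [/\ (s <= f <= g)%N, (g < t)%N, P f, P g &
    forall k, (s <= k < t)%N -> P k -> (f <= k <= g)%N].
Proof.
have [/existsP[k0 /andP[sk0 Pk0]]|/existsPn N] :=
  boolP [exists k : 'I_t, (s <= k)%N && P k]; last first.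
  left=> k /andP[sk kt]; apply/negP => Pk.
  by have := N (Ordinal kt); rewrite /= sk Pk.
right; pose Q k := [&& (s <= k)%N, (k < t)%N & P k].
have exQ : exists k, Q k by exists k0; rewrite /Q sk0 ltn_ord Pk0.
have boundQ k : Q k -> (k <= t)%N by case/and3P => _ /ltnW.
case: (ex_minnP exQ) => f /and3P[sf ft Pf] fmin.
case: (ex_maxnP exQ boundQ) => g /and3P[sg gt Pg] gmax.
exists f, g; split=> //; first by rewrite sf fmin // /Q sg gt.
by move=> k /andP[sk kt] Pk; rewrite fmin ?gmax // /Q sk kt.
Qed.

Lemma first_crossing (P : pred nat) (s t : nat) : (s <= t)%N -> P t ->
  exists k, [/\ (s <= k <= t)%N, P k & forall i, (s <= i < k)%N -> ~~ P i].
Proof.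
move=> st Pt; pose Q k := (s <= k)%N && P k.
have exQ : exists k, Q k by exists t; rewrite /Q st.
case: (ex_minnP exQ) => k /andP[sk Pk] kmin; exists k; split=> //.
  by rewrite sk kmin // /Q st.
by move=> i /andP[si ik]; apply/negP => Pi; have := kmin i; rewrite /Q si Pi leqNgt ik => /(_ isT).
Qed.

Lemma ler_sum_subrange (f : nat -> R) (P : pred nat) (s t a b : nat) :
  (s <= a)%N -> (a <= b)%N -> (b <= t)%N ->
  (forall k, (a <= k < b)%N -> 0 <= f k) ->
  (forall k, (s <= k < t)%N -> P k -> (a <= k < b)%N) ->
  \sum_(s <= k < t | P k) f k <= \sum_(a <= k < b) f k.
Proof.
move=> sa ab bt f0 HP.
rewrite (big_cat_nat (n := a)) ?(leq_trans ab) //= (big_cat_nat (n := b) (p := t)) //=.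
rewrite [X in X + _]big_nat_cond big_pred0 ?add0r; last first.
  move=> k; apply/negP => /andP[/andP[sk ka] Pk].
  by have := HP k; rewrite sk (leq_trans ka (leq_trans ab bt)) leqNgt ka => /(_ isT Pk).
rewrite [X in _ + X]big_nat_cond [X in _ + X]big_pred0 ?addr0; last first.
  move=> k; apply/negP => /andP[/andP[bk kt] Pk].
  have := HP k; rewrite (leq_trans sa (leq_trans ab bk)) kt => /(_ isT Pk).
  by rewrite ltnNge bk andbF.
rewrite big_mkcond big_nat_cond [leRHS]big_nat_cond; apply: ler_sum => k /andP[kab _].
by case: ifP => // _; apply: f0.
Qed.

Lemma sum_one_nonzero_le (f : nat -> R) (b : R) (s t : nat) :
  0 <= b -> (forall k, (s <= k < t)%N -> f k <= b) ->
  (forall k k', (s <= k)%N -> (k < k')%N -> (k' < t)%N -> f k' != 0 -> f k = 0) ->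
  \sum_(s <= k < t) f k <= b.
Proof.
move=> b0; elim: t => [|t IH] fb H; first by rewrite big_geq.
have [st|ts] := leqP s t; last by rewrite big_geq.
rewrite big_nat_recr //=; have [->|ft] := eqVneq (f t) 0.
  rewrite addr0; apply: IH => [k /andP[sk kt]|k k' sk kk' kt].
    by apply: fb; rewrite sk ltnS ltnW.
  by apply: H => //; rewrite ltnS ltnW.
rewrite big_nat_cond big1 ?add0r ?fb ?st ?ltnSn // => k /andP[/andP[sk kt] _].
exact: (H k t).
Qed.

End NatRangeSums.

Section Phase.
Context {R : realFieldType} {J : finType}.
(** [I j r] stands for: reply [j] of player 2 is best when the first action has weight [r]. By
    [I_inside], no other reply is best strictly between two points of its region. [alpha j] is the
    advantage of the first action against [j], and [F] is a primitive of [alpha] along the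
    regions. *)
Context (I : J -> R -> Prop) (alpha : J -> R) (a c0 L : R) (F : R -> R).
Hypothesis I_inside : forall i j r s t, r < s -> s < t ->
  I j r -> I j t -> I i s -> i = j.
Hypothesis alpha_le : forall j, `|alpha j| <= a.
Hypothesis alpha_ge : forall j, c0 <= `|alpha j|.
Hypothesis c0_gt0 : 0 < c0.
Hypothesis F_lip : forall r s, `|F s - F r| <= L * `|s - r|.
Hypothesis F_slope : forall j r s, I j r -> I j s -> F s - F r = alpha j * (s - r).

(* A stretch [s, e] of the play of a 2 x m game during which player 1 only
   plays her first action: [p] is her empirical weight on it, so that
   [Q = l1 * (1 - p)] is constant; [xi] is [l2] times her empirical payoff
   advantage of the first action, [j] the best reply of player 2. *)
Record phase (s e : nat) (x1 x2 : nat -> bool) (j : nat -> J)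
    (l1 l2 xi p : nat -> R) (Q eta : R) : Prop := Phase {
  ph_le : (s <= e)%N;
  ph_l1 : forall k, (s <= k < e)%N -> l1 k.+1 = l1 k + (x1 k)%:R;
  ph_l2 : forall k, (s <= k < e)%N -> l2 k.+1 = l2 k + (x2 k)%:R;
  ph_xi : forall k, (s <= k < e)%N -> xi k.+1 = xi k + (x2 k)%:R * alpha (j k);
  ph_I : forall k, (s <= k <= e)%N -> I (j k) (p k);
  ph_p : forall k, (s <= k <= e)%N -> p k = 1 - Q / l1 k;
  ph_Q : 0 < Q <= l1 s;
  ph_sync : forall k, (s <= k <= e)%N -> `|l1 k - l2 k| <= eta * l1 k;
  ph_eta : 1 <= eta * l1 s;
  ph_xi_ge : forall k, (s <= k <= e)%N -> - (eta * l1 k) <= xi k;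
  ph_xi_le : xi s <= eta * l1 s }.

Section OnePhase.
Context {s e : nat} {x1 x2 : nat -> bool} {j : nat -> J}
  {l1 l2 xi p : nat -> R} {Q eta : R}.
Hypothesis H : phase s e x1 x2 j l1 l2 xi p Q eta.

Let m : R := #|J|%:R.

Let se : (s <= e)%N. Proof. exact: ph_le H. Qed.

Let sI : (s <= s <= e)%N. Proof. by rewrite leqnn. Qed.

Let l1_ge k : (s <= k <= e)%N -> l1 s <= l1 k.
Proof.
move=> /andP[sk ke]; apply: (clock_le (x := x1)) sk => i /andP[si ik].
by apply: (ph_l1 H); rewrite si (leq_trans ik).
Qed.

Let l1_le k k' : (s <= k)%N -> (k <= k')%N -> (k' <= e)%N -> l1 k <= l1 k'.
Proof.
move=> sk kk' k'e; apply: (clock_le (x := x1)) kk' => i /andP[ki ik].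
by apply: (ph_l1 H); rewrite (leq_trans sk) // (leq_trans ik).
Qed.

Let Q_gt0 : 0 < Q. Proof. by case/andP: (ph_Q H). Qed.

Let l1s_gt0 : 0 < l1 s. Proof. by case/andP: (ph_Q H); apply: lt_le_trans. Qed.

Let l1_gt0 k : (s <= k <= e)%N -> 0 < l1 k.
Proof. by move=> /l1_ge; apply: lt_le_trans. Qed.

Let Q_le k : (s <= k <= e)%N -> Q <= l1 k.
Proof. by move=> /l1_ge; apply: le_trans; case/andP: (ph_Q H). Qed.

Let eta_gt0 : 0 < eta.
Proof.
rewrite -(pmulr_lgt0 eta l1s_gt0); apply: lt_le_trans (ph_eta H); exact: ltr01.
Qed.

Let p_diff k k' : (s <= k <= e)%N -> (s <= k' <= e)%N ->
  p k' - p k = Q * (l1 k' - l1 k) / (l1 k * l1 k').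
Proof.
move=> ks k's; rewrite (ph_p H ks) (ph_p H k's).
by field; rewrite !gt_eqF ?l1_gt0.
Qed.

Lemma phase_mono k k' : (s <= k)%N -> (k <= k')%N -> (k' <= e)%N -> p k <= p k'.
Proof.
move=> sk kk' k'e; have ks : (s <= k <= e)%N by rewrite sk (leq_trans kk').
have k's : (s <= k' <= e)%N by rewrite (leq_trans sk).
rewrite -subr_ge0 p_diff //; apply: divr_ge0; apply: mulr_ge0.
- exact: ltW.
- by rewrite subr_ge0 l1_le.
- by rewrite ltW ?l1_gt0.
- by rewrite ltW ?l1_gt0.
Qed.

Let p_inj k k' : (s <= k <= e)%N -> (s <= k' <= e)%N -> p k = p k' -> l1 k = l1 k'.
Proof.
move=> ks k's pp; have := p_diff ks k's; rewrite pp subrr => /esym/eqP.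
have den : l1 k * l1 k' != 0 by rewrite gt_eqF // mulr_gt0 ?l1_gt0.
rewrite mulf_eq0 invr_eq0 (negbTE den) orbF mulf_eq0 gt_eqF //= subr_eq0.
by move/eqP.
Qed.

Let p_le1 k : (s <= k <= e)%N -> p k <= 1.
Proof. by move=> ks; rewrite (ph_p H ks) gerBl divr_ge0 // ltW ?l1_gt0. Qed.

Let p_ge0 k : (s <= k <= e)%N -> 0 <= p k.
Proof. by move=> ks; rewrite (ph_p H ks) subr_ge0 ler_pdivrMr ?l1_gt0 // mul1r Q_le. Qed.

Let eta_l1 k : (s <= k <= e)%N -> 1 <= eta * l1 k.
Proof. by move=> ks; apply: le_trans (ph_eta H) _; rewrite ler_pM2l ?l1_ge. Qed.

Let inv_l1_le k : (s <= k <= e)%N -> (l1 k)^-1 <= eta.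
Proof. by move=> ks; rewrite -[leLHS]div1r ler_pdivrMr ?l1_gt0 ?eta_l1. Qed.

Let w k := Q / (l1 k * (l1 k + 1)).

Let p_step k : (s <= k < e)%N -> p k.+1 - p k = (x1 k)%:R * w k.
Proof.
move=> /andP[sk ke]; have kI : (s <= k <= e)%N by rewrite sk ltnW.
have kI' : (s <= k.+1 <= e)%N by rewrite ke andbT ltnW // ltnS.
rewrite p_diff // (ph_l1 H) ?sk // /w; have := l1_gt0 kI.
case: (x1 k) => /= h; last by rewrite addr0 subrr mulr0 !mul0r.
by field; rewrite !gt_eqF //; lra.
Qed.

Let w_ge0 k : (s <= k <= e)%N -> 0 <= w k.
Proof.
move=> kI; have := l1_gt0 kI => h.
by rewrite /w divr_ge0 ?mulr_ge0 ?ltW //; lra.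
Qed.

Let w_le k : (s <= k <= e)%N -> w k <= eta.
Proof.
move=> kI; have h := l1_gt0 kI; apply: le_trans (inv_l1_le kI).
have hQ := Q_le kI.
have h1 : Q * (l1 k + 1)^-1 <= 1 by rewrite ler_pdivrMr ?mul1r; lra.
by rewrite /w invfM mulrCA ler_piMr // invr_ge0 ltW.
Qed.

Let p_step_le k : (s <= k < e)%N -> p k.+1 - p k <= eta.
Proof.
move=> kI; rewrite p_step //; have kI' : (s <= k <= e)%N.
  by case/andP: kI => -> /ltnW.
by case: (x1 k); rewrite ?mul1r ?mul0r ?w_le ?ltW.
Qed.

(** Since [Q > 0], [p] is strictly increasing in [l1], so [l1] takes the same value at any two
    visits to a level, and only the last visit can carry an update. *)
Let level_x1 x t : (t <= e)%N -> \sum_(s <= k < t | p k == x) (x1 k)%:R <= 1 :> R.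
Proof.
move=> te; have [N|[f [g [/andP[sf fg] gt /eqP pf /eqP pg fl]]]] :=
  first_last (fun k => p k == x) s t.
  rewrite big_nat_cond big_pred0 // => k; apply/negP => /andP[/N /negP h1 h2].
  exact: h1.
have gI : (s <= g < e)%N by rewrite (leq_trans sf fg) (leq_trans gt).
have fg1 : (f <= g.+1)%N by rewrite leqW.
apply: le_trans (ler_sum_subrange sf fg1 gt (fun k _ => ler0n _ _) fl) _.
have -> : \sum_(f <= k < g.+1) (x1 k)%:R = l1 g.+1 - l1 f.
  rewrite -(@clock_sub_sum _ x1 l1) // => k /andP[fk kg].
  by apply: (ph_l1 H); rewrite (leq_trans sf) // (leq_trans kg) ?(leq_trans gt).
rewrite (ph_l1 H) // (@p_inj f g) ?pf ?pg //.
- by rewrite addrAC subrr add0r lern1 leq_b1.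
- by rewrite sf (leq_trans fg) // ltnW //; case/andP: gI.
- by case/andP: gI => -> /ltnW.
Qed.

(** Player 2's clock may run on while [p] stands still, but only as far as the two clocks can drift
    apart. *)
Let level_x2 x t : (s <= t <= e)%N ->
  \sum_(s <= k < t | p k == x) (x2 k)%:R <= 1 + 2 * eta * l1 t.
Proof.
move=> /andP[st te].
have tI : (s <= t <= e)%N by rewrite st.
have [N|[f [g [/andP[sf fg] gt /eqP pf /eqP pg fl]]]] :=
  first_last (fun k => p k == x) s t.
  rewrite big_nat_cond big_pred0 => [|k].
    have : 0 < eta * l1 t by apply: mulr_gt0 => //; exact: l1_gt0.
    by lra.
  by apply/negP => /andP[/N /negP h1 h2]; exact: h1.
have gI : (s <= g < e)%N by rewrite (leq_trans sf fg) (leq_trans gt).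
have fI : (s <= f <= e)%N by rewrite sf (leq_trans fg) // ltnW //; case/andP: gI.
have gI' : (s <= g <= e)%N by case/andP: gI => -> /ltnW.
have g1I : (s <= g.+1 <= e)%N by case/andP: gI => h ->; rewrite andbT ltnW.
have fg1 : (f <= g.+1)%N by rewrite leqW.
apply: le_trans (ler_sum_subrange sf fg1 gt (fun k _ => ler0n _ _) fl) _.
have -> : \sum_(f <= k < g.+1) (x2 k)%:R = l2 g.+1 - l2 f.
  rewrite -(@clock_sub_sum _ x2 l2) // => k /andP[fk kg].
  by apply: (ph_l2 H); rewrite (leq_trans sf) // (leq_trans kg) ?(leq_trans gt).
have h1 : l1 g.+1 <= l1 f + 1.
  rewrite (ph_l1 H) // (@p_inj f g) ?pf ?pg //.
  by rewrite lerD2l lern1 leq_b1.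
have h2 := ph_sync H fI; have h3 := ph_sync H g1I.
have h4 : eta * l1 g.+1 <= eta * l1 t.
  rewrite ler_pM2l // l1_le //; by case/andP: g1I.
have h5 : eta * l1 f <= eta * l1 t.
  by rewrite ler_pM2l // l1_le // (leq_trans fg) // ltnW.
by move: h2 h3; rewrite !ler_norml; lra.
Qed.

(* On a range delimited by two uses of the best reply [i], other
   replies occur only at the two extreme positions. *)
Let mismatch (z : nat -> R) i f g t : (s <= f)%N -> (f <= g)%N -> (g < t)%N ->
  (t <= e)%N -> (forall k, 0 <= z k) -> j f = i -> j g = i ->
  \sum_(f <= k < g.+1 | j k != i) z k <=
  \sum_(s <= k < t | p k == p f) z k + \sum_(s <= k < t | p k == p g) z k.
Proof.
move=> sf fg gt te z0 jf jg.
rewrite big_mkcond [X in _ <= X + _]big_mkcond [X in _ <= _ + X]big_mkcond /=.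
rewrite -big_split /=.
rewrite [leRHS](big_cat_nat (n := f)) ?(leq_trans fg (ltnW gt)) //=.
rewrite [X in _ <= _ + X](big_cat_nat (n := g.+1)) ?(leq_trans fg) //=.
have pos k : 0 <= (if p k == p f then z k else 0) + (if p k == p g then z k else 0).
  by apply: addr_ge0; case: ifP.
apply: ler_wpDl; first by apply: sumr_ge0.
apply: ler_wpDr; first by apply: sumr_ge0.
apply: ler_sum_nat => k /andP[fk kg].
case: ifPn => // jk; have [pf|pf] := eqVneq (p k) (p f).
  by rewrite lerDl; case: ifP.
have [pg|pg] := eqVneq (p k) (p g); first by rewrite add0r.
have kI : (s <= k <= e)%N.
  by rewrite (leq_trans sf fk) (leq_trans _ te) // (leq_trans _ gt) // ltnW.
have fI : (s <= f <= e)%N by rewrite sf (leq_trans fk) //; case/andP: kI.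
have gI : (s <= g <= e)%N by rewrite (leq_trans sf fg) (leq_trans (ltnW gt)).
case/eqP: jk; apply: (I_inside (r := p f) (s := p k) (t := p g)).
- by rewrite lt_neqAle eq_sym pf phase_mono //; case/andP: kI.
- rewrite lt_neqAle pg phase_mono //; [by case/andP: kI| by case/andP: gI].
- by rewrite -{1}jf; exact: ph_I H _ fI.
- by rewrite -{1}jg; exact: ph_I H _ gI.
- exact: ph_I H _ kI.
Qed.

(** Apart from ties at two extreme positions, the reply [i] is used on one interval of time, where
    the difference of the counts is that of the clocks. The clocks contribute 2 and the ties 4 + 4
    multiples of [eta * l1 t], using [1 <= eta * l1 t]. *)
Let desync i t : (s <= t <= e)%N ->
  `|\sum_(s <= k < t | j k == i) ((x2 k)%:R - (x1 k)%:R)| <= 10 * eta * l1 t.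
Proof.
move=> /andP[st te]; have tI : (s <= t <= e)%N by rewrite st.
have [N|[f [g [/andP[sf fg] gt /eqP jf /eqP jg fl]]]] :=
  first_last (fun k => j k == i) s t.
  rewrite big_nat_cond big_pred0 => [|k].
    have : 0 < eta * l1 t by apply: mulr_gt0 => //; exact: l1_gt0.
    by rewrite normr0; lra.
  by apply/negP => /andP[/N /negP h1 h2]; exact: h1.
have gI : (s <= g < e)%N by rewrite (leq_trans sf fg) (leq_trans gt).
have fI : (s <= f <= e)%N by rewrite sf (leq_trans fg) // ltnW //; case/andP: gI.
have g1I : (s <= g.+1 <= e)%N by case/andP: gI => h ->; rewrite andbT ltnW.
have fgt : (f <= t)%N by rewrite (leq_trans fg) // ltnW.
rewrite (big_cat_nat (n := f)) //= (big_cat_nat (n := g.+1) (p := t)) ?(leq_trans fg) //=.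
rewrite [X in X + _]big_nat_cond big_pred0 ?add0r; last first.
  move=> k; apply/negP => /andP[/andP[sk kf] jk].
  by have := fl k; rewrite sk (leq_trans kf fgt) leqNgt kf => /(_ isT jk).
rewrite [X in _ + X]big_nat_cond [X in _ + X]big_pred0 ?addr0; last first.
  move=> k; apply/negP => /andP[/andP[gk kt] jk].
  have := fl k; rewrite (leq_trans (leq_trans sf fg) (ltnW gk)) kt => /(_ isT jk).
  by case/andP => _; rewrite leqNgt gk.
have split : \sum_(f <= k < g.+1) ((x2 k)%:R - (x1 k)%:R) =
    \sum_(f <= k < g.+1 | j k == i) ((x2 k)%:R - (x1 k)%:R)
  + \sum_(f <= k < g.+1 | j k != i) ((x2 k)%:R - (x1 k)%:R) :> R.
  by rewrite (bigID (fun k => j k == i)).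
have tot : \sum_(f <= k < g.+1) ((x2 k)%:R - (x1 k)%:R) =
    (l2 g.+1 - l2 f) - (l1 g.+1 - l1 f) :> R.
  rewrite sumrB; congr (_ - _); apply/esym; apply: clock_sub_sum.
  - move=> k /andP[fk kg]; apply: (ph_l2 H).
    by rewrite (leq_trans sf) // (leq_trans kg) ?(leq_trans gt).
  - exact: leq_trans fg _.
  - move=> k /andP[fk kg]; apply: (ph_l1 H).
    by rewrite (leq_trans sf) // (leq_trans kg) ?(leq_trans gt).
  - exact: leq_trans fg _.
have err : `|\sum_(f <= k < g.+1 | j k != i) ((x2 k)%:R - (x1 k)%:R)| <=
    2 * (2 + 2 * eta * l1 t) :> R.
  apply: (@le_trans _ _ (\sum_(f <= k < g.+1 | j k != i) ((x1 k)%:R + (x2 k)%:R))).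
    apply: le_trans (ler_norm_sum _ _ _) _; apply: ler_sum => k _.
    by rewrite [leRHS]addrC; apply: le_trans (ler_normB _ _) _; rewrite !normr_nat.
  apply: le_trans (mismatch sf fg gt te _ jf jg) _.
    by move=> k; rewrite addr_ge0.
  rewrite !big_split /=.
  have := level_x1 (p f) te; have := level_x1 (p g) te.
  by have := level_x2 (p f) tI; have := level_x2 (p g) tI; lra.
have h2 := ph_sync H fI; have h3 := ph_sync H g1I.
have h4 : eta * l1 g.+1 <= eta * l1 t.
  by rewrite ler_pM2l // l1_le //; case/andP: g1I.
have h5 : eta * l1 f <= eta * l1 t by rewrite ler_pM2l // l1_le.
have h6 := eta_l1 tI.
move: h2 h3 err split; rewrite tot !ler_norml => /andP[h2 h2'] /andP[h3 h3'] /andP[err err'].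
move: (\sum_(_ <= _ < _ | _ == _) _) => X1; move: (\sum_(_ <= _ < _ | _) _) err err' => X2.
by move=> err err' split; apply/andP; split; lra.
Qed.

(** The increment of [xi] since [s], recomputed with the updates of player 1 in place of those of
    player 2. These are the updates that move [p], so this version can be summed against the steps
    of [p]. *)
Let Hs t : R := \sum_(s <= k < t) (x1 k)%:R * alpha (j k).

Let a_gt0 : 0 < a.
Proof. exact: lt_le_trans c0_gt0 (le_trans (alpha_ge (j s)) (alpha_le (j s))). Qed.

Let m_gt0 : 0 < m.
Proof. by rewrite /m ltr0n; apply/card_gt0P; exists (j s). Qed.

Let C3 : R := 2 + 10 * m * a.

Let C3_gt0 : 0 < C3.
Proof. by have := mulr_gt0 m_gt0 a_gt0; rewrite /C3; lra. Qed.

(** Sorting increments by reply, [xi t - xi s] and [Hs t] differ by the desynchronization over each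
    reply. In [C3], the 2 comes from the bounds on [xi] at [s] and [t], and [10 * m * a] from the
    replies. *)
Let Hs_ge t : (s <= t <= e)%N -> - (C3 * (eta * l1 t)) <= Hs t.
Proof.
move=> tI; have [st te] := andP tI.
have E : xi t - xi s - Hs t =
    \sum_i alpha i * \sum_(s <= k < t | j k == i) ((x2 k)%:R - (x1 k)%:R).
  rewrite -(telescope_sumr xi) // /Hs -sumrB.
  transitivity (\sum_(s <= k < t) \sum_i
      (if j k == i then alpha i * ((x2 k)%:R - (x1 k)%:R) else 0)).
    apply: eq_big_nat => k /andP[sk kt].
    rewrite -big_mkcond /= (big_pred1 (j k)) => [|i]; last by rewrite eq_sym.
    by rewrite (ph_xi H) ?sk ?(leq_trans kt) //; ring.
  rewrite exchange_big; apply: eq_bigr => i _.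
  by rewrite -big_mkcond /= mulr_sumr.
have le : `|xi t - xi s - Hs t| <= m * (a * (10 * eta * l1 t)).
  rewrite E; apply: le_trans (ler_norm_sum _ _ _) _.
  rewrite /m -sumr_const mulr_suml; apply: ler_sum => i _.
  by rewrite mul1r normrM ler_pM // desync.
have h1 := ph_xi_ge H tI; have h2 := ph_xi_le H.
have h3 : eta * l1 s <= eta * l1 t by rewrite ler_pM2l // l1_ge.
by move: le; rewrite ler_norml /C3; lra.
Qed.

Let L_ge0 : 0 <= L.
Proof.
apply: le_trans (normr_ge0 (F 1 - F 0)) _; apply: le_trans (F_lip _ _) _.
by rewrite subr0 normr1 mulr1.
Qed.

(* The telescoping is exact except at the last use of each reply before the
   position leaves its region. *)
Let F_sum t : (s <= t <= e)%N ->
  `|F (p t) - F (p s) - \sum_(s <= k < t) alpha (j k) * (p k.+1 - p k)|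
  <= m * ((L + a) * eta).
Proof.
move=> /andP[st te].
rewrite -(telescope_sumr (fun k => F (p k))) // -sumrB.
pose z k := `|F (p k.+1) - F (p k) - alpha (j k) * (p k.+1 - p k)|.
apply: (@le_trans _ _ (\sum_(s <= k < t) z k)); first exact: ler_norm_sum.
have La : 0 <= (L + a) * eta.
  by rewrite mulr_ge0 // ?addr_ge0 // ltW.
have -> : \sum_(s <= k < t) z k =
    \sum_i \sum_(s <= k < t) (if j k == i then z k else 0).
  rewrite exchange_big; apply: eq_big_nat => k _.
  by rewrite -big_mkcond /= (big_pred1 (j k)) // => i; rewrite eq_sym.
rewrite /m -sumr_const mulr_suml; apply: ler_sum => i _; rewrite mul1r.
apply: sum_one_nonzero_le => // [k /andP[sk kt]|k k' sk kk' k't].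
  have kI : (s <= k < e)%N by rewrite sk (leq_trans kt).
  case: ifP => // _; apply: (@le_trans _ _ ((L + a) * (p k.+1 - p k))); last first.
    by rewrite ler_wpM2l ?p_step_le // addr_ge0 // ltW.
  have pk : 0 <= p k.+1 - p k.
    rewrite subr_ge0 phase_mono //; exact: leq_trans kt te.
  apply: le_trans (ler_normB _ _) _; rewrite mulrDl normrM (ger0_norm pk) lerD //.
    by apply: le_trans (F_lip _ _) _; rewrite (ger0_norm pk).
  by rewrite ler_wpM2r.
have [jk'|_] := eqVneq (j k') i; last by rewrite eqxx.
case: ifPn => // /eqP jk _.
have kI : (s <= k <= e)%N by rewrite sk (leq_trans (ltnW kk')) // (leq_trans (ltnW k't)).
have k1I : (s <= k.+1 <= e)%N by rewrite leqW // (leq_trans kk') // (leq_trans (ltnW k't)).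
have k'I : (s <= k' <= e)%N by rewrite (leq_trans _ (ltnW kk')) // (leq_trans (ltnW k't)).
have Ik : I i (p k) by rewrite -jk; exact: ph_I H _ kI.
have Ik' : I i (p k') by rewrite -jk'; exact: ph_I H _ k'I.
have Ik1 : I i (p k.+1).
  have [->//|n1] := eqVneq (p k.+1) (p k); have [->//|n2] := eqVneq (p k.+1) (p k').
  have <- : j k.+1 = i; last exact: ph_I H _ k1I.
  apply: (I_inside _ _ Ik Ik' (ph_I H k1I)).
    by rewrite lt_neqAle eq_sym n1 phase_mono //; case/andP: k1I.
  by rewrite lt_neqAle n2 phase_mono //; [case/andP: k1I|case/andP: k'I].
by rewrite /z jk (F_slope Ik Ik1) subrr normr0.
Qed.

Let G k := Hs k + C3 * (eta * l1 k).

Let G_ge0 k : (s <= k <= e)%N -> 0 <= G k.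
Proof. by move=> /Hs_ge; rewrite /G; lra. Qed.

Let w_mono k : (s <= k < e)%N -> w k.+1 <= w k.
Proof.
move=> /andP[sk ke]; have kI : (s <= k <= e)%N by rewrite sk ltnW.
have k1I : (s <= k.+1 <= e)%N by rewrite leqW.
have h := l1_gt0 kI; have h1 := l1_gt0 k1I.
have h2 : l1 k <= l1 k.+1 by rewrite l1_le.
rewrite /w ler_wpM2l ?(ltW Q_gt0) // lef_pV2 ?posrE; last 2 first.
- by apply: mulr_gt0; lra.
- by apply: mulr_gt0; lra.
by apply: ler_pM; lra.
Qed.

Let l1w_le k : (s <= k < e)%N -> l1 k.+1 * (w k - w k.+1) <= 2 * (p k.+1 - p k).
Proof.
move=> kI; have /andP[sk ke] := kI.
have k0I : (s <= k <= e)%N by rewrite sk ltnW.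
have h := l1_gt0 k0I.
rewrite p_step // /w (ph_l1 H) //; case: (x1 k) => /=; last by rewrite addr0 subrr mulr0 mul0r mulr0.
rewrite mul1r -subr_ge0.
have -> : 2 * (Q / (l1 k * (l1 k + 1))) - (l1 k + 1) *
    (Q / (l1 k * (l1 k + 1)) - Q / ((l1 k + 1) * (l1 k + 1 + 1))) =
    2 * Q / (l1 k * (l1 k + 1) * (l1 k + 2)).
  by field; rewrite !gt_eqF //; lra.
have hQ := Q_gt0.
apply: divr_ge0; first by lra.
by apply: mulr_ge0; [apply: mulr_ge0|]; lra.
Qed.

(* Summation by parts against the weights [w], whose differences are what
   makes the potential strictly increase when [Hs] is positive. *)
Let F_increase (u v : nat) : (s <= u)%N -> (u <= v)%N -> (v <= e)%N ->
  \sum_(u <= k < v) G k.+1 * (w k - w k.+1) - (3 * C3 + m * (L + a)) * eta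
  <= F (p e) - F (p s).
Proof.
move=> su uv ve.
have eI : (s <= e <= e)%N by rewrite se leqnn.
have abel : \sum_(s <= k < e) alpha (j k) * (p k.+1 - p k) =
    Hs e * w e + \sum_(s <= k < e) Hs k.+1 * (w k - w k.+1).
  have -> : Hs e * w e = \sum_(s <= k < e) (Hs k.+1 * w k.+1 - Hs k * w k).
    have Hs0 : Hs s = 0 by rewrite /Hs big_geq.
    by rewrite (telescope_sumr (fun k => Hs k * w k)) // Hs0 mul0r subr0.
  rewrite -big_split; apply: eq_big_nat => k kI /=.
  have -> : Hs k.+1 = Hs k + (x1 k)%:R * alpha (j k).
    by rewrite /Hs big_nat_recr //=; case/andP: kI.
  by rewrite p_step //; ring.
(* With [G] in place of [Hs] every term is nonnegative, so the sum may be restricted to [[u, v]].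
   This costs [2 * C3 * eta]; the boundary term of the summation by parts costs one more
   [C3 * eta]. *)
have GE : \sum_(s <= k < e) Hs k.+1 * (w k - w k.+1) =
    \sum_(s <= k < e) G k.+1 * (w k - w k.+1)
    - C3 * eta * \sum_(s <= k < e) l1 k.+1 * (w k - w k.+1).
  rewrite mulr_sumr -sumrB; apply: eq_bigr => k _; rewrite /G; ring.
have lw : \sum_(s <= k < e) l1 k.+1 * (w k - w k.+1) <= 2.
  apply: (@le_trans _ _ (\sum_(s <= k < e) 2 * (p k.+1 - p k))).
    by apply: ler_sum_nat => k kI; exact: l1w_le.
  rewrite -mulr_sumr telescope_sumr //.
  by have := p_le1 eI; have := p_ge0 sI; lra.
have Gpos k : (s <= k < e)%N -> 0 <= G k.+1 * (w k - w k.+1).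
  move=> kI; rewrite mulr_ge0 ?subr_ge0 ?w_mono //.
  by rewrite G_ge0 //; case/andP: kI => sk ->; rewrite leqW.
have sub : \sum_(u <= k < v) G k.+1 * (w k - w k.+1) <=
    \sum_(s <= k < e) G k.+1 * (w k - w k.+1).
  rewrite (big_cat_nat (n := u) (m := s) (p := e)) ?(leq_trans uv) //=.
  rewrite (big_cat_nat (n := v) (m := u) (p := e)) //=.
  apply: ler_wpDl.
    rewrite big_nat_cond; apply: sumr_ge0 => k /andP[/andP[sk ku] _].
    by apply: Gpos; rewrite sk (leq_trans ku) // (leq_trans uv).
  rewrite lerDl big_nat_cond; apply: sumr_ge0 => k /andP[/andP[vk ke] _].
  by apply: Gpos; rewrite ke (leq_trans su) // (leq_trans uv).
have He : - (C3 * eta) <= Hs e * w e.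
  have h := l1_gt0 eI; have hw : l1 e * w e <= 1.
    have -> : l1 e * w e = Q / (l1 e + 1) by rewrite /w; field; rewrite !gt_eqF //; lra.
    by rewrite ler_pdivrMr; [have := Q_le eI; lra|lra].
  apply: (@le_trans _ _ (- (C3 * (eta * l1 e)) * w e)).
    rewrite mulNr lerN2 -!mulrA ler_wpM2l ?(ltW C3_gt0) // ler_piMr //.
    exact: ltW.
  by rewrite ler_wpM2r ?w_ge0 // Hs_ge.
have := F_sum eI; rewrite abel GE ler_norml => /andP[h _].
have : C3 * eta * \sum_(s <= k < e) l1 k.+1 * (w k - w k.+1) <= C3 * eta * 2.
  by rewrite ler_wpM2l // ltW // mulr_gt0.
lra.
Qed.

Lemma phase_potential_ge :
  - ((3 * C3 + m * (L + a)) * eta) <= F (p e) - F (p s).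
Proof. by have := F_increase (leqnn s) (leqnn s) se; rewrite big_geq // add0r. Qed.

(* A reply used over a long part of the phase makes [Hs] vary by a definite
   amount; as [Hs] is nearly nonnegative it is then definitely positive at one
   end of that part. *)
Let Hs_big (d c : R) : 0 < d -> d <= p e - p s -> c = c0 * d / (4 * m) ->
  eta * (4 * a + C3) < c -> eta <= d / 16 ->
  exists k, [/\ (s <= k <= e)%N, c * l1 k <= Hs k & p k <= p s + d / 2 + eta].
Proof.
move=> d0 ped cE etac etad.
(* Only the first half of the displacement is searched, which leaves room to collect the gain
   afterwards. *)
have pe2 : p s + d / 2 <= p e by lra.
have [h [/andP[sh he] ph hmin]] :=
  first_crossing (P := fun k => p s + d / 2 <= p k) se pe2.
rewrite /= in ph hmin; have hI : (s <= h <= e)%N by rewrite sh.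
have ph_up : p h <= p s + d / 2 + eta.
  have [<-|hs] := eqVneq s h; first by have := eta_gt0; lra.
  have sh' : (s < h)%N by rewrite ltn_neqAle hs.
  have hE : h.-1.+1 = h by rewrite prednK // (leq_ltn_trans _ sh').
  have sh1 : (s <= h.-1)%N by rewrite -ltnS hE.
  have h1e : (h.-1 < e)%N by rewrite hE.
  have := hmin h.-1; rewrite sh1 -[in X in (_ < X)%N]hE ltnSn => /(_ isT); rewrite -ltNge => h1.
  by have := p_step_le (k := h.-1); rewrite sh1 h1e hE => /(_ isT); lra.
(* Pigeonhole: one of the [m] replies accounts for at least [d / (2 * m)] of the displacement
   [d / 2]. *)
have [i hi] : exists i, d / (2 * m) <=
    \sum_(s <= k < h | j k == i) (p k.+1 - p k).
  apply: contrapT => /forallNP N.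
  have : \sum_i \sum_(s <= k < h | j k == i) (p k.+1 - p k) < \sum_(i : J) d / (2 * m).
    apply: ltr_sum => [|i _]; last by rewrite ltNge; apply/negP.
    by apply/hasP; exists (j s); rewrite ?mem_index_enum.
  have -> : \sum_i \sum_(s <= k < h | j k == i) (p k.+1 - p k) = p h - p s.
    rewrite -(telescope_sumr p) // [RHS](eq_bigr (fun k => \sum_i
      (if j k == i then p k.+1 - p k else 0))); last first.
      by move=> k _; rewrite -big_mkcond /= (big_pred1 (j k)) // => i; rewrite eq_sym.
    by rewrite exchange_big; apply: eq_bigr => i _; rewrite -big_mkcond.
  have dE : (d / (2 * m)) *+ #|J| = d / 2.
    by rewrite -[LHS]mulr_natr -/m; field; rewrite gt_eqF.
  have -> : \sum_(i : J) d / (2 * m) = d / 2 by rewrite sumr_const; exact: dE.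
  by lra.
have dm : 0 < d / (2 * m) by rewrite divr_gt0 // mulr_gt0.
have [N|[f [g [/andP[sf fg] gh /eqP jf /eqP jg fl]]]] :=
  first_last (fun k => j k == i) s h.
  exfalso; move: hi; rewrite big_nat_cond big_pred0 => [|k]; first by lra.
  by apply/negP => /andP[/N /negP h1 h2]; exact: h1.
have sg := leq_trans sf fg; have ge := leq_trans gh he.
have fI : (s <= f <= e)%N by rewrite sf (leq_trans fg) // ltnW.
have gI : (s <= g < e)%N by rewrite sg.
have g1I : (s <= g.+1 <= e)%N by rewrite leqW.
have fg1 : (f <= g.+1)%N by rewrite leqW.
have hi' : d / (2 * m) <= p g.+1 - p f.
  apply: le_trans hi _; rewrite -(telescope_sumr p) //.
  apply: ler_sum_subrange => // k /andP[fk kg].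
  by rewrite subr_ge0 phase_mono // ?(leq_trans sf) // (leq_trans kg).
have n_le : d / (2 * m) * l1 g.+1 <= l1 g.+1 - l1 f.
  rewrite -ler_pdivlMr ?l1_gt0 //; apply: le_trans hi' _.
  rewrite p_diff // invfM mulrA ler_wpM2r ?invr_ge0 ?(ltW (l1_gt0 _)) //.
  rewrite -mulrA mulrC -mulrA ler_piMr ?subr_ge0 ?l1_le //.
  by rewrite mulrC ler_pdivrMr ?mul1r ?Q_le ?l1_gt0.
have HsE : Hs g.+1 - Hs f = \sum_(f <= k < g.+1) (x1 k)%:R * alpha (j k).
  by rewrite /Hs (big_cat_nat (n := f) (m := s) (p := g.+1)) //= addrAC subrr add0r.
have main : `|Hs g.+1 - Hs f - alpha i * (l1 g.+1 - l1 f)| <= 4 * a.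
  have -> : Hs g.+1 - Hs f - alpha i * (l1 g.+1 - l1 f) =
      \sum_(f <= k < g.+1 | j k != i) (x1 k)%:R * (alpha (j k) - alpha i).
    rewrite HsE (@clock_sub_sum _ x1 l1) // => [|k /andP[fk kg]]; last first.
      by apply: (ph_l1 H); rewrite (leq_trans sf) // (leq_trans kg).
    rewrite mulr_sumr -sumrB (bigID (fun k => j k == i)) /= big1 ?add0r => [|k /eqP ->].
      by apply: eq_bigr => k _; ring.
    by ring.
  apply: le_trans (ler_norm_sum _ _ _) _.
  apply: (@le_trans _ _ (\sum_(f <= k < g.+1 | j k != i) (x1 k)%:R * (2 * a))).
    apply: ler_sum => k _; rewrite normrM normr_nat ler_wpM2l //.
    apply: le_trans (ler_normB _ _) _; have := alpha_le (j k); have := alpha_le i; lra.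
  rewrite -mulr_suml.
  have := mismatch sf fg gh he (fun k => ler0n R (x1 k)) jf jg.
  have := level_x1 (p f) he; have := level_x1 (p g) he => h1 h2 h3.
  have : \sum_(f <= k < g.+1 | j k != i) (x1 k)%:R <= 2 :> R by lra.
  have := a_gt0; nra.
have big : (2 * c - 4 * a * eta) * l1 g.+1 <= `|Hs g.+1 - Hs f|.
  have h1 : c0 * (l1 g.+1 - l1 f) <= `|alpha i * (l1 g.+1 - l1 f)|.
    rewrite normrM (ger0_norm (x := _ - _)) ?subr_ge0 ?l1_le //.
    by rewrite ler_wpM2r ?subr_ge0 ?l1_le.
  have h2 : c0 * (d / (2 * m) * l1 g.+1) <= c0 * (l1 g.+1 - l1 f).
    by rewrite ler_wpM2l ?(ltW c0_gt0).
  have h3 : 2 * c * l1 g.+1 = c0 * (d / (2 * m) * l1 g.+1).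
    by rewrite cE; field; rewrite gt_eqF.
  have h4 : `|alpha i * (l1 g.+1 - l1 f)| <= `|Hs g.+1 - Hs f| + 4 * a.
    have := ler_normD (Hs g.+1 - Hs f) (alpha i * (l1 g.+1 - l1 f) - (Hs g.+1 - Hs f)).
    rewrite addrC subrK => h'; apply: le_trans h' _; rewrite lerD2l.
    by rewrite distrC.
  have h5 := eta_l1 g1I.
  have h6 : a * 1 <= a * (eta * l1 g.+1) by rewrite ler_wpM2l // ltW.
  lra.
have gH : p g.+1 <= p s + d / 2 + eta.
  by apply: le_trans ph_up; rewrite phase_mono // leqW.
(* [Hs] varies by nearly [2 * c * l1 g.+1] between [f] and [g.+1]. Were it below [c * l1] at both
   ends, its lower bound would limit the variation to [(c + C3 * eta) * l1 g.+1]; this is why [c] is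
   half of [c0 * d / (2 * m)]. *)
have [hg|hg] := leP (c * l1 g.+1) (Hs g.+1); first by exists g.+1.
have [hf|hf] := leP (c * l1 f) (Hs f).
  by exists f; split=> //; apply: le_trans gH; rewrite phase_mono //; case/andP: g1I.
exfalso; have l1g := l1_gt0 g1I.
have lfg : l1 f <= l1 g.+1 by rewrite l1_le //; case/andP: g1I.
have Gf := Hs_ge fI; have Gg := Hs_ge g1I.
have cpos : 0 < c by rewrite cE divr_gt0 ?mulr_gt0.
have h1 : c * l1 f <= c * l1 g.+1 by rewrite ler_pM2l.
have h2 : C3 * (eta * l1 f) <= C3 * (eta * l1 g.+1) by rewrite !ler_pM2l.
have h3 : `|Hs g.+1 - Hs f| <= (c + C3 * eta) * l1 g.+1.
  by rewrite ler_norml; apply/andP; split; lra.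
have := le_trans big h3; rewrite ler_pM2r // => h4.
lra.
Qed.

(** From a time [u] with [Hs u >= c * l1 u], as long as [p] moves by about [theta], [Hs] stays above
    [c / 2 * l1 u]. Meanwhile [w] drops by at least [theta / (2 * l1 u)], so summation by parts
    yields [c * theta / 4]. The value of [theta] makes the possible decrease of [Hs], at most
    [8 * a * theta / d * l1 u], equal to [c / 4 * l1 u]. *)
Lemma phase_potential_increase (d c theta : R) : 0 < d -> d <= p e - p s ->
  c = c0 * d / (4 * m) -> theta = c * d / (32 * a) ->
  eta * (4 * a + C3) < c -> eta <= theta -> theta <= d / 16 ->
  c * theta / 4 - (3 * C3 + m * (L + a)) * eta <= F (p e) - F (p s).
Proof.
move=> d0 ped cE thE etac etath thd.
have cpos : 0 < c by rewrite cE divr_gt0 ?mulr_gt0.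
have thpos : 0 < theta by rewrite thE divr_gt0 ?mulr_gt0.
have [u [/andP[su ue] Hu pu]] := Hs_big d0 ped cE etac (le_trans etath thd).
have uI : (s <= u <= e)%N by rewrite su.
have eI : (s <= e <= e)%N by rewrite se leqnn.
have pe2 : p u + theta <= p e by lra.
have [v [/andP[uv ve] pv vmin]] :=
  first_crossing (P := fun k => p u + theta <= p k) ue pe2.
rewrite /= in pv vmin; have sv := leq_trans su uv.
have vI : (s <= v <= e)%N by rewrite sv.
have pv_up : p v <= p u + theta + eta.
  have [<-|uv'] := eqVneq u v; first by have := eta_gt0; lra.
  have ltuv : (u < v)%N by rewrite ltn_neqAle uv'.
  have vE : v.-1.+1 = v by rewrite prednK // (leq_ltn_trans _ ltuv).
  have uv1 : (u <= v.-1)%N by rewrite -ltnS vE.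
  have v1e : (v.-1 < e)%N by rewrite vE.
  have := vmin v.-1; rewrite uv1 -[in X in (_ < X)%N]vE ltnSn => /(_ isT).
  rewrite -ltNge => h1.
  by have := p_step_le (k := v.-1); rewrite (leq_trans su uv1) v1e vE => /(_ isT); lra.
apply: le_trans (F_increase su uv ve); rewrite lerD2r.
have l1u := l1_gt0 uI; have l1v := l1_gt0 vI.
have Hbig k : (u <= k < v)%N -> c / 2 * l1 u <= Hs k.+1.
  move=> /andP[uk kv].
  have k1I : (s <= k.+1 <= e)%N by rewrite leqW ?(leq_trans su) // (leq_trans kv).
  have luk : l1 u <= l1 k.+1 by rewrite l1_le ?leqW //; case/andP: k1I.
  have Hdiff : `|Hs k.+1 - Hs u| <= a * (l1 k.+1 - l1 u).
    have -> : Hs k.+1 - Hs u = \sum_(u <= i < k.+1) (x1 i)%:R * alpha (j i).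
      by rewrite /Hs (big_cat_nat (n := u) (m := s) (p := k.+1)) ?leqW //= addrAC subrr add0r.
    rewrite (@clock_sub_sum _ x1 l1) ?leqW // => [|i /andP[ui ik]]; last first.
      by apply: (ph_l1 H); rewrite (leq_trans su) // (leq_trans ik) // (leq_trans kv).
    rewrite mulr_sumr; apply: le_trans (ler_norm_sum _ _ _) _.
    by apply: ler_sum => i _; rewrite normrM normr_nat mulrC ler_wpM2r.
  have pk : p k.+1 <= p u + theta + eta.
    by apply: le_trans pv_up; rewrite phase_mono //; case/andP: k1I.
  have l1k := l1_gt0 k1I; have pe1 := p_le1 eI.
  have lb : d / 4 <= Q / l1 k.+1.
    have -> : Q / l1 k.+1 = 1 - p k.+1 by rewrite (ph_p H k1I); ring.
    lra.
  have E : (p k.+1 - p u) * l1 u = Q / l1 k.+1 * (l1 k.+1 - l1 u).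
    by rewrite p_diff //; field; rewrite !gt_eqF.
  have h1 : d / 4 * (l1 k.+1 - l1 u) <= 2 * theta * l1 u.
    apply: (@le_trans _ _ (Q / l1 k.+1 * (l1 k.+1 - l1 u))).
      by rewrite ler_wpM2r ?subr_ge0.
    by rewrite -E ler_wpM2r ?(ltW l1u) //; lra.
  have h2 : a * (l1 k.+1 - l1 u) <= c / 4 * l1 u.
    have -> : a * (l1 k.+1 - l1 u) = 4 * a / d * (d / 4 * (l1 k.+1 - l1 u)).
      by field; rewrite gt_eqF.
    apply: (@le_trans _ _ (4 * a / d * (2 * theta * l1 u))).
      by rewrite ler_wpM2l // divr_ge0 ?(ltW d0) // mulr_ge0 // ltW.
    by rewrite thE le_eqVlt; apply/orP; left; apply/eqP; field; rewrite !gt_eqF.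
  have h3 : 0 < c * l1 u by rewrite mulr_gt0.
  by move: Hdiff; rewrite ler_norml; lra.
have W : theta / (2 * l1 u) <= w u - w v.
  have h1 := eta_l1 uI.
  have luv : l1 u <= l1 v by rewrite l1_le.
  have wE k : (s <= k <= e)%N -> w k = (1 - p k) / (l1 k + 1).
    move=> kI; have := l1_gt0 kI => h.
    by rewrite (ph_p H kI) /w; field; rewrite !gt_eqF //; lra.
  have pvpu : (1 - p v) / (l1 v + 1) <= (1 - p v) / (l1 u + 1).
    rewrite ler_wpM2l ?subr_ge0 ?p_le1 // lef_pV2 ?posrE; lra.
  have d1 : d <= 1 by have := p_le1 eI; have := p_ge0 sI; lra.
  have l1u1 : 1 <= l1 u.
    apply: le_trans h1 _; rewrite ler_piMl ?(ltW l1u) //; lra.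
  apply: (@le_trans _ _ (theta / (l1 u + 1))).
    by rewrite ler_wpM2l ?(ltW thpos) // lef_pV2 ?posrE; lra.
  rewrite (wE u) // (wE v) //.
  apply: (@le_trans _ _ ((1 - p u) / (l1 u + 1) - (1 - p v) / (l1 u + 1))); last first.
    by rewrite lerD2l lerN2.
  by rewrite -mulrBl ler_wpM2r ?invr_ge0; lra.
have wmon k : (u <= k < v)%N -> 0 <= w k - w k.+1.
  move=> /andP[uk kv]; rewrite subr_ge0 w_mono //.
  by rewrite (leq_trans su uk) (leq_trans kv).
apply: (@le_trans _ _ (\sum_(u <= k < v) c / 2 * l1 u * (w k - w k.+1))); last first.
  apply: ler_sum_nat => k kI; apply: ler_wpM2r; first exact: wmon.
  apply: le_trans (Hbig k kI) _; rewrite /G lerDl.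
  have k1I : (s <= k.+1 <= e)%N.
    by case/andP: kI => uk kv; rewrite leqW ?(leq_trans su) // (leq_trans kv).
  by rewrite ltW // mulr_gt0 // mulr_gt0 // l1_gt0.
rewrite -mulr_sumr.
have -> : \sum_(u <= k < v) (w k - w k.+1) = w u - w v.
  rewrite -[RHS]opprB -telescope_sumr // -sumrN.
  by apply: eq_bigr => k _; rewrite opprB.
apply: (@le_trans _ _ (c / 2 * l1 u * (theta / (2 * l1 u)))); last first.
  by rewrite ler_wpM2l // ltW // mulr_gt0 // divr_gt0.
by rewrite le_eqVlt; apply/orP; left; apply/eqP; field; rewrite !gt_eqF.
Qed.

End OnePhase.

(** The constants depend only on the game and on [d], not on the phase: as [eta] tends to 0 the loss
    vanishes, while the gain of a phase of displacement [d] stays bounded below. *)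
Lemma phase_potential : exists C : R, [/\ 0 < C,
  forall s e x1 x2 j l1 l2 xi p Q eta, phase s e x1 x2 j l1 l2 xi p Q eta ->
    - (C * eta) <= F (p e) - F (p s) &
  forall d : R, 0 < d -> exists2 k : R, 0 < k & exists2 eta0 : R, 0 < eta0 &
    forall s e x1 x2 j l1 l2 xi p Q eta, phase s e x1 x2 j l1 l2 xi p Q eta ->
    eta <= eta0 -> d <= p e - p s -> k <= F (p e) - F (p s)].
Proof.
have [a0|a0] := ltP 0 a; last first.
  have no (i : J) : False.
    by have := lt_le_trans c0_gt0 (le_trans (alpha_ge i) (alpha_le i)); rewrite ltNge a0.
  exists 1; split=> // [s e x1 x2 j *|d d0]; first by case: (no (j s)).
  by exists 1 => //; exists 1 => // s e x1 x2 j; case: (no (j s)).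
have [m0|m0] := eqVneq #|J| 0%N.
  have no (i : J) : False by have /card0_eq/(_ i) := m0; rewrite inE.
  exists 1; split=> // [s e x1 x2 j *|d d0]; first by case: (no (j s)).
  by exists 1 => //; exists 1 => // s e x1 x2 j; case: (no (j s)).
set m : R := #|J|%:R; have {}m0 : 0 < m by rewrite ltr0n lt0n.
have L0 : 0 <= L.
  apply: le_trans (normr_ge0 (F 1 - F 0)) _; apply: le_trans (F_lip _ _) _.
  by rewrite subr0 normr1 mulr1.
set C3 : R := 2 + 10 * m * a.
have ma : 0 < m * a by exact: mulr_gt0.
have mL : 0 <= m * L by apply: mulr_ge0 => //; exact: ltW.
set C : R := 3 * C3 + m * (L + a).
have C0 : 0 < C by rewrite /C /C3; lra.
exists C; split=> // [s e x1 x2 j l1 l2 xi p Q eta H|d d0].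
  exact: (phase_potential_ge H).
(* Weights lie in [[0, 1]], so no phase moves by more than 1; below, [d <= 1] gives [c <= a / 4] and
   then [theta <= d / 16]. *)
have [d1|d1] := ltP 1 d.
  exists 1 => //; exists 1 => // s e x1 x2 j l1 l2 xi p Q eta H _ dle; exfalso.
  have [se /andP[Q0 Ql] pE] : [/\ (s <= e)%N, 0 < Q <= l1 s &
      forall k, (s <= k <= e)%N -> p k = 1 - Q / l1 k] by case: H.
  have l1s : 0 < l1 s by lra.
  have l1e : l1 s <= l1 e by apply: (clock_le (x := x1)) se; exact: ph_l1 H.
  have : p e <= 1 by rewrite pE ?se ?leqnn // gerBl divr_ge0; lra.
  have : 0 <= p s by rewrite pE ?se ?leqnn // subr_ge0 ler_pdivrMr // mul1r.
  by lra.
pose c := c0 * d / (4 * m); pose theta := c * d / (32 * a).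
have c_gt0 : 0 < c by rewrite divr_gt0 ?mulr_gt0.
have th_gt0 : 0 < theta by apply: divr_gt0; apply: mulr_gt0.
have k0 : 0 < c * theta / 8 by apply: divr_gt0 => //; apply: mulr_gt0.
exists (c * theta / 8) => //.
exists (Num.min (c / (4 * a + C3 + 1)) (Num.min theta (c * theta / (8 * C)))).
  rewrite !lt_min th_gt0 /=; apply/andP; split; apply: divr_gt0 => //.
  - by rewrite /C3; lra.
  - exact: mulr_gt0.
  - by rewrite pmulr_rgt0.
move=> s e x1 x2 j l1 l2 xi p Q eta H etale dle.
have c0a : c0 <= a := le_trans (alpha_ge (j s)) (alpha_le (j s)).
have m1 : 1 <= m by rewrite ler1n lt0n -(eqr_nat R) gt_eqF.
have ca : c <= a / 4.
  rewrite /c ler_pdivrMr ?mulr_gt0 //.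
  have : c0 * d <= a * 1 by apply: ler_pM => //; exact: ltW.
  have : a * 1 <= a * m by rewrite ler_pM2l.
  lra.
have thd : theta <= d / 16.
  rewrite /theta ler_pdivrMr ?mulr_gt0 //.
  have : c * d <= a / 4 * d by rewrite ler_pM2r.
  have : 0 < a * d by rewrite mulr_gt0.
  lra.
have D0 : 0 < 4 * a + C3 + 1 by rewrite /C3; lra.
move: etale; rewrite !le_min => /and3P[e1 e2 e3].
have e1' : eta * (4 * a + C3) < c.
  have h : eta * (4 * a + C3 + 1) <= c by rewrite -ler_pdivlMr.
  have [eta0|eta0] := ltP 0 eta; first by lra.
  by apply: le_lt_trans c_gt0; rewrite mulr_le0_ge0 // /C3; lra.
have := phase_potential_increase H d0 dle erefl erefl e1' e2 thd.
have : C * eta <= c * theta / 8.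
  have -> : c * theta / 8 = C * (c * theta / (8 * C)) by field; rewrite gt_eqF.
  by rewrite ler_pM2l.
rewrite -/m -/C3 -/C -/c -/theta; lra.
Qed.

End Phase.

(** * Convergence of 2 x m plays *)

Section Eventually.

Lemma nearoo_forall (P : nat -> Prop) :
  (\forall k \near \oo, P k) ->
  \forall s \near \oo, forall k, (s <= k)%N -> P k.
Proof. by case=> N _ HN; exists N => // s /= Ns k sk; apply: HN; exact: leq_trans sk. Qed.

Lemma infinitely_often (P : pred nat) :
  (\forall k \near \oo, ~~ P k) \/ forall n, exists2 k, (n <= k)%N & P k.
Proof.
have [H|/existsNP[n Hn]] := pselect (forall n, exists2 k, (n <= k)%N & P k); first by right.
by left; exists n => // k /= nk; apply/negP => Pk; apply: Hn; exists k.
Qed.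

(** Used to place barriers for the potential away from its values at the crossings; each point of
    [B] costs one halving of the interval. *)
Lemma finite_avoid {R : realFieldType} (B : seq R) (x y : R) : x < y ->
  exists u v, [/\ x < u, u < v, v < y & forall b, b \in B -> ~~ (u <= b <= v)].
Proof.
elim: B x y => [|b B IH] x y xy.
  by exists (x + (y - x) / 3), (x + (y - x) * 2 / 3); split => //; lra.
have [u [v [xu uv vy H]]] := IH x y xy.
have [bm|mb] := leP b ((u + v) / 2).
  have [u' [v' [uu uv' vv H']]] := IH _ _ (midf_lt uv).2.
  exists u', v'; split=> //; try lra.
  move=> b'; rewrite inE => /predU1P[->|/H' //].
  by apply/negP => /andP[h _]; move: bm; rewrite leNgt (lt_le_trans uu).
have [u' [v' [uu uv' vv H']]] := IH _ _ (midf_lt uv).1.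
exists u', v'; split=> //; try lra.
move=> b'; rewrite inE => /predU1P[->|/H' //].
by apply/negP => /andP[_ h]; move: mb; rewrite ltNge (le_trans h) // ltW.
Qed.

Lemma finite_separation {R : realFieldType} (B : seq R) :
  exists2 d : R, 0 < d & forall b b', b \in B -> b' \in B -> `|b - b'| < d -> b = b'.
Proof.
suff [d d0 Hd] : exists2 d : R, 0 < d &
    forall z, z \in [seq `|b - b'| | b <- B, b' <- B] -> z < d -> z = 0.
  exists d => // b b' bB b'B h; apply/eqP; rewrite -subr_eq0 -normr_eq0.
  by rewrite (Hd `|b - b'|) //; apply: allpairs_f.
have : forall z, z \in [seq `|b - b'| | b <- B, b' <- B] -> 0 <= z.
  by move=> z /allpairsP[[b b'] [_ _ ->]].
elim: [seq _ | _ <- _, _ <- _] => [|z s IH] H; first by exists 1.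
have [|d d0 Hd] := IH; first by move=> y ys; apply: H; rewrite inE ys orbT.
have [z0|zn0] := eqVneq z 0.
  by exists d => // y; rewrite inE => /predU1P[->//|/Hd].
have zp : 0 < z by rewrite lt_neqAle eq_sym zn0 H // inE eqxx.
exists (Num.min d z); first by rewrite lt_min d0.
move=> y; rewrite lt_min inE => /predU1P[->|/Hd h /andP[/h]//].
by rewrite ltxx andbF.
Qed.

Lemma ler_dist_common {R : realFieldType} (y x z : R) : `|x - z| <= `|y - x| + `|y - z|.
Proof. by rewrite (distrC y x); apply: le_trans (ler_normD _ _); rewrite addrA subrK. Qed.

(** Distinct points of [B] are at least [d] apart, so a sequence that stays within [d / 4] of [B]
    with steps at most [d / 4] can never pass from one point to another. *)
Lemma trapped_cvg {R : realFieldType} (B : seq R) (p : nat -> R) :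
  (forall d : R, 0 < d -> \forall k \near \oo, exists2 b, b \in B & `|p k - b| <= d) ->
  (forall d : R, 0 < d -> \forall k \near \oo, `|p k.+1 - p k| <= d) ->
  exists b, forall d : R, 0 < d -> \forall k \near \oo, `|p k - b| <= d.
Proof.
move=> nearB small; have [d d0 sep] := finite_separation B.
have d4 : 0 < d / 4 by rewrite divr_gt0.
have [N _ HN] := nearB _ d4; have [N' _ HN'] := small _ d4.
pose M := maxn N N'.
have MN : (N <= M)%N by rewrite leq_maxl.
have MN' : (N' <= M)%N by rewrite leq_maxr.
have [b bB Hb] := HN M MN.
have stay k : (M <= k)%N -> `|p k - b| <= d / 4.
  elim: k => [|k IH]; first by rewrite leqn0 => /eqP M0; move: Hb; rewrite M0.
  rewrite leq_eqVlt => /predU1P[<-//|Mk].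
  have [b' b'B Hb'] := HN k.+1 (leq_trans MN (ltnW Mk)).
  have h1 := IH Mk; have /= h2 := HN' k (leq_trans MN' Mk).
  rewrite -(sep b' b) //.
  have := ler_dist_common (p k.+1) b' b; have := ler_dist_common (p k) (p k.+1) b.
  by rewrite (distrC (p k)); move: Hb' h1 h2; lra.
exists b => e e0.
have me : 0 < Num.min e (d / 4) by rewrite lt_min e0.
near=> k.
have [b' b'B] : exists2 b', b' \in B & `|p k - b'| <= Num.min e (d / 4).
  by near: k; exact: nearB.
rewrite le_min => /andP[h1 h2].
rewrite -(sep b' b) //.
have h3 : `|p k - b| <= d / 4 by apply: stay; near: k; exact: nbhs_infty_ge.
by have := ler_dist_common (p k) b' b; move: h2 h3; lra.
Unshelve. all: by end_near. Qed.

End Eventually.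

(** * The play of a 2 x m game and its division into phases *)

Section Play.
Context {R : realType} {J : finType}.

Definition is_best (bu bv : J -> R) (i : J) (r : R) : Prop :=
  0 <= r <= 1 /\ forall i', bu i' + bv i' * r <= bu i + bv i * r.

(** The payoffs of player 2 are affine in [r]. A line on the upper envelope at [r] and [t] meets any
    line that is on it at an intermediate [s], and both then have the same slope. *)
Lemma is_best_inside (bu bv : J -> R) :
  (forall i i', bu i = bu i' -> bv i = bv i' -> i = i') ->
  forall i j r s t, r < s -> s < t ->
    is_best bu bv j r -> is_best bu bv j t -> is_best bu bv i s -> i = j.
Proof.
move=> inj i j r s t rs st [_ Hr] [_ Ht] [_ Hs].
have h1 := Hr i; have h2 := Ht i; have h3 := Hs j.
have E : bv i = bv j.
  apply/eqP; rewrite eq_le; apply/andP; split; rewrite leNgt; apply/negP => lt.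
    have : (bv i - bv j) * (t - s) > 0 by rewrite mulr_gt0 // subr_gt0.
    lra.
  have : (bv j - bv i) * (s - r) > 0 by rewrite mulr_gt0 // subr_gt0.
  lra.
apply: inj => //; rewrite E in h1 h2 h3; lra.
Qed.

(* The play of a 2 x m game seen from player 1: [p] is the empirical weight of
   her first action, [xi] is [l2] times its empirical payoff advantage, [c] and
   [j] are the current best replies of the two players. *)
Record play (bu bv alpha : J -> R) (x1 x2 c : nat -> bool) (j : nat -> J)
    (l1 l2 p xi : nat -> R) (c0 : bool) : Prop := Play {
  pl_l1 : forall k, l1 k.+1 = l1 k + (x1 k)%:R;
  pl_l2 : forall k, l2 k.+1 = l2 k + (x2 k)%:R;
  pl_p : forall k, l1 k.+1 * p k.+1 = l1 k * p k + (x1 k && c k)%:R;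
  pl_xi : forall k, xi k.+1 = xi k + (x2 k)%:R * alpha (j k);
  pl_l10 : l1 0%N = 1;
  pl_p0 : p 0%N = c0%:R;
  pl_c : forall k, if c k then 0 <= xi k else xi k <= 0;
  pl_j : forall k, is_best bu bv (j k) (p k);
  pl_l1_oo : forall M : R, \forall k \near \oo, M <= l1 k;
  pl_sync : forall e : R, 0 < e -> \forall k \near \oo, `|l1 k - l2 k| <= e * l1 k }.

(** Exchanging the two actions of player 1; it reduces the phases of the second action to those of
    the first. *)
Lemma play_reflect bu bv alpha x1 x2 c j l1 l2 p xi c0 :
  play bu bv alpha x1 x2 c j l1 l2 p xi c0 ->
  play (fun i => bu i + bv i) (fun i => - bv i) (fun i => - alpha i) x1 x2
    (fun k => ~~ c k) j l1 l2 (fun k => 1 - p k) (fun k => - xi k) (~~ c0).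
Proof.
case=> h1 h2 h3 h4 h5 h6 h7 h8 h9 h10; split=> //.
- move=> k; rewrite !mulrBr h3 h1; case: (x1 k) (c k) => [] [] /=; lra.
- by move=> k; rewrite h4; ring.
- by rewrite h6; case: c0 {h6} => /=; rewrite ?subrr ?subr0.
- by move=> k; have := h7 k; case: (c k) => /=; rewrite ?oppr_ge0 ?oppr_le0.
- by move=> k; have [h11 h12] := h8 k; split=> [|i]; [lra|have := h12 i; lra].
Qed.

Section OnePlay.
Context {bu bv alpha : J -> R} {x1 x2 c : nat -> bool} {j : nat -> J}
  {l1 l2 p xi : nat -> R} {c0 : bool}.
Hypothesis H : play bu bv alpha x1 x2 c j l1 l2 p xi c0.
Context (a : R).
Hypothesis alpha_le : forall i, `|alpha i| <= a.

(** The action at the latest update strictly before step [k], or the initial action if there was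
    none. *)
Fixpoint last_play (k : nat) : bool :=
  if k is k'.+1 then (if x1 k' then c k' else last_play k') else c0.

Definition flip k := x1 k && (c k != last_play k).

Lemma play_l1_mono s t : (s <= t)%N -> l1 s <= l1 t.
Proof. by apply: (clock_le (x := x1)) => k _; exact: pl_l1 H k. Qed.

Lemma play_l2_mono s t : (s <= t)%N -> l2 s <= l2 t.
Proof. by apply: (clock_le (x := x2)) => k _; exact: pl_l2 H k. Qed.

Lemma play_l1_ge1 k : 1 <= l1 k.
Proof. by rewrite -(pl_l10 H) play_l1_mono. Qed.

Lemma play_l1_gt0 k : 0 < l1 k.
Proof. exact: lt_le_trans ltr01 (play_l1_ge1 k). Qed.

Let play_a_ge0 : 0 <= a.
Proof. by apply: le_trans (alpha_le (j 0%N)). Qed.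

Lemma play_xi_var s t : (s <= t)%N -> `|xi t - xi s| <= a * (l2 t - l2 s).
Proof.
move=> st; rewrite -(telescope_sumr xi) // (@clock_sub_sum _ x2) //; last first.
  by move=> k _; exact: pl_l2 H k.
rewrite mulr_sumr; apply: le_trans (ler_norm_sum _ _ _) _; apply: ler_sum => k _.
by rewrite (pl_xi H) addrAC subrr add0r normrM normr_nat mulrC ler_wpM2r.
Qed.

Lemma play_p_itv k : 0 <= p k <= 1.
Proof.
suff : 0 <= l1 k * p k <= l1 k.
  by rewrite pmulr_rge0 ?play_l1_gt0 // -{2}[l1 k]mulr1 ler_pM2l ?play_l1_gt0.
elim: k => [|k IH]; first by rewrite (pl_l10 H) (pl_p0 H) mul1r ler0n lern1 leq_b1.
by rewrite (pl_p H) (pl_l1 H); case: (x1 k) (c k) => [] [] /=; lra.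
Qed.

Lemma play_p_var s t : (s <= t)%N -> `|p t - p s| * l1 t <= l1 t - l1 s.
Proof.
move=> st; suff : `|l1 t * p t - l1 t * p s| <= l1 t - l1 s.
  by rewrite -mulrBr normrM gtr0_norm ?play_l1_gt0 // mulrC.
elim: t st => [|t IH]; first by rewrite leqn0 => /eqP ->; rewrite !subrr normr0.
rewrite leq_eqVlt => /predU1P[->|/IH]; first by rewrite !subrr normr0.
have := play_p_itv s.
by rewrite (pl_p H) (pl_l1 H) !ler_norml; case: (x1 t) (c t) => [] [] /=; lra.
Qed.

Lemma play_p_step (d : R) : 0 < d -> \forall k \near \oo, `|p k.+1 - p k| <= d.
Proof.
move=> d0; near=> k.
have h1 := play_p_var (leqnSn k).
have h2 : d^-1 <= l1 k by near: k; exact: pl_l1_oo H _.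
have h3 : l1 k.+1 - l1 k <= 1 by rewrite (pl_l1 H); case: (x1 k) => /=; lra.
have h4 := play_l1_gt0 k.+1.
rewrite -(ler_pM2r h4); apply: le_trans (le_trans h1 h3) _.
rewrite mulrC -ler_pdivrMr // div1r; apply: le_trans h2 _; exact: play_l1_mono.
Unshelve. all: by end_near. Qed.

(** An action that has been played keeps a positive weight. At a flip to the first action this gives
    [p s < 1], which makes the constant [Q] of the new phase positive. *)
Lemma last_play_frac k : if last_play k then 0 < p k else p k < 1.
Proof.
suff : if last_play k then 0 < l1 k * p k else l1 k * p k < l1 k.
  case: (last_play k); first by rewrite pmulr_rgt0 // play_l1_gt0.
  by rewrite -{2}[l1 k]mulr1 ltr_pM2l ?play_l1_gt0.
elim: k => [|k] /=.
  by rewrite (pl_l10 H) (pl_p0 H); case: c0; rewrite /= !mul1r ltr01.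
rewrite (pl_p H) (pl_l1 H); have /andP[h1 h2] := play_p_itv k.
have h3 := play_l1_gt0 k.
have h4 : 0 <= l1 k * p k by rewrite mulr_ge0 // ltW.
have h5 : l1 k * p k <= l1 k by rewrite ler_piMr // ltW.
by case: (x1 k) (c k) (last_play k) => [] [] [] /=; lra.
Qed.

(* Between two plays of player 1 the advantage [xi] can move only by o(l1). *)
Lemma last_play_sign (e : R) : 0 < e -> \forall k \near \oo,
  if last_play k then - (e * l1 k) <= xi k else xi k <= e * l1 k.
Proof.
move=> e0; have a0 := play_a_ge0.
pose h := e / (3 * (a + 1)).
have h0 : 0 < h by rewrite divr_gt0 ?mulr_gt0 //; lra.
have [N _ HN] := pl_sync H h0.
have [N' _ HN'] := pl_l1_oo H h^-1.
have [M _ HM] := pl_l1_oo H (l1 (maxn N N') + 2).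
exists M => // k /= Mk.
have [t [Nt tk xt ct nox]] : exists t, [/\ (maxn N N' <= t)%N, (t < k)%N, x1 t,
    last_play k = c t & l1 k = l1 t + 1].
  have := HM k Mk; rewrite /=; move: (maxn N N') => n; elim: k {Mk} => [|k IH].
    by have := play_l1_mono (leq0n n); lra.
  rewrite (pl_l1 H) /=; have [xk|nxk] := boolP (x1 k); last first.
    rewrite addr0 => /IH[t [nt tk xt ct lt]]; exists t; split=> //; exact: ltnW.
  have [nk _|kn] := leqP n k; first by exists k; split.
  by have := play_l1_mono (ltnW kn) => hk hM; exfalso; move: hM => /=; lra.
have le : e * l1 k >= a * (l2 k - l2 t).
  have tk' := ltnW tk.
  have /= s1 := HN t (leq_trans (leq_maxl _ _) Nt).
  have /= s2 := HN k (leq_trans (leq_maxl _ _) (leq_trans Nt tk')).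
  have /= s3 := HN' k (leq_trans (leq_maxr _ _) (leq_trans Nt tk')).
  have s4 : 1 <= h * l1 k by rewrite mulrC -ler_pdivrMr // div1r.
  have s5 : h * l1 t <= h * l1 k by rewrite ler_pM2l // play_l1_mono.
  have s6 : l2 k - l2 t <= 3 * (h * l1 k).
    by move: s1 s2; rewrite /= !ler_norml; lra.
  have -> : e * l1 k = (a + 1) * (3 * (h * l1 k)).
    by rewrite /h; field; rewrite gt_eqF //; lra.
  have s7 : 0 <= l2 k - l2 t by rewrite subr_ge0 play_l2_mono.
  by apply: ler_pM => //; lra.
have := play_xi_var (ltnW tk); have := pl_c H t; rewrite ct ler_norml.
by case: (c t); lra.
Qed.

(** Before a flip, [xi] had, up to o(l1), the sign of the old action; at the flip it has the sign of
    the new one. *)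
Lemma flip_xi_small (e : R) : 0 < e -> \forall k \near \oo, flip k -> `|xi k| <= e * l1 k.
Proof.
move=> e0; near=> k => /andP[_ ck].
have h0 : 0 < e * l1 k by rewrite mulr_gt0 ?play_l1_gt0.
have : if last_play k then - (e * l1 k) <= xi k else xi k <= e * l1 k.
  by near: k; exact: last_play_sign.
have := pl_c H k; move: ck; rewrite ler_norml.
by case: (c k) (last_play k) => [] [] //=; lra.
Unshelve. all: by end_near. Qed.

Lemma last_play_after_flip s k : flip s -> (s < k)%N ->
  (forall i, (s < i < k)%N -> ~~ flip i) -> last_play k = c s.
Proof.
case/andP=> xs _; elim: k => // k IH; rewrite ltnS leq_eqVlt => /predU1P[<- _|sk nf] /=.
  by rewrite xs.
have E : last_play k = c s.
  by apply: IH => // i /andP[si ik]; apply: nf; rewrite si ltnS ltnW.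
have := nf k; rewrite sk ltnSn /flip E => /(_ isT).
by case: (x1 k) => //= /negPn/eqP.
Qed.

Lemma flip_same s k : flip s -> (s <= k)%N ->
  (forall i, (s < i <= k)%N -> ~~ flip i) -> x1 k -> c k = c s.
Proof.
move=> fs; rewrite leq_eqVlt => /predU1P[<-//|sk] nf xk.
have := nf k; rewrite sk leqnn /flip xk => /(_ isT) /negPn/eqP ->.
by apply: last_play_after_flip => // i /andP[si ik]; apply: nf; rewrite si ltnW.
Qed.

(** A phase may extend up to and including the next flip [t], because the new action chosen at [t]
    affects [p] only at [t.+1]. Its invariant [l1 * (1 - p)] is the number of times the second
    action was counted. *)
Lemma play_phase (e : R) : 0 < e -> \forall s \near \oo, flip s -> c s ->
  forall t, (s <= t)%N -> (forall i, (s < i < t)%N -> ~~ flip i) ->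
  phase (is_best bu bv) alpha s t x1 x2 j l1 l2 xi p (l1 s * (1 - p s)) e.
Proof.
move=> e0; near=> s => fs cs t st nf.
have axis : `|xi s| <= e * l1 s by move: fs; near: s; exact: flip_xi_small.
split=> //.
- by move=> k _; exact: pl_l1 H k.
- by move=> k _; exact: pl_l2 H k.
- by move=> k _; exact: pl_xi H k.
- by move=> k _; exact: pl_j H k.
- move=> k /andP[sk kt]; suff E : l1 k * (1 - p k) = l1 s * (1 - p s).
    by rewrite -E; field; rewrite gt_eqF ?play_l1_gt0.
  elim: k sk kt => [|k IH]; first by rewrite leqn0 => /eqP ->.
  rewrite leq_eqVlt => /predU1P[->//|sk kt].
  rewrite -(IH sk (ltnW kt)) !mulrBr (pl_p H) (pl_l1 H).
  have [xk|] := boolP (x1 k); last by rewrite /= !addr0.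
  have -> : c k = true.
    rewrite (flip_same fs sk) // => i /andP[si ik]; apply: nf.
    by rewrite si (leq_ltn_trans ik).
  by rewrite /=; ring.
- have h := play_l1_gt0 s; have /andP[p0 p1] := play_p_itv s.
  have : p s < 1.
    have := last_play_frac s; case/andP: fs => _.
    by rewrite cs; case: (last_play s).
  by move=> p1'; rewrite pmulr_rgt0 // subr_gt0 p1' /= ler_piMr ?(ltW h) //; lra.
- move=> k /andP[sk _]; move: k sk; near: s; apply: nearoo_forall; exact (pl_sync H e0).
- rewrite mulrC -ler_pdivrMr // div1r; near: s; exact: pl_l1_oo H _.
- move=> k /andP[sk kt]; move: sk; rewrite leq_eqVlt => /predU1P[<-|sk].
    by move: axis; rewrite ler_norml => /andP[].
  have := last_play_after_flip fs sk; rewrite cs => E.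
  have {}E : last_play k by rewrite E // => i /andP[si ik]; apply: nf; rewrite si (leq_trans ik).
  suff : if last_play k then - (e * l1 k) <= xi k else xi k <= e * l1 k by rewrite E.
  move: k sk {kt E} => k /ltnW; move: k; near: s; apply: nearoo_forall.
  exact: last_play_sign.
- by move: axis; rewrite ler_norml => /andP[].
Unshelve. all: by end_near. Qed.

End OnePlay.
End Play.

Section PlayPhases.
Context {R : realType} {J : finType}.

Definition slope_on (bu bv alpha : J -> R) (F : R -> R) :=
  forall i r s, is_best bu bv i r -> is_best bu bv i s -> F s - F r = alpha i * (s - r).

Section Facts.
Context (bu bv alpha : J -> R) (a a0 L : R) (F : R -> R).
Context (x1 x2 c : nat -> bool) (j : nat -> J) (l1 l2 p xi : nat -> R) (c0 : bool).
Hypothesis lines_inj : forall i i', bu i = bu i' -> bv i = bv i' -> i = i'.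
Hypothesis alpha_le : forall i, `|alpha i| <= a.
Hypothesis alpha_ge : forall i, a0 <= `|alpha i|.
Hypothesis a0_gt0 : 0 < a0.
Hypothesis F_lip : forall r s, `|F s - F r| <= L * `|s - r|.
Hypothesis F_slope : slope_on bu bv alpha F.
Hypothesis H : play bu bv alpha x1 x2 c j l1 l2 p xi c0.

Let fl := @flip x1 c c0.

Lemma play_phases_up : [/\
  forall e : R, 0 < e -> \forall s \near \oo, fl s -> c s ->
    forall t, (s <= t)%N -> (forall i, (s < i < t)%N -> ~~ fl i) ->
    [/\ F (p s) - e <= F (p t),
      forall k, (s <= k <= t)%N -> p s <= p k <= p t,
      xi t * (1 - p t) <= (e + a * (p t - p s)) * l1 t &
      - xi t * p t <= e * l1 t] &
  forall d : R, 0 < d -> exists2 k : R, 0 < k & \forall s \near \oo, fl s -> c s ->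
    forall t, (s <= t)%N -> (forall i, (s < i < t)%N -> ~~ fl i) ->
    d <= p t - p s -> F (p s) + k <= F (p t)].
Proof.
have [C [C0 PL1 PL2]] :=
  phase_potential (is_best_inside lines_inj) alpha_le alpha_ge a0_gt0 F_lip F_slope.
have age0 : 0 <= a := le_trans (normr_ge0 _) (alpha_le (j 0%N)).
split=> [e e0|d d0]; last first.
  have [k k0 [e0 e00 PL]] := PL2 d d0; exists k => //.
  near=> s => fs cs t st nf dp.
  have ph : phase (is_best bu bv) alpha s t x1 x2 j l1 l2 xi p (l1 s * (1 - p s)) e0.
    move: fs cs t st nf {dp}; near: s; exact: (play_phase H alpha_le).
  by have := PL _ _ _ _ _ _ _ _ _ _ _ ph (lexx _) dp; lra.
pose h := Num.min (e / C) (e / (1 + 2 * a)).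
have h0 : 0 < h by rewrite lt_min !divr_gt0 //; lra.
near=> s => fs cs t st nf.
have ph : phase (is_best bu bv) alpha s t x1 x2 j l1 l2 xi p (l1 s * (1 - p s)) h.
  move: fs cs t st nf; near: s; exact: (play_phase H alpha_le).
have hC : C * h <= e by rewrite mulrC -ler_pdivlMr // ge_min lexx.
have ha : (1 + 2 * a) * h <= e.
  by rewrite mulrC -ler_pdivlMr ?ge_min ?lexx ?orbT //; lra.
have mono := phase_mono ph.
have tI : (s <= t <= t)%N by rewrite st leqnn.
have l1t := play_l1_gt0 H t; have l1s := play_l1_gt0 H s.
have hl : h * l1 s <= h * l1 t by rewrite ler_pM2l // (play_l1_mono H).
have /andP[p0 p1] := play_p_itv H t.
split.
- by have := PL1 _ _ _ _ _ _ _ _ _ _ _ ph; lra.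
- by move=> k /andP[sk kt]; rewrite !mono.
- have := play_xi_var H alpha_le st; rewrite ler_norml => /andP[_ x2le].
  have s1 := ph_sync ph tI; have s2 := ph_sync ph (k := s); rewrite leqnn st in s2.
  have {}s2 := s2 isT.
  have l2le : l2 t - l2 s <= l1 t - l1 s + 2 * (h * l1 t).
    by move: s1 s2; rewrite !ler_norml; lra.
  have xile : xi t <= (1 + 2 * a) * h * l1 t + a * (l1 t - l1 s).
    have := ph_xi_le ph.
    have : a * (l2 t - l2 s) <= a * (l1 t - l1 s + 2 * (h * l1 t)) by rewrite ler_wpM2l.
    lra.
  (* The advantage [xi] can grow in proportion to the elapsed clock, but in the product with
     [1 - p t] the invariant of the phase turns elapsed time into displacement of [p]. *)
  have pE : (l1 t - l1 s) * (1 - p t) = (p t - p s) * l1 s.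
    have e1 : l1 t * (1 - p t) = l1 s * (1 - p s).
      by rewrite {1}(ph_p ph tI); field; rewrite gt_eqF.
    have -> : (l1 t - l1 s) * (1 - p t) = l1 t * (1 - p t) - l1 s * (1 - p t) by ring.
    by rewrite e1; ring.
  have pts : p s <= p t by rewrite mono.
  apply: (@le_trans _ _ (((1 + 2 * a) * h * l1 t + a * (l1 t - l1 s)) * (1 - p t))).
    by rewrite ler_wpM2r // subr_ge0.
  have -> : ((1 + 2 * a) * h * l1 t + a * (l1 t - l1 s)) * (1 - p t) =
    (1 + 2 * a) * h * l1 t * (1 - p t) + a * ((p t - p s) * l1 s) by rewrite -pE; ring.
  rewrite [leRHS]mulrDl; apply: lerD.
    apply: (@le_trans _ _ ((1 + 2 * a) * h * l1 t)).
      rewrite ler_piMr //; last by lra.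
      by apply: mulr_ge0; [apply: mulr_ge0|]; lra.
    by rewrite ler_pM2r.
  rewrite -mulrA ler_wpM2l // ler_wpM2l ?subr_ge0 //; exact: (play_l1_mono H).
- have := ph_xi_ge ph tI => xige.
  have hh : h * l1 t <= e * l1 t.
    rewrite ler_pM2r //; apply: le_trans ha; rewrite ler_peMl //; lra.
  apply: le_trans hh; apply: (@le_trans _ _ (h * l1 t * p t)).
    by rewrite ler_wpM2r //; lra.
  by rewrite ler_piMr // mulr_ge0 // ltW.
Unshelve. all: by end_near. Qed.

End Facts.

Lemma flip_reflect (x1 c : nat -> bool) (c0 : bool) k :
  @flip x1 (fun i => ~~ c i) (~~ c0) k = @flip x1 c c0 k.
Proof.
rewrite /flip; have -> : @last_play x1 (fun i => ~~ c i) (~~ c0) k = ~~ @last_play x1 c c0 k.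
  by elim: k => //= k ->; case: (x1 k).
by case: (c k) (last_play k) => [] [].
Qed.

(** * The potential along successive phases *)

Section Convergence.
Context (bu bv alpha : J -> R) (a a0 L : R) (F : R -> R).
Context (x1 x2 c : nat -> bool) (j : nat -> J) (l1 l2 p xi : nat -> R) (c0 : bool).
Hypothesis lines_inj : forall i i', bu i = bu i' -> bv i = bv i' -> i = i'.
Hypothesis alpha_le : forall i, `|alpha i| <= a.
Hypothesis alpha_ge : forall i, a0 <= `|alpha i|.
Hypothesis a0_gt0 : 0 < a0.
Hypothesis F_lip : forall r s, `|F s - F r| <= L * `|s - r|.
Hypothesis F_slope : slope_on bu bv alpha F.
Hypothesis H : play bu bv alpha x1 x2 c j l1 l2 p xi c0.

Let fl := @flip x1 c c0.
Let noflip s t := forall i, (s < i < t)%N -> ~~ fl i.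

Lemma play_phases : [/\
  forall e : R, 0 < e -> \forall s \near \oo, fl s ->
    forall t, (s <= t)%N -> noflip s t ->
    [/\ F (p s) - e <= F (p t),
      forall k, (s <= k <= t)%N -> `|p k - p s| <= `|p t - p s|,
      xi t * (1 - p t) <= (e + a * `|p t - p s|) * l1 t &
      - xi t * p t <= (e + a * `|p t - p s|) * l1 t] &
  forall d : R, 0 < d -> exists2 k : R, 0 < k & \forall s \near \oo, fl s ->
    forall t, (s <= t)%N -> noflip s t ->
    d <= `|p t - p s| -> F (p s) + k <= F (p t)].
Proof.
have [U1 U2] := play_phases_up lines_inj alpha_le alpha_ge a0_gt0 F_lip F_slope H.
have lines_inj' i i' : bu i + bv i = bu i' + bv i' -> - bv i = - bv i' -> i = i'.
  by move=> h1 h2; apply: lines_inj; lra.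
have alpha_le' i : `|- alpha i| <= a by rewrite normrN.
have alpha_ge' i : a0 <= `|- alpha i| by rewrite normrN.
have F_lip' r s : `|F (1 - s) - F (1 - r)| <= L * `|s - r|.
  by apply: le_trans (F_lip _ _) _; rewrite (_ : 1 - s - (1 - r) = r - s) 1?distrC //; ring.
have F_slope' : slope_on (fun i => bu i + bv i) (fun i => - bv i)
    (fun i => - alpha i) (fun r => F (1 - r)).
  move=> i r s Hr Hs; rewrite (F_slope (i := i)); first by ring.
    by case: Hr => h1 h2; split=> [|i']; [lra|have := h2 i'; lra].
  by case: Hs => h1 h2; split=> [|i']; [lra|have := h2 i'; lra].
have [D1 D2] := play_phases_up lines_inj' alpha_le' alpha_ge' a0_gt0 F_lip' F_slope'
  (play_reflect H).
have age0 : 0 <= a := le_trans (normr_ge0 _) (alpha_le (j 0%N)).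
have nf' s t : noflip s t -> forall i, (s < i < t)%N -> ~~ @flip x1 (fun i => ~~ c i) (~~ c0) i.
  by move=> nf i /nf; rewrite flip_reflect.
split=> [e e0|d d0]; last first.
  have [k k0 U] := U2 d d0; have [k' k'0 D] := D2 d d0.
  exists (Num.min k k'); first by rewrite lt_min k0.
  apply: filterS3 (filterI U D) (U1 1 ltr01) (D1 1 ltr01) => s [Us Ds] Ms Ns fs t st nf dp.
  have m1 : Num.min k k' <= k by rewrite ge_min lexx.
  have m2 : Num.min k k' <= k' by rewrite ge_min lexx orbT.
  have tI : (s <= t <= t)%N by rewrite st leqnn.
  have [cs|cs] := boolP (c s).
    have [_ /(_ t tI) /andP[pts _] _ _] := Ms fs cs t st nf.
    rewrite ger0_norm ?subr_ge0 // in dp.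
    by have := Us fs cs t st nf dp; lra.
  have fs' : @flip x1 (fun i => ~~ c i) (~~ c0) s by rewrite flip_reflect.
  have [_ /(_ t tI) /andP[pts _] _ _] := Ns fs' cs t st (nf' _ _ nf).
  rewrite ler0_norm in dp; last by lra.
  have dp' : d <= 1 - p t - (1 - p s) by lra.
  have := Ds fs' cs t st (nf' _ _ nf) dp'; rewrite !subKr; lra.
apply: filterS2 (U1 e e0) (D1 e e0) => s Us Ds fs t st nf.
have tI : (s <= t <= t)%N by rewrite st leqnn.
have l1t := play_l1_gt0 H t.
have el : 0 <= a * `|p t - p s| * l1 t by rewrite mulr_ge0 ?(ltW l1t) // mulr_ge0.
have [cs|cs] := boolP (c s).
  have [h1 h2 h3 h4] := Us fs cs t st nf.
  have pts : p s <= p t by case/andP: (h2 t tI).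
  rewrite [`|p t - _|]ger0_norm ?subr_ge0 //; split=> //.
    move=> k kI; case/andP: (h2 k kI) => pk1 pk2.
    by rewrite ger0_norm ?subr_ge0 // lerD2r.
  by rewrite [`|_|]ger0_norm ?subr_ge0 // in el; lra.
have fs' : @flip x1 (fun i => ~~ c i) (~~ c0) s by rewrite flip_reflect.
have [h1 h2 h3 h4] := Ds fs' cs t st (nf' _ _ nf).
have pts : p t <= p s by case/andP: (h2 t tI) => ? _; lra.
rewrite [`|p t - _|]ler0_norm ?subr_le0 //; split=> //.
- by move: h1; rewrite !subKr.
- move=> k kI; case/andP: (h2 k kI) => pk1 pk2.
  by rewrite ler0_norm; lra.
- rewrite [`|_|]ler0_norm ?subr_le0 // in el; move: h4; rewrite opprK; lra.
- by move: h3; rewrite subKr (_ : 1 - p t - (1 - p s) = - (p t - p s)) //; ring.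
Qed.

(** Parallel lines, and [i = i'], give 0 by the convention on inverses; this at most adds a point to
    the finite list [crossings]. *)
Definition line_cross (i i' : J) : R := - (bu i - bu i') / (bv i - bv i').

Definition crossings : seq R := [seq line_cross i i' | i <- enum J, i' <- enum J].

(** The difference of the two lines changes sign between [r] and [s], so it vanishes at a point no
    farther from [r] than [s]. *)
Lemma best_switch i i' r s : i != i' -> is_best bu bv i r -> is_best bu bv i' s ->
  exists2 b, b \in crossings & `|r - b| <= `|r - s|.
Proof.
move=> ii' [_ Hr] [_ Hs]; have hr := Hr i'; have hs := Hs i.
have v0 : bv i - bv i' != 0.
  apply: contra ii' => /eqP v0; apply/eqP; apply: lines_inj; last by lra.
  have vv : bv i = bv i' by lra.
  by rewrite vv in hr hs; lra.
exists (line_cross i i'); first by apply: allpairs_f; rewrite mem_enum.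
set b := line_cross i i'.
have bE : (bv i - bv i') * b = - (bu i - bu i') by rewrite /b /line_cross mulrC divfK.
have h1 : 0 <= (bv i - bv i') * (r - b) by rewrite mulrBr bE; lra.
have h2 : (bv i - bv i') * (s - b) <= 0 by rewrite mulrBr bE; lra.
move: v0; rewrite neq_lt => /orP[v0|v0].
  have rb : r - b <= 0 by rewrite -(nmulr_rge0 _ v0).
  have sb : 0 <= s - b by rewrite -(nmulr_rle0 _ v0).
  by rewrite !ler0_norm; lra.
have rb : 0 <= r - b by rewrite -(pmulr_rge0 _ v0).
have sb : s - b <= 0 by rewrite -(pmulr_rle0 _ v0).
by rewrite !ger0_norm; lra.
Qed.

Hypothesis flips_oo : forall n, exists2 s, (n <= s)%N & fl s.

Lemma next_flip s n : (s < n)%N -> (forall i, (s < i < n)%N -> ~~ fl i) ->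
  exists e, [/\ (n <= e)%N, fl e & noflip s e].
Proof.
move=> sn nf; have exP : exists k, (n <= k)%N && fl k.
  by have [k nk fk] := flips_oo n; exists k; rewrite nk.
case: (ex_minnP exP) => e /andP[ne fe] emin; exists e; split=> //.
move=> i /andP[si ie]; apply/negP => fi.
have [ni|ni] := leqP n i; first by have := emin i; rewrite ni fi leqNgt ie => /(_ isT).
by have := nf i; rewrite si ni fi => /(_ isT).
Qed.

Lemma previous_flip r n : (r < n)%N -> fl r -> exists s,
  [/\ (r <= s)%N, (s < n)%N, fl s & forall i, (s < i < n)%N -> ~~ fl i].
Proof.
move=> rn fr; pose Q k := [&& (r <= k)%N, (k < n)%N & fl k].
have exQ : exists k, Q k by exists r; rewrite /Q leqnn rn.
have bd k : Q k -> (k <= n)%N by case/and3P => _ /ltnW.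
case: (ex_maxnP exQ bd) => s /and3P[rs sn fs] smax; exists s; split=> //.
move=> i /andP[si iN]; apply/negP => fi.
by have := smax i; rewrite /Q (leq_trans rs (ltnW si)) iN fi leqNgt si => /(_ isT).
Qed.

(* Away from the crossings the reply of player 2 is locally constant, so [xi]
   drifts at a definite rate and cannot stay near 0 while [p] moves by [d]. *)
Lemma away_flip (d e : R) : 0 < d -> 0 < e -> \forall r \near \oo, fl r ->
  (forall b, b \in crossings -> d < `|p r - b|) ->
  exists s t, [/\ (r <= s < t)%N, fl s, fl t & noflip s t] /\
    (forall q, (r <= q <= s)%N -> fl q -> `|p q - p r| <= e) /\
    d / 2 <= `|p t - p s|.
Proof.
move=> d0 e0; pose h := Num.min (Num.min e (d / 2)) (1 / 2) / (2 / a0 + 2).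
have a00 : 0 < 2 / a0 + 2 by rewrite addr_gt0 // divr_gt0.
have h0 : 0 < h by rewrite divr_gt0 // !lt_min e0 !divr_gt0.
have [PH0 _] := play_phases; have {}PH0 := PH0 1 ltr01.
near=> r => fr away.
have sync k : (r <= k)%N -> `|l1 k - l2 k| <= h * l1 k.
  by move: k; near: r; apply: nearoo_forall; exact (pl_sync H h0).
have axis k : (r <= k)%N -> fl k -> `|xi k| <= h * l1 k.
  move: k; near: r; apply: nearoo_forall; exact (flip_xi_small H alpha_le h0).
have PH s : (r <= s)%N -> fl s -> forall t, (s <= t)%N -> noflip s t ->
    forall k, (s <= k <= t)%N -> `|p k - p s| <= `|p t - p s|.
  move=> rs fs t st nf; suff : [/\ F (p s) - 1 <= F (p t),
      forall k, (s <= k <= t)%N -> `|p k - p s| <= `|p t - p s|,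
      xi t * (1 - p t) <= (1 + a * `|p t - p s|) * l1 t &
      - xi t * p t <= (1 + a * `|p t - p s|) * l1 t] by case.
  move: s rs fs t st nf; near: r; exact: (nearoo_forall PH0).
(* As long as [p] stays in a ball without crossings, the reply is constant and [xi] moves by
   [alpha * (l2 q - l2 r)]. But [xi] is nearly 0 at both flips, so the clocks have hardly advanced;
   [2 / a0] comes from [xi] and 2 from the desynchronization. *)
have drift q : (r <= q)%N -> fl q -> (forall k, (r <= k < q)%N -> `|p k - p r| < d) ->
    l1 q - l1 r <= (2 / a0 + 2) * h * l1 q.
  move=> rq fq ball.
  have jE k : (r <= k < q)%N -> j k = j r.
    move=> kI; apply/eqP; apply/negPn/negP; rewrite eq_sym => jk.
    have [b bB hb] := best_switch jk (pl_j H r) (pl_j H k).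
    by have := away b bB; have := ball k kI; rewrite distrC; lra.
  have xiE : xi q - xi r = alpha (j r) * (l2 q - l2 r).
    rewrite (@clock_sub_sum _ x2 l2) // => [|k _]; last exact: pl_l2 H k.
    rewrite -(telescope_sumr xi) // mulr_sumr; apply: eq_big_nat => k kI.
    by rewrite (pl_xi H) jE //; ring.
  have l2q : 0 <= l2 q - l2 r by rewrite subr_ge0 (play_l2_mono H).
  have hlq : h * l1 r <= h * l1 q by rewrite ler_pM2l // (play_l1_mono H).
  have : a0 * (l2 q - l2 r) <= 2 * (h * l1 q).
    apply: (@le_trans _ _ `|xi q - xi r|).
      by rewrite xiE normrM (ger0_norm l2q) ler_wpM2r.
    have := axis q rq fq; have := axis r (leqnn r) fr.
    have := ler_normB (xi q) (xi r); lra.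
  rewrite mulrC -ler_pdivlMr // => h1.
  have s1 := sync q rq; have s2 := sync r (leqnn r).
  have -> : (2 / a0 + 2) * h * l1 q = 2 * (h * l1 q) / a0 + 2 * (h * l1 q) by ring.
  by move: s1 s2; rewrite !ler_norml; lra.
have hE : (2 / a0 + 2) * h = Num.min (Num.min e (d / 2)) (1 / 2).
  by rewrite /h mulrC divfK // gt_eqF.
have he : (2 / a0 + 2) * h <= e by rewrite hE !ge_min lexx.
have hd : (2 / a0 + 2) * h <= d / 2 by rewrite hE !ge_min lexx orbT.
have h2 : (2 / a0 + 2) * h <= 1 / 2 by rewrite hE !ge_min lexx orbT.
have close q : (r <= q)%N -> fl q -> (forall k, (r <= k < q)%N -> `|p k - p r| < d) ->
    `|p q - p r| <= (2 / a0 + 2) * h.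
  move=> rq fq /(drift q rq fq) h1; have h3 := play_p_var H rq.
  by rewrite -(ler_pM2r (play_l1_gt0 H q)); apply: le_trans h3 h1.
(* If [p] never left the ball, [drift] would give [l1 q <= 2 * l1 r] at all later flips [q],
   although the clock is unbounded. *)
have [t rt tfar] : exists2 t, (r <= t)%N & d <= `|p t - p r|.
  apply: contrapT => N.
  have ball k : (r <= k)%N -> `|p k - p r| < d.
    by move=> rk; rewrite ltNge; apply/negP => dk; apply: N; exists k.
  have [M _ HM] := pl_l1_oo H (2 * l1 r + 1).
  have [q Mq fq] := flips_oo (maxn M r).
  have rq : (r <= q)%N by rewrite (leq_trans _ Mq) // leq_maxr.
  have /= lq := HM q (leq_trans (leq_maxl _ _) Mq).
  have := drift q rq fq (fun k kI => ball k (proj1 (andP kI))).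
  have : (2 / a0 + 2) * h * l1 q <= 1 / 2 * l1 q by rewrite ler_pM2r ?(play_l1_gt0 H).
  have := play_l1_gt0 H q; lra.
(* [p] first leaves the ball at [u], whereas at all flips before [u] it is close to [p r]. The phase
   containing [u] therefore makes a long move, and by monotonicity its full displacement is at least
   that up to [u]. *)
have [u [/andP[ru ut] ufar umin]] :=
  first_crossing (P := fun k => d <= `|p k - p r|) rt tfar.
rewrite /= in ufar umin; have ltru : (r < u)%N.
  rewrite ltn_neqAle ru andbT; apply/eqP => E.
  by move: ufar; rewrite -E subrr normr0; lra.
have ball k : (r <= k < u)%N -> `|p k - p r| < d.
  by move=> kI; rewrite ltNge; exact: umin.
have [s [rs su fs nf]] := previous_flip ltru fr.
have [v [uv fv nfv]] := next_flip su nf.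
have closeq q : (r <= q)%N -> (q < u)%N -> fl q -> `|p q - p r| <= (2 / a0 + 2) * h.
  move=> rq qu fq; apply: close => // k /andP[rk kq]; apply: ball.
  by rewrite rk (ltn_trans kq).
exists s, v; split; first by split=> //; rewrite rs (leq_trans su).
split.
  move=> q /andP[rq qs] fq; apply: le_trans he; apply: closeq => //.
  exact: leq_ltn_trans qs su.
have := PH s rs fs v (ltnW (leq_trans su uv)) nfv u.
rewrite (ltnW su) uv => /(_ isT) h3.
have := closeq s rs su fs; have := ler_dist_common (p s) (p u) (p r).
rewrite (distrC (p s) (p u)); lra.
Unshelve. all: by end_near. Qed.

Let L_ge0 : 0 <= L.
Proof.
apply: le_trans (normr_ge0 (F 1 - F 0)) _; apply: le_trans (F_lip _ _) _.
by rewrite subr0 normr1 mulr1.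
Qed.

Let F_close r s (d e : R) : `|s - r| <= d -> d * (L + 1) <= e -> `|F s - F r| <= e.
Proof.
move=> h1; apply: le_trans; apply: le_trans (F_lip _ _) _.
by rewrite mulrC; apply: ler_pM => //; lra.
Qed.

(** Take the last flip before [s] at which [F] is at least [(u + v) / 2]. If it is near a crossing,
    the value of [F] there exceeds [v], and the small loss of one phase keeps the next flip above
    the middle. Otherwise a long phase follows soon, and its gain makes up for what was lost before
    it. Both contradict the choice of the flip. *)
Lemma no_descent (u v : R) : u < v ->
  (forall b, b \in crossings -> ~~ (u <= F b <= v)) ->
  \forall t \near \oo, fl t -> v <= F (p t) ->
    forall s, (t <= s)%N -> fl s -> u <= F (p s).
Proof.
move=> uv crit; pose e := (v - u) / 4; have e0 : 0 < e by rewrite divr_gt0 // subr_gt0.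
have L1 : 0 < L + 1 by have := L_ge0; lra.
pose d := e / (L + 1); have d0 : 0 < d by rewrite divr_gt0.
have dL : d * (L + 1) <= e by rewrite /d divfK // gt_eqF.
have [PH0 PB0] := play_phases.
have [k k0 PB1] := PB0 (d / 2) (divr_gt0 d0 (ltr0n _ 2)).
pose e1 := Num.min (k / (L + 1)) d.
have e10 : 0 < e1 by rewrite lt_min d0 divr_gt0.
have e1k : e1 * (L + 1) <= k by rewrite -ler_pdivlMr // ge_min lexx.
have e1e : e1 * (L + 1) <= e by apply: le_trans dL; rewrite ler_pM2r // ge_min lexx orbT.
near=> t => ft vt s ts fs.
have PH r : (t <= r)%N -> fl r -> forall s, (r <= s)%N -> noflip r s -> F (p r) - e <= F (p s).
  move=> tr fr q rq nf; suff : [/\ F (p r) - e <= F (p q),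
      forall k, (r <= k <= q)%N -> `|p k - p r| <= `|p q - p r|,
      xi q * (1 - p q) <= (e + a * `|p q - p r|) * l1 q &
      - xi q * p q <= (e + a * `|p q - p r|) * l1 q] by case.
  move: r tr fr q rq nf; near: t; exact: (nearoo_forall (PH0 e e0)).
have PB r : (t <= r)%N -> fl r -> forall s, (r <= s)%N -> noflip r s ->
    d / 2 <= `|p s - p r| -> F (p r) + k <= F (p s).
  by move: r; near: t; exact: nearoo_forall.
have AW r : (t <= r)%N -> fl r -> (forall b, b \in crossings -> d < `|p r - b|) ->
  exists s t, [/\ (r <= s < t)%N, fl s, fl t & noflip s t] /\
    (forall q, (r <= q <= s)%N -> fl q -> `|p q - p r| <= e1) /\
    d / 2 <= `|p t - p s|.
  by move: r; near: t; exact: (nearoo_forall (away_flip d0 e10)).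
rewrite leNgt; apply/negP => lt.
have lts : (t < s)%N.
  rewrite ltn_neqAle ts andbT; apply/eqP => E; move: lt vt; rewrite E; lra.
pose Q r := [&& (t <= r)%N, (r < s)%N, fl r & (u + v) / 2 <= F (p r)].
have exQ : exists r, Q r by exists t; rewrite /Q leqnn lts ft /=; lra.
have bdQ r : Q r -> (r <= s)%N by case/and4P => _ /ltnW.
case: (ex_maxnP exQ bdQ) => r /and4P[tr rs fr ur] rmax.
have last q : (r < q)%N -> (q <= s)%N -> fl q -> (u + v) / 2 <= F (p q) -> False.
  move=> rq; rewrite leq_eqVlt => /predU1P[->|qs] fq uq; first by lra.
  by have := rmax q; rewrite /Q (leq_trans tr (ltnW rq)) qs fq uq leqNgt rq => /(_ isT).
have before r' q : (r' < s)%N -> noflip r' q -> (q <= s)%N.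
  by move=> r's nf; rewrite leqNgt; apply/negP => sq; have := nf s; rewrite r's sq fs => /(_ isT).
have [[b bB hb]|away] := pselect (exists2 b, b \in crossings & `|p r - b| <= d).
  have Fb := F_close hb dL.
  have vb : v < F b.
    move: (crit b bB) Fb; rewrite negb_and -!ltNge ler_norml /e => /orP[|] //; lra.
  have nf0 i : (r < i < r.+1)%N -> ~~ fl i by rewrite ltnS => /andP[]; case: ltngtP.
  have [q [rq fq nf]] := next_flip (ltnSn r) nf0.
  apply: (last q rq (before r q rs nf) fq).
  by have := PH r tr fr q (ltnW rq) nf; move: Fb; rewrite ler_norml /e; lra.
have [|r1 [r2 [[/andP[rr1 r12] fr1 fr2 nf] [close far]]]] := AW r tr fr.
  by move=> b bB; rewrite ltNge; apply/negP => h; apply: away; exists b.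
have Fr1 : F (p r) + k <= F (p r2) + k.
  have h1 : `|F (p r1) - F (p r)| <= k.
    by apply: F_close e1k; apply: close => //; rewrite rr1 leqnn.
  have := PB r1 (leq_trans tr rr1) fr1 r2 (ltnW r12) nf far.
  by move: h1; rewrite ler_norml; lra.
have [sr1|r1s] := leqP s r1.
  have h1 : `|F (p s) - F (p r)| <= e.
    by apply: F_close e1e; apply: close => //; rewrite (ltnW rs).
  by move: h1; rewrite ler_norml /e; lra.
by apply: (last r2 (leq_ltn_trans rr1 r12) (before r1 r2 r1s nf) fr2); lra.
Unshelve. all: by end_near. Qed.

(** [sup S] is the lower limit of [F] along the flips. A late rise by [k] would exceed some
    [v > sup S], and by [no_descent] [F] would then remain above some [u > sup S]. *)
Lemma no_rise (k : R) : 0 < k -> \forall r \near \oo, fl r ->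
  forall s, (r <= s)%N -> fl s -> F (p s) < F (p r) + k.
Proof.
move=> k0; pose M := `|F 0| + L.
have FM s : - M <= F (p s) <= M.
  rewrite -ler_norml /M; have /andP[h1 h2] := play_p_itv H s.
  have := F_lip 0 (p s); rewrite subr0 (ger0_norm h1) => h3.
  have h4 : L * p s <= L by rewrite ler_piMr.
  by have := ler_normD (F (p s) - F 0) (F 0); rewrite subrK; lra.
pose S : set R := [set u | \forall s \near \oo, fl s -> u <= F (p s)].
have S_sup : has_sup S.
  split; first by exists (- M); near=> s => _; case/andP: (FM s).
  exists M => u [N _ HN]; have [s Ns fs] := flips_oo N.
  by have := HN s Ns fs; have /andP[_] := FM s; lra.
have [u' Su' uL] := sup_adherent (divr_gt0 k0 (ltr0n _ 2)) S_sup.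
have [|u [v [Lu uv vL crit]]] :=
  @finite_avoid _ [seq F b | b <- crossings] (sup S) (sup S + k / 2); first by lra.
have ND : \forall t \near \oo, fl t -> v <= F (p t) ->
    forall s, (t <= s)%N -> fl s -> u <= F (p s).
  by apply: no_descent => // b bB; apply: crit; apply: map_f.
near=> r => fr s rs fs; rewrite ltNge; apply/negP => rise.
have h1 : u' <= F (p r) by move: fr {rise}; near: r.
have stay : fl s -> v <= F (p s) -> forall t, (s <= t)%N -> fl t -> u <= F (p t).
  by move: s rs {fs rise}; near: r; exact: nearoo_forall.
have Su : S u.
  exists s => // t /= st ft; apply: stay => //; lra.
have := ub_le_sup S_sup.2 Su; lra.
Unshelve. all: by end_near. Qed.

(** A long phase would raise [F] by [k], which [no_rise] forbids late in the play. A flip away from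
    all crossings is excluded too, since [away_flip] would produce a long phase. *)
Lemma flips_settle (d : R) : 0 < d -> \forall r \near \oo, fl r ->
  (exists2 b, b \in crossings & `|p r - b| <= d) /\
  forall t, (r <= t)%N -> noflip r t -> `|p t - p r| < d.
Proof.
move=> d0; have L1 : 0 < L + 1 by have := L_ge0; lra.
have [PH0 PB0] := play_phases; have PH1 := PH0 1 ltr01.
have [k k0 PB1] := PB0 (d / 2) (divr_gt0 d0 (ltr0n _ 2)).
pose e := k / 2 / (L + 1).
have k2 : 0 < k / 2 by rewrite divr_gt0.
have e0 : 0 < e by rewrite divr_gt0.
have eL : e * (L + 1) <= k / 2 by rewrite /e divfK // gt_eqF.
have AW := away_flip d0 e0; have NR0 := no_rise k2.
near=> r => fr.
have PH t : (r <= t)%N -> noflip r t -> forall k, (r <= k <= t)%N -> `|p k - p r| <= `|p t - p r|.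
  move=> rt nf; suff : [/\ F (p r) - 1 <= F (p t),
      forall k, (r <= k <= t)%N -> `|p k - p r| <= `|p t - p r|,
      xi t * (1 - p t) <= (1 + a * `|p t - p r|) * l1 t &
      - xi t * p t <= (1 + a * `|p t - p r|) * l1 t] by case.
  by move: fr t rt nf; near: r.
have PB s : (r <= s)%N -> fl s -> forall t, (s <= t)%N -> noflip s t ->
    d / 2 <= `|p t - p s| -> F (p s) + k <= F (p t).
  by move: s; near: r; exact: nearoo_forall.
have NR s : (r <= s)%N -> fl s -> F (p s) < F (p r) + k / 2.
  by move: fr s; near: r.
split.
  apply: contrapT => N.
  have [s [t [[/andP[rs st] fs ft nf] [close far]]]] : exists s t,
      [/\ (r <= s < t)%N, fl s, fl t & noflip s t] /\
      (forall q, (r <= q <= s)%N -> fl q -> `|p q - p r| <= e) /\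
      d / 2 <= `|p t - p s|.
    suff : forall b, b \in crossings -> d < `|p r - b|.
      by move: fr {N PH PB NR}; near: r.
    by move=> b bB; rewrite ltNge; apply/negP => h; apply: N; exists b.
  have := PB s rs fs t (ltnW st) nf far; have := NR t (leq_trans rs (ltnW st)) ft.
  have : `|F (p s) - F (p r)| <= k / 2.
    by apply: F_close eL; apply: close => //; rewrite rs leqnn.
  by rewrite ler_norml; lra.
(* The bound for an intermediate [t] follows from the next flip, since the displacement of a phase
   is largest at its end. *)
move=> t rt nf; rewrite ltNge; apply/negP => far.
have ltrt : (r < t)%N.
  by rewrite ltn_neqAle rt andbT; apply/eqP => E; move: far; rewrite E subrr normr0; lra.
have [q [tq fq nfq]] := next_flip ltrt nf.
have rq := leq_trans rt tq.
have h1 := PH q rq nfq t; rewrite rt tq in h1; have {}h1 := h1 isT.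
have := PB r (leqnn r) fr q rq nfq; have := NR q rq fq.
have : d / 2 <= `|p q - p r| by lra.
by move=> h2 h3 /(_ h2); lra.
Unshelve. all: by end_near. Qed.

End Convergence.

End PlayPhases.

(** * Construction of the potential and convergence of the play *)

Section PlayConvergence.
Context {R : realType} {J : finType}.

Lemma max_lip (x r s : R) : `|Num.max s x - Num.max r x| <= `|s - r|.
Proof.
have h1 := ler_norm (s - r); have h2 := ler_norm (r - s); rewrite distrC in h2.
case: (leP s x) => h3; case: (leP r x) => h4.
all: by rewrite ler_norml; apply/andP; split; move: (normr_ge0 (s - r)); lra.
Qed.

Lemma min_lip (x r s : R) : `|Num.min s x - Num.min r x| <= `|s - r|.
Proof.
have h1 := ler_norm (s - r); have h2 := ler_norm (r - s); rewrite distrC in h2.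
case: (leP s x) => h3; case: (leP r x) => h4.
all: by rewrite ler_norml; apply/andP; split; move: (normr_ge0 (s - r)); lra.
Qed.

Section Potential.
Context (bu bv alpha : J -> R).
Hypothesis lines_inj : forall i i', bu i = bu i' -> bv i = bv i' -> i = i'.

Definition best_region (i : J) : set R := [set r | is_best bu bv i r].

(** The projection of the line onto the interval where reply [i] is best; the value 0 for an empty
    region is a default, harmless because it is constant. *)
Definition region_clip (i : J) (r : R) : R :=
  if `[< best_region i !=set0 >]
  then Num.min (Num.max r (inf (best_region i))) (sup (best_region i)) else 0.

Lemma best_region_bounds i r : best_region i r ->
  has_inf (best_region i) /\ has_sup (best_region i).
Proof.
move=> Ir; split; split; try by exists r.
  by exists 0 => s [/andP[]].
by exists 1 => s [/andP[]].
Qed.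

Lemma best_region_inside i r : inf (best_region i) < r -> r < sup (best_region i) ->
  best_region i !=set0 -> best_region i r.
Proof.
move=> ir rs [z Iz]; have [hi hs] := best_region_bounds Iz.
have rs0 : 0 < sup (best_region i) - r by rewrite subr_gt0.
have ir0 : 0 < r - inf (best_region i) by rewrite subr_gt0.
have [x [/andP[x0 x1] Hx] xr] := inf_adherent ir0 hi.
have [y [/andP[y0 y1] Hy] yr] := sup_adherent rs0 hs.
have {}xr : x < r by move: xr; rewrite addrC subrK.
have {}yr : r < y by move: yr; rewrite subKr.
split; first by apply/andP; split; lra.
move=> i'; have h1 := Hx i'; have h2 := Hy i'.
have yx : 0 < y - x by lra.
rewrite -subr_ge0 -(pmulr_rge0 _ yx).
have -> : (y - x) * (bu i + bv i * r - (bu i' + bv i' * r)) =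
   (y - r) * (bu i + bv i * x - (bu i' + bv i' * x)) +
   (r - x) * (bu i + bv i * y - (bu i' + bv i' * y)) by ring.
by rewrite addr_ge0 // mulr_ge0 // subr_ge0 // ltW.
Qed.

Lemma region_clip_lip i r s : `|region_clip i s - region_clip i r| <= `|s - r|.
Proof.
rewrite /region_clip; case: asboolP => [_|_]; last by rewrite subrr normr0.
exact: le_trans (min_lip _ _ _) (max_lip _ _ _).
Qed.

Lemma region_clip_id i r : is_best bu bv i r -> region_clip i r = r.
Proof.
move=> Ir; have [hi hs] := best_region_bounds Ir.
rewrite /region_clip; case: asboolP => [_|]; last by case; exists r.
rewrite max_l; last exact: ge_inf hi.2 _ Ir.
by rewrite min_l //; exact: ub_le_sup hs.2 _ Ir.
Qed.

(** Otherwise an interior point of the region of [i] would lie strictly between [r] and [s], where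
    only [j] can be best. *)
Lemma region_clip_const i j r s : i != j -> r < s -> is_best bu bv j r -> is_best bu bv j s ->
  region_clip i r = region_clip i s.
Proof.
move=> ij rs Jr Js; rewrite /region_clip; case: asboolP => // n0.
have [z Iz] := n0; have [hi hs] := best_region_bounds Iz.
set x := inf _; set y := sup _.
have xz : x <= z by exact: ge_inf hi.2 _ Iz.
have zy : z <= y by exact: ub_le_sup hs.2 _ Iz.
have [xy|xy] := leP (Num.min s y) (Num.max r x).
  move: xy; have xy' := le_trans xz zy.
  have ys : y <= s -> y <= Num.max s x by move=> h; rewrite le_max h.
  case: (leP s y) => h1; case: (leP r x) => h2 h3.
  - by rewrite (max_r h3).
  - by exfalso; lra.
  - by rewrite (min_r h3) min_r // ys // ltW.
  - by rewrite (min_r h3) min_r // ys // ltW.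
have [h1 h2] := (midf_lt xy); exfalso; case/eqP: ij.
set m := (_ + _) / 2 in h1 h2.
move: h1 h2; rewrite gt_max lt_min => /andP[rm xm] /andP[ms my].
apply: (is_best_inside lines_inj rm ms Jr Js).
exact: best_region_inside.
Qed.

(** A primitive of a step function without integration: the projection onto the region of [i] has
    slope 1 on that region and 0 on the others, so weighting it by [alpha i] and summing gives the
    prescribed slopes. *)
Lemma exists_potential : exists L F,
  (forall r s, `|F s - F r| <= L * `|s - r|) /\ slope_on bu bv alpha F.
Proof.
exists (\sum_i `|alpha i|), (fun r => \sum_i alpha i * region_clip i r); split.
  move=> r s; rewrite -sumrB mulr_suml; apply: le_trans (ler_norm_sum _ _ _) _.
  by apply: ler_sum => i _; rewrite -mulrBr normrM ler_wpM2l // region_clip_lip.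
have lt i r s : r < s -> is_best bu bv i r -> is_best bu bv i s ->
    \sum_i' alpha i' * region_clip i' s - \sum_i' alpha i' * region_clip i' r =
    alpha i * (s - r).
  move=> rs Ir Is; rewrite -sumrB (bigD1 i) //= big1 ?addr0 => [|i' ii'].
    by rewrite !region_clip_id // mulrBr.
  by rewrite (region_clip_const ii' rs Ir Is) subrr.
move=> i r s Ir Is; have [rs|sr|->] := ltgtP r s; first exact: lt.
  by rewrite -[LHS]opprB (lt i s r) //; ring.
by rewrite !subrr mulr0.
Qed.

End Potential.

(** Divided by player 2's clock, [xi * (1 - p)] and [- xi * p] are the gains of player 1 from
    switching to her first and second action. Convergence of [p] is what player 2's replies
    require. *)
Definition settles (l1 p xi : nat -> R) : Prop :=
  (exists p0, forall d : R, 0 < d -> \forall k \near \oo, `|p k - p0| <= d) /\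
  forall e : R, 0 < e -> \forall k \near \oo,
    xi k * (1 - p k) <= e * l1 k /\ - xi k * p k <= e * l1 k.

Lemma settles_reflect l1 p xi :
  settles l1 (fun k => 1 - p k) (fun k => - xi k) -> settles l1 p xi.
Proof.
case=> [[p0 Hp] Hx]; split.
  exists (1 - p0) => d /Hp; apply: filterS => k.
  by rewrite (_ : 1 - p k - p0 = - (p k - (1 - p0))) ?normrN //; ring.
by move=> e /Hx; apply: filterS => k; rewrite opprK subKr => -[].
Qed.

(** Eventually player 1 updates with one action only, say the first. Then [1 - p] tends to 0 while
    [xi] is O(l1), and the sign of [xi] is right up to o(l1). *)
Lemma no_flip_settles (bu bv alpha : J -> R) (a : R) (x1 x2 c : nat -> bool)
    (j : nat -> J) (l1 l2 p xi : nat -> R) (c0 : bool) :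
  (forall i, `|alpha i| <= a) ->
  play bu bv alpha x1 x2 c j l1 l2 p xi c0 ->
  (\forall k \near \oo, ~~ @flip x1 c c0 k) -> settles l1 p xi.
Proof.
move=> alpha_le H [N _ HN].
have lastE k : (N <= k)%N -> @last_play x1 c c0 k = @last_play x1 c c0 N.
  elim: k => [|k IH]; first by rewrite leqn0 => /eqP ->.
  rewrite leq_eqVlt => /predU1P[->//|Nk] /=; rewrite -(IH Nk).
  by have := HN k Nk; rewrite /= /flip; case: (x1 k) => //= /negPn/eqP.
wlog lastN : bu bv alpha c p xi c0 alpha_le H HN lastE / @last_play x1 c c0 N.
  move=> wl; have [|nN] := boolP (@last_play x1 c c0 N); first exact: wl H HN lastE.
  apply: settles_reflect.
  have E k : @last_play x1 (fun i => ~~ c i) (~~ c0) k = ~~ @last_play x1 c c0 k.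
    by elim: k => //= k ->; case: (x1 k).
  apply: wl (play_reflect H) _ _ _.
  - by move=> i; rewrite normrN.
  - by move=> k Nk; rewrite /= flip_reflect; exact: HN.
  - by move=> k Nk; rewrite !E lastE.
  - by rewrite E.
have cst k : (N <= k)%N -> l1 k * (1 - p k) = l1 N * (1 - p N).
  elim: k => [|k IH]; first by rewrite leqn0 => /eqP ->.
  rewrite leq_eqVlt => /predU1P[->//|Nk]; rewrite -(IH Nk) !mulrBr (pl_p H) (pl_l1 H).
  have := HN k Nk; rewrite /= /flip lastE // lastN.
  by case: (x1 k) (c k) => [] [] //= _; ring.
have q0 k : 0 <= 1 - p k <= 1 by have := play_p_itv H k; lra.
have a0 : 0 <= a := le_trans (normr_ge0 _) (alpha_le (j 0%N)).
have small d : 0 < d -> \forall k \near \oo, 1 - p k <= d.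
  move=> d0; near=> k; have l1k := play_l1_gt0 H k.
  rewrite -(ler_pM2l l1k) cst; last by near: k; exact: nbhs_infty_ge.
  apply: (@le_trans _ _ (l1 N)).
    by rewrite ler_piMr ?(ltW (play_l1_gt0 H N)) //; case/andP: (q0 N).
  by rewrite -ler_pdivrMr //; near: k; exact: pl_l1_oo H _.
split.
  exists 1 => d d0; apply: filterS (small d d0) => k.
  by rewrite distrC ger0_norm //; case/andP: (q0 k).
move=> e e0; pose M := `|xi 0%N| + a * (2 + `|l2 0%N|).
have M0 : 0 <= M by rewrite addr_ge0 // mulr_ge0 // addr_ge0.
have sgn := last_play_sign H alpha_le e0.
near=> k; have l1k := play_l1_gt0 H k; have l1k1 := play_l1_ge1 H k.
have /andP[q1 q2] := q0 k.
split.
  have xik : xi k <= M * l1 k.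
    have := play_xi_var H alpha_le (leq0n k); rewrite ler_norml => /andP[_ h1].
    have h2 : `|l1 k - l2 k| <= 1 * l1 k by near: k; exact (pl_sync H ltr01).
    have h3 : `|xi 0%N| <= `|xi 0%N| * l1 k by rewrite ler_peMr.
    have h3' : `|l2 0%N| <= `|l2 0%N| * l1 k by rewrite ler_peMr.
    have h4 : a * (l2 k - l2 0%N) <= a * ((2 + `|l2 0%N|) * l1 k).
      rewrite ler_wpM2l //; have := ler_norm (- l2 0%N); rewrite normrN.
      by move: h2; rewrite ler_norml; lra.
    have := ler_norm (xi 0%N); rewrite /M; lra.
  have h6 : 1 - p k <= e / (M + 1) by near: k; apply: small; rewrite divr_gt0 //; lra.
  apply: (@le_trans _ _ (M * l1 k * (1 - p k))); first by rewrite ler_wpM2r.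
  apply: (@le_trans _ _ (M * l1 k * (e / (M + 1)))).
    by rewrite ler_wpM2l // mulr_ge0 // ltW.
  rewrite -subr_ge0 (_ : _ - _ = e * l1 k / (M + 1)); last by field; lra.
  by rewrite divr_ge0 ?mulr_ge0 //; lra.
have : if @last_play x1 c c0 k then - (e * l1 k) <= xi k else xi k <= e * l1 k.
  by near: k.
rewrite lastE; last by near: k; exact: nbhs_infty_ge.
rewrite lastN => h; apply: (@le_trans _ _ (e * l1 k * p k)).
  by rewrite ler_wpM2r //; lra.
by rewrite ler_piMr ?mulr_ge0 //; lra.
Unshelve. all: by end_near. Qed.

(** Each late time belongs to a phase that started near a crossing and has moved little; since the
    crossings are finite in number and the steps tend to 0, [p] is trapped at one of them. *)
Lemma flips_oo_settles (bu bv alpha : J -> R) (a a0 L : R) (F : R -> R)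
    (x1 x2 c : nat -> bool) (j : nat -> J) (l1 l2 p xi : nat -> R) (c0 : bool) :
  (forall i i', bu i = bu i' -> bv i = bv i' -> i = i') ->
  (forall i, `|alpha i| <= a) -> (forall i, a0 <= `|alpha i|) -> 0 < a0 ->
  (forall r s, `|F s - F r| <= L * `|s - r|) -> slope_on bu bv alpha F ->
  play bu bv alpha x1 x2 c j l1 l2 p xi c0 ->
  (forall n, exists2 s, (n <= s)%N & @flip x1 c c0 s) -> settles l1 p xi.
Proof.
move=> inj ale age a00 Flip Fslope H oo.
have FS := flips_settle inj ale age a00 Flip Fslope H oo.
have [PH _] := play_phases inj ale age a00 Flip Fslope H.
have a_ge0 : 0 <= a := le_trans (normr_ge0 _) (ale (j 0%N)).
have recent (P : nat -> Prop) : (\forall r \near \oo, @flip x1 c c0 r -> P r) ->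
    \forall k \near \oo, exists r, [/\ (r <= k)%N, @flip x1 c c0 r, P r &
      forall i, (r < i < k)%N -> ~~ @flip x1 c c0 i].
  case=> N _ HN; have [r0 Nr0 fr0] := oo N; exists r0 => // k /= r0k.
  have [r [r0r rk fr nf]] := @previous_flip _ _ _ _ _ (r0k : (r0 < k.+1)%N) fr0.
  exists r; split=> //; first by apply: HN => //; exact: leq_trans r0r.
  by move=> i /andP[ri ik]; apply: nf; rewrite ri ltnS ltnW.
split.
  have [|d d0|b Hb] := @trapped_cvg _ (crossings bu bv) p; last by exists b.
    move=> d d0; have d20 : 0 < d / 2 by rewrite divr_gt0.
    apply: filterS (recent _ (FS _ d20)) => k [r [rk fr [[b bB hb] sh] nf]].
    exists b => //; have := sh k rk nf; have := ler_dist_common (p r) (p k) b.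
    by rewrite (distrC (p r)); lra.
  exact: (play_p_step H).
move=> e e0; pose d := e / 2 / (a + 1).
have a1 : 0 < a + 1 by lra.
have d0 : 0 < d by rewrite !divr_gt0.
have e20 : 0 < e / 2 by rewrite divr_gt0.
have ad : a * d <= e / 2.
  have : (a + 1) * d = e / 2 by rewrite /d mulrC divfK // gt_eqF.
  by lra.
have both : \forall r \near \oo, @flip x1 c c0 r ->
    forall t, (r <= t)%N -> (forall i, (r < i < t)%N -> ~~ @flip x1 c c0 i) ->
    xi t * (1 - p t) <= e * l1 t /\ - xi t * p t <= e * l1 t.
  apply: filterS2 (FS d d0) (PH _ e20) => r Hr Hp fr t rt nf.
  have [_ /(_ t rt nf) sh] := Hr fr; have [_ _ h1 h2] := Hp fr t rt nf.
  have l1t := play_l1_gt0 H t.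
  have le : (e / 2 + a * `|p t - p r|) * l1 t <= e * l1 t.
    rewrite ler_pM2r //; have : a * `|p t - p r| <= a * d by rewrite ler_wpM2l // ltW.
    lra.
  by split; [exact: le_trans h1 le|exact: le_trans h2 le].
by apply: filterS (recent _ both) => k [r [rk fr Hr nf]]; exact: Hr.
Qed.

Theorem play_settles (bu bv alpha : J -> R) (x1 x2 c : nat -> bool)
    (j : nat -> J) (l1 l2 p xi : nat -> R) (c0 : bool) :
  (forall i i', bu i = bu i' -> bv i = bv i' -> i = i') ->
  (forall i, alpha i != 0) ->
  play bu bv alpha x1 x2 c j l1 l2 p xi c0 -> settles l1 p xi.
Proof.
move=> inj nz H; pose a := \sum_i `|alpha i|.
have ale i : `|alpha i| <= a.
  by rewrite /a (bigD1 i) //= lerDl sumr_ge0.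
have [no|oo] := infinitely_often (@flip x1 c c0); first exact: no_flip_settles ale H no.
pose b := \sum_i `|alpha i|^-1.
have ble i : `|alpha i|^-1 <= b.
  by rewrite /b (bigD1 i) //= lerDl sumr_ge0 // => k _; rewrite invr_ge0.
have b0 : 0 < b by apply: lt_le_trans (ble (j 0%N)); rewrite invr_gt0 normr_gt0.
have age i : b^-1 <= `|alpha i|.
  by rewrite -[leRHS]invrK lef_pV2 ?posrE ?invr_gt0 ?normr_gt0.
have [L [F [Flip Fslope]]] := exists_potential alpha inj.
apply: flips_oo_settles ale age _ Flip Fslope H oo => //.
by rewrite invr_gt0.
Qed.

End PlayConvergence.

(** * Payoffs and approximate equilibria *)

Section Continuity.
Context {T : topologicalType} {R : realType}.

Lemma continuous_big_sum (I : Type) (r : seq I) (g : I -> T -> R) :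
  (forall i, continuous (g i)) -> continuous (fun x => \sum_(i <- r) g i x).
Proof.
move=> gc; elim: r => [|i r IH].
  have -> : (fun x => \sum_(i <- [::]) g i x) = cst 0 by apply/funext => x; rewrite big_nil.
  exact: cst_continuous.
have -> : (fun x => \sum_(k <- i :: r) g k x) = (fun x => g i x + \sum_(k <- r) g k x).
  by apply/funext => x; rewrite big_cons.
by move=> x; apply: cvgD; [exact: gc|exact: IH].
Qed.

Lemma continuous_big_prod (I : Type) (r : seq I) (g : I -> T -> R) :
  (forall i, continuous (g i)) -> continuous (fun x => \prod_(i <- r) g i x).
Proof.
move=> gc; elim: r => [|i r IH].
  have -> : (fun x => \prod_(i <- [::]) g i x) = cst 1 by apply/funext => x; rewrite big_nil.
  exact: cst_continuous.
have -> : (fun x => \prod_(k <- i :: r) g k x) = (fun x => g i x * \prod_(k <- r) g k x).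
  by apply/funext => x; rewrite big_cons.
by move=> x; apply: cvgM; [exact: gc|exact: IH].
Qed.

Lemma cluster_le (s : nat -> T) (x : T) (g : T -> R) (v : R) :
  cluster (s @ \oo) x -> continuous g ->
  (forall e : R, 0 < e -> \forall k \near \oo, g (s k) <= v + e) -> g x <= v.
Proof.
move=> cx gc ev; rewrite leNgt; apply/negP => lt.
pose e := (g x - v) / 2; have e0 : 0 < e by rewrite divr_gt0 // subr_gt0.
have nb : nbhs x [set y | v + e < g y].
  apply: (gc x [set r | v + e < r]); apply: open_nbhs_nbhs; split; first exact: open_gt.
  by rewrite /= /e; lra.
have [y [/= yA yB]] := cx [set y | g y <= v + e] [set y | v + e < g y] (ev e e0) nb.
by move: yB; rewrite ltNge yA.
Qed.

End Continuity.

Section Payoff.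
Context {R : realType} {n : nat} {Y : 'I_n -> finType}.
Implicit Types (u : payoffs R Y) (p q : mixed R Y).

Lemma dfwith_self p i : dfwith p i (p i) = p.
Proof.
by apply: functional_extensionality_dep => k; case: dfwithP.
Qed.

Lemma expected_payoff_expand u i p j (x : Y j -> R) :
  expected_payoff u i (dfwith p j x) =
  \sum_y x y * expected_payoff u i (dfwith p j (pure y)).
Proof.
rewrite /expected_payoff; under [RHS]eq_bigr do rewrite mulr_sumr.
rewrite exchange_big; apply: eq_bigr => z _ /=.
under [RHS]eq_bigr do rewrite mulrCA; rewrite -mulr_sumr; congr (_ * _).
have prodE x' : \prod_(k < n) dfwith p j x' k (z k) =
    x' (z j) * \prod_(k < n | k != j) p k (z k).
  rewrite (bigD1 j) //= dfwithin; congr (_ * _).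
  by apply: eq_bigr => k kj; rewrite dfwithout // eq_sym.
under [RHS]eq_bigr do rewrite prodE mulrA; rewrite -mulr_suml prodE; congr (_ * _).
rewrite (bigD1 (z j)) //= /pure eqxx mulr1 big1 ?addr0 // => y yz.
by rewrite eq_sym (negbTE yz) mulr0.
Qed.

Lemma expected_payoff_mix u i p j :
  expected_payoff u i p =
  \sum_y p j y * expected_payoff u i (dfwith p j (pure y)).
Proof. by rewrite -expected_payoff_expand dfwith_self. Qed.

Lemma simplex_pure (T : finType) (y : T) : simplex (R := R) (pure y).
Proof.
split=> [z|]; first exact: ler0n.
rewrite (bigD1 y) //= big1 ?addr0 /pure ?eqxx // => z zy.
by rewrite (negbTE zy).
Qed.

Lemma simplex_le1 (T : finType) (x : T -> R) y : simplex x -> x y <= 1.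
Proof.
case=> x0 <-; rewrite (bigD1 y) //= lerDl; exact: sumr_ge0.
Qed.

Lemma simplex_dfwith p j x : (forall i, simplex (p i)) -> simplex x ->
  forall i, simplex (dfwith p j x i).
Proof. by move=> ps xs i; case: dfwithP. Qed.

Lemma average_le (T : finType) (x : T -> R) (g : T -> R) (v : R) :
  simplex x -> (forall y, g y <= v) -> \sum_y x y * g y <= v.
Proof.
case=> x0 x1 gv; rewrite -[leRHS]mul1r -x1 mulr_suml.
by apply: ler_sum => y _; rewrite ler_wpM2l.
Qed.

Lemma prod_dist_le (I : Type) (r : seq I) (f g : I -> R) :
  (forall i, `|f i| <= 1) -> (forall i, `|g i| <= 1) ->
  `|\prod_(i <- r) f i - \prod_(i <- r) g i| <= \sum_(i <- r) `|f i - g i|.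
Proof.
move=> f1 g1; elim: r => [|i r IH]; first by rewrite !big_nil subrr normr0.
rewrite !big_cons.
have -> : f i * \prod_(j <- r) f j - g i * \prod_(j <- r) g j =
  (f i - g i) * \prod_(j <- r) f j + g i * (\prod_(j <- r) f j - \prod_(j <- r) g j).
  by ring.
apply: le_trans (ler_normD _ _) _; rewrite !normrM; apply: lerD.
  rewrite ler_piMr // normr_prod; elim: r {IH} => [|k r IH]; first by rewrite big_nil.
  by rewrite big_cons mulr_ile1 // prodr_ge0.
by apply: le_trans IH; rewrite ler_piMl.
Qed.

Lemma expected_payoff_lip u i : exists2 C : R, 0 <= C & forall p q,
  (forall j, simplex (p j)) -> (forall j, simplex (q j)) ->
  `|expected_payoff u i p - expected_payoff u i q| <=
  C * \sum_j \sum_y `|p j y - q j y|.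
Proof.
exists (\sum_y `|u (i, y)|) => [|p q ps qs]; first exact: sumr_ge0.
rewrite /expected_payoff -sumrB mulr_suml.
apply: le_trans (ler_norm_sum _ _ _) _; apply: ler_sum => y _.
rewrite -mulrBr normrM ler_wpM2l //.
have s1 (r : mixed R Y) : (forall j, simplex (r j)) -> forall j, `|r j (y j)| <= 1.
  by move=> rs j; rewrite ger0_norm ?simplex_le1 //; case: (rs j).
apply: le_trans (prod_dist_le _ (s1 p ps) (s1 q qs)) _.
by apply: ler_sum => j _; rewrite (bigD1 (y j)) //= lerDl sumr_ge0.
Qed.

Lemma nash_of_pure u p : (forall i, simplex (p i)) ->
  (forall i y, expected_payoff u i (dfwith p i (pure y)) <= expected_payoff u i p) ->
  nash_equilibria u p.
Proof.
move=> ps H; split=> // i x xs; rewrite expected_payoff_expand.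
exact: average_le.
Qed.

Lemma continuous_expected_payoff (T : topologicalType) u i (f : T -> mixed R Y) :
  (forall j y, continuous (fun t => f t j y)) ->
  continuous (fun t => expected_payoff u i (f t)).
Proof.
move=> fc; apply: continuous_big_sum => y x; apply: cvgM; first exact: cvg_cst.
by apply: continuous_big_prod => j; exact: fc.
Qed.

(** [mixed] with its product topology, so that Tychonoff's theorem makes the box of strategy
    profiles compact. *)
Let mixed_top : topologicalType :=
  prod_topology (fun i : 'I_n => prod_topology (fun _ : Y i => R)).

Let coord_continuous j y : continuous (fun p : mixed_top => p j y).
Proof.
move=> p; apply: (@continuous_comp _ _ _ (fun p : mixed_top => p j)
  (fun x : prod_topology (fun _ : Y j => R) => x y)); exact: proj_continuous.
Qed.

Let box_compact : compact [set p : mixed_top | forall i, [set x | forall y, `[0, 1]%classic (x y)] (p i)].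
Proof.
apply: (@tychonoff 'I_n (fun i => prod_topology (fun _ : Y i => R))
  (fun i => [set x | forall y, `[0, 1]%classic (x y)])) => i.
apply: (@tychonoff (Y i) (fun _ => R) (fun=> `[0, 1]%classic)) => y.
exact: segment_compact.
Qed.

(** Otherwise there are 1/(m+1)-equilibria at distance at least [e] from [nash_equilibria u]. A
    cluster point of them is an equilibrium by continuity, and its distance to itself would be at
    least [e]. *)
Lemma approximate_nash_near_nash u (e : R) : 0 < e -> exists2 d : R, 0 < d &
  forall p, (forall i, simplex (p i)) ->
  (forall i y, expected_payoff u i (dfwith p i (pure y)) <= expected_payoff u i p + d) ->
  exists2 p', nash_equilibria u p' & euclidean_dist p p' < e.
Proof.
move=> e0; apply: contrapT => N.
have /choice[s Hs] : forall m : nat, exists p : mixed R Y,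
    [/\ forall i, simplex (p i),
      forall i y, expected_payoff u i (dfwith p i (pure y)) <=
        expected_payoff u i p + m.+1%:R^-1 &
      forall p', nash_equilibria u p' -> e <= euclidean_dist p p'].
  move=> m; apply: contrapT => Nm; apply: N; exists m.+1%:R^-1; first by rewrite invr_gt0.
  move=> p ps pd; apply: contrapT => Np; apply: Nm; exists p; split=> // p' p'N.
  by rewrite leNgt; apply/negP => lt; apply: Np; exists p'.
have [|p [_ cp]] := box_compact (F := (s : nat -> mixed_top) @ \oo) _.
  exists 0%N => // m _ i y; have [/(_ i) si _ _] := Hs m.
  by rewrite /= in_itv /= simplex_le1 // andbT; case: si.
have le1 (g : mixed_top -> R) v : continuous g -> (forall m, g (s m) <= v) -> g p <= v.
  move=> gc gv; apply: (cluster_le cp gc) => d d0.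
  by exists 0%N => // m _ /=; apply: le_trans (gv m) _; rewrite lerDl ltW.
have cdev i y : continuous (fun q : mixed_top =>
    expected_payoff u i (dfwith (q : mixed R Y) i (pure y))).
  apply: (@continuous_expected_payoff mixed_top u i
    (fun q' => dfwith (q' : mixed R Y) i (pure y))) => j z.
  have [ij|ij] := eqVneq i j.
    move: z; rewrite -ij => z; rewrite (_ : (fun _ => _) = cst (pure y z)) => [|]; first exact: cst_continuous.
    by apply/funext => q'; rewrite dfwithin.
  rewrite (_ : (fun _ => _) = (fun q' : mixed_top => q' j z)) => [|].
    exact: coord_continuous.
  by apply/funext => q'; rewrite dfwithout.
have cself i : continuous (fun q : mixed_top => expected_payoff u i (q : mixed R Y)).
  apply: (@continuous_expected_payoff mixed_top u i (fun q' => q')) => j z.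
  exact: coord_continuous.
have cont i y : continuous (fun q : mixed_top =>
    expected_payoff u i (dfwith (q : mixed R Y) i (pure y))
    - expected_payoff u i (q : mixed R Y)).
  by move=> q; exact (cvgB (cdev i y q) (cself i q)).
have csum i : continuous (fun q : mixed_top => \sum_y q i y).
  by apply: continuous_big_sum => y; exact: coord_continuous.
have pN : nash_equilibria u p.
  apply: nash_of_pure => [i|i y].
    split=> [y|].
      rewrite -oppr_le0; apply: (le1 (fun q => - q i y)).
        by move=> q; exact (cvgN (@coord_continuous i y q)).
      by move=> m; rewrite oppr_le0; have [/(_ i) [h _] _ _] := Hs m; exact: h.
    apply/eqP; rewrite eq_le; apply/andP; split.
      by apply: (le1 _ _ (csum i)) => m; have [/(_ i) [_ ->]] := Hs m.
    rewrite -lerN2; apply: (le1 (fun q => - \sum_y q i y)).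
      by move=> q; exact (cvgN (csum i q)).
    by move=> m; have [/(_ i) [_ ->]] := Hs m.
  rewrite -subr_le0; apply: (cluster_le cp (cont i y)) => d d0; rewrite add0r.
  near=> m; have [_ h _] := Hs m; rewrite lerBlDr; apply: le_trans (h i y) _.
  rewrite addrC lerD2r; apply: ltW; near: m; exact: near_infty_natSinv_lt (PosNum d0).
pose g (q : mixed_top) : R := \sum_i \sum_y (q i y - p i y) ^+ 2.
have gc : continuous g.
  apply: continuous_big_sum => i; apply: continuous_big_sum => y q.
  have h : (fun q' : mixed_top => q' i y - p i y) x @[x --> q] --> q i y - p i y.
    exact (cvgB (@coord_continuous i y q) (cvg_cst (p i y))).
  exact (cvgM h h).
have : - g p <= - e ^+ 2.
  apply: (le1 (fun q => - g q)); first by move=> q; exact (cvgN (gc q)).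
  move=> m; rewrite lerN2; have [_ _ /(_ p pN)] := Hs m.
  rewrite /euclidean_dist => h.
  have : e ^+ 2 <= Num.sqrt (g (s m)) ^+ 2 by rewrite ler_pXn2r ?nnegrE ?sqrtr_ge0 ?(ltW e0).
  rewrite sqr_sqrtr //; apply: sumr_ge0 => i _; apply: sumr_ge0 => y _; exact: sqr_ge0.
rewrite lerN2 /g big1 => [|i _]; last by rewrite big1 // => y _; rewrite subrr expr0n.
by have := exprn_gt0 2 e0; lra.
Unshelve. all: by end_near. Qed.

End Payoff.

(** * Asynchronous fictitious play *)

Section Async.
Context {R : realType} {n : nat} {Y : 'I_n -> finType}.

(* Fictitious play in which player [i] updates at step [k] exactly when
   [x i k] holds; [l i] counts her updates and [c i k] is her best reply to the
   empirical profile [q k], recorded also at the steps without update. *)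
Record async_fp (u : payoffs R Y) (x : 'I_n -> nat -> bool) (l : 'I_n -> nat -> R)
    (c : forall i, nat -> Y i) (q : nat -> mixed R Y) (y0 : forall i, Y i) : Prop := AsyncFp {
  af_l0 : forall i, l i 0%N = 1;
  af_l : forall i k, l i k.+1 = l i k + (x i k)%:R;
  af_q0 : forall i, q 0%N i = pure (y0 i);
  af_q : forall i k y, l i k.+1 * q k.+1 i y = l i k * q k i y + (x i k)%:R * pure (c i k) y;
  af_best : forall i k, best_replies u i (q k) (c i k);
  af_oo : forall i (M : R), \forall k \near \oo, M <= l i k;
  af_sync : forall i j (e : R), 0 < e -> \forall k \near \oo, `|l i k - l j k| <= e * l i k }.

Arguments af_best {u x l c q y0} _ i k _.

Definition reply_gap (u : payoffs R Y) (c : forall i, nat -> Y i) (q : nat -> mixed R Y) i k : R :=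
  expected_payoff u i (dfwith (q k) i (pure (c i k))) - expected_payoff u i (q k).

Section Basics.
Context {u : payoffs R Y} {x : 'I_n -> nat -> bool} {l : 'I_n -> nat -> R}
  {c : forall i, nat -> Y i} {q : nat -> mixed R Y} {y0 : forall i, Y i}.
Arguments q _ _ _ : clear implicits.
Hypothesis H : async_fp u x l c q y0.

Lemma af_mono i s t : (s <= t)%N -> l i s <= l i t.
Proof. by apply: (clock_le (x := x i)) => k _; exact: af_l H i k. Qed.

Lemma af_l_ge1 i k : 1 <= l i k.
Proof. by rewrite -(af_l0 H i) af_mono. Qed.

Lemma af_l_gt0 i k : 0 < l i k.
Proof. exact: lt_le_trans ltr01 (af_l_ge1 i k). Qed.

Lemma af_simplex k i : simplex (q k i).
Proof.
elim: k => [|k [q0 q1]]; first by rewrite (af_q0 H); exact: simplex_pure.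
split=> [y|].
  rewrite -(pmulr_rge0 _ (af_l_gt0 i k.+1)) (af_q H).
  apply: addr_ge0; apply: mulr_ge0 => //.
  exact: ltW (af_l_gt0 i k).
apply: (mulfI (lt0r_neq0 (af_l_gt0 i k.+1))); rewrite mulr1 mulr_sumr.
under eq_bigr do rewrite (af_q H).
rewrite big_split /= -!mulr_sumr q1 (simplex_pure (R := R) (c i k)).2 !mulr1.
by rewrite (af_l H).
Qed.

Lemma af_q_var i s t y : (s <= t)%N -> `|q t i y - q s i y| <= (l i t - l i s) / l i t.
Proof.
move=> st; rewrite ler_pdivlMr ?af_l_gt0 //.
suff : `|l i t * q t i y - l i t * q s i y| <= l i t - l i s.
  by rewrite -mulrBr normrM (gtr0_norm (af_l_gt0 i t)) mulrC.
have q01 : 0 <= q s i y <= 1.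
  by have qs := af_simplex s i; rewrite simplex_le1 // andbT; case: qs.
elim: t st => [|t IH]; first by rewrite leqn0 => /eqP ->; rewrite !subrr normr0.
rewrite leq_eqVlt => /predU1P[->|/IH]; first by rewrite !subrr normr0.
have : 0 <= pure (R := R) (c i t) y <= 1 by rewrite /pure ler0n lern1 leq_b1.
by rewrite (af_q H) (af_l H) !ler_norml; case: (x i t) => /=; lra.
Qed.

Lemma reply_gap_ge0 i k : 0 <= reply_gap u c q i k.
Proof.
rewrite subr_ge0 (expected_payoff_mix _ _ _ i); apply: average_le; first exact: af_simplex.
exact: af_best H i k.
Qed.

Definition drift s t : R := \sum_i #|Y i|%:R * ((l i t - l i s) / l i t).

Lemma af_dist s t : (s <= t)%N -> \sum_i \sum_y `|q t i y - q s i y| <= drift s t.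
Proof.
move=> st; apply: ler_sum => i _.
rewrite -sum1_card natr_sum mulr_suml; apply: ler_sum => y _.
by rewrite mul1r af_q_var.
Qed.

(** The best reply at each time is a candidate at the other, so the optimal payoff varies no faster
    than the payoff of a fixed action. *)
Lemma reply_gap_lip i : exists2 C : R, 0 <= C & forall s t, (s <= t)%N ->
  `|reply_gap u c q i t - reply_gap u c q i s| <= C * drift s t.
Proof.
have [C C0 HC] := expected_payoff_lip u i; exists (2 * C) => [|s t st].
  by rewrite mulr_ge0.
have qs := af_simplex s; have qt := af_simplex t.
have d := af_dist st.
have Cd : C * \sum_j \sum_y `|q t j y - q s j y| <= C * drift s t by rewrite ler_wpM2l.
have h1 := le_trans (HC _ _ qt qs) Cd.
have h2 y : `|expected_payoff u i (dfwith (q t) i (pure y))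
    - expected_payoff u i (dfwith (q s) i (pure y))| <= C * drift s t.
  apply: le_trans (HC _ _ _ _) _; try by move=> j; apply: simplex_dfwith => //; exact: simplex_pure.
  apply: le_trans Cd; rewrite ler_wpM2l //; apply: ler_sum => j _.
  apply: ler_sum => z _; have [ij|ij] := eqVneq i j; last by rewrite !dfwithout.
  by move: z; rewrite -ij => z; rewrite !dfwithin subrr normr0.
have b1 := af_best H i t (c i s); have b2 := af_best H i s (c i t).
have h3 := h2 (c i s); have h4 := h2 (c i t).
by move: h1 h3 h4; rewrite /reply_gap !ler_norml; lra.
Qed.

Definition step_size i k : R := (x i k)%:R / l i k.+1.

Lemma step_size_ge0 i k : 0 <= step_size i k.
Proof. by rewrite divr_ge0 ?ler0n // ltW ?af_l_gt0. Qed.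

(** Telescoping, from the inequality between [1 / (l + 1) ^ 2] and [1 / l - 1 / (l + 1)]. *)
Lemma sum_sqr_step_size i t : \sum_(0 <= k < t) step_size i k ^+ 2 <= 1.
Proof.
suff : \sum_(0 <= k < t) step_size i k ^+ 2 <= 1 - (l i t)^-1.
  by move=> h; apply: le_trans h _; rewrite gerBl invr_ge0 ltW ?af_l_gt0.
elim: t => [|t IH]; first by rewrite big_geq // (af_l0 H) invr1 subrr.
rewrite big_nat_recr //=; apply: le_trans (lerD IH (lexx _)) _.
have := af_l_gt0 i t; rewrite /step_size (af_l H); case: (x i t) => /= h; last first.
  by rewrite mul0r expr0n /= !addr0.
rewrite -subr_ge0.
have -> : 1 - (l i t + 1)^-1 - (1 - (l i t)^-1 + (1 / (l i t + 1)) ^+ 2) =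
  1 / (l i t * (l i t + 1) ^+ 2) by field; rewrite !gt_eqF //; lra.
by rewrite divr_ge0 // mulr_ge0 ?sqr_ge0 // ltW.
Qed.

Lemma step_size_tail i s t : (s <= t)%N ->
  (l i t - l i s) / l i t <= \sum_(s <= k < t) step_size i k.
Proof.
move=> st; rewrite (@clock_sub_sum _ (x i) (l i)) // => [|k _]; last exact: af_l H i k.
rewrite mulr_suml; apply: ler_sum_nat => k /andP[sk kt].
by rewrite /step_size ler_wpM2l // lef_pV2 ?posrE ?af_l_gt0 // af_mono.
Qed.

(** If [f k > e] at a late [k], then [f >= e / 2] while the clock grows by the factor [1 + d]. The
    steps over that stretch sum to at least [d / 3], so the convergent series would gain
    [e / 2 * (d / 3)] beyond its tail. *)
Lemma slow_summable_to0 i (f : nat -> R) (C M : R) :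
  0 <= C -> (forall k, 0 <= f k) ->
  (forall s t, (s <= t)%N -> `|f t - f s| <= C * drift s t) ->
  (forall t, \sum_(0 <= k < t) step_size i k * f k <= M) ->
  forall e : R, 0 < e -> \forall k \near \oo, f k <= e.
Proof.
move=> C0 f0 flip sumf e e0.
pose S t := \sum_(0 <= k < t) step_size i k * f k.
pose N0 : R := \sum_j #|Y j|%:R; have N00 : 0 <= N0 by apply: sumr_ge0.
(* While [l i] grows by the fraction [d], every clock grows relatively by at most [4 * d]; this [d]
   makes the resulting change of [f] at most [e / 2]. *)
pose d := Num.min (e / (8 * (C * N0 + 1))) (1 / 2).
have CN : 0 <= C * N0 by rewrite mulr_ge0.
have d0 : 0 < d by rewrite lt_min !divr_gt0 ?mulr_gt0 //; lra.
have d2 : d <= 1 / 2 by rewrite ge_min lexx orbT.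
have dC : C * N0 * (4 * d) <= e / 2.
  have : d * (8 * (C * N0 + 1)) <= e by rewrite -ler_pdivlMr ?ge_min ?lexx // mulr_gt0 //; lra.
  by lra.
have S_sup : has_sup (range S).
  by split; [exists (S 0%N), 0%N|exists M => _ [t _ <-]; exact: sumf].
have ed0 : 0 < e / 2 * (d / 3) by rewrite mulr_gt0 ?divr_gt0.
have [_ [N _ <-] HN] := sup_adherent ed0 S_sup.
have Smono s t : (s <= t)%N -> S t = S s + \sum_(s <= k < t) step_size i k * f k.
  by move=> st; rewrite /S (big_cat_nat (n := s)).
have pos s t : 0 <= \sum_(s <= k < t) step_size i k * f k.
  by apply: sumr_ge0 => k _; rewrite mulr_ge0 ?step_size_ge0.
have d80 : 0 < d / 8 by rewrite divr_gt0.
near=> k; rewrite leNgt; apply/negP => lt.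
have Nk : (N <= k)%N by near: k; exact: nbhs_infty_ge.
have lk : d^-1 <= l i k by near: k; exact: af_oo H i _.
have dl : 1 <= d * l i k by rewrite mulrC -ler_pdivrMr // div1r.
have sync j t : (k <= t)%N -> `|l i t - l j t| <= d / 8 * l i t.
  move=> kt; move: t kt j; near: k.
  apply: (@nearoo_forall (fun t => forall j, `|l i t - l j t| <= d / 8 * l i t)).
  by apply: filter_forall => j; exact (af_sync H i j d80).
have [t [kt tl tmin]] : exists t, [/\ (k <= t)%N, d * l i k <= l i t - l i k &
    forall s, (k <= s < t)%N -> l i s - l i k < d * l i k].
  have [N' _ HN'] := af_oo H i ((1 + d) * l i k).
  have kt : (k <= maxn k N')%N by rewrite leq_maxl.
  have h : d * l i k <= l i (maxn k N') - l i k.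
    by have /= := HN' (maxn k N') (leq_maxr _ _); lra.
  have [t [/andP[k1 k2] k3 k4]] := first_crossing (P := fun t => d * l i k <= l i t - l i k) kt h.
  by exists t; split=> // s /k4; rewrite -ltNge.
have small s : (k <= s < t)%N -> e / 2 <= f s.
  move=> sI; have /andP[ks st] := sI; have lts := tmin s sI.
  have dr : drift k s <= N0 * (4 * d).
    rewrite /drift mulr_suml; apply: ler_sum => j _; rewrite ler_wpM2l //.
    rewrite ler_pdivrMr ?af_l_gt0 //.
    have h1 := sync j s ks; have h2 := sync j k (leqnn k).
    have h3 := af_mono i ks; have h4 := af_mono j ks; have h5 := af_l_gt0 i k.
    have h6 : d / 8 * l i s <= d / 8 * (2 * l i k) by rewrite ler_pM2l //; nra.
    have h7 : l i k / 2 <= l j s.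
      move: h2; rewrite ler_norml => /andP[_ h2]; nra.
    have h8 : d * (l i k / 2) <= d * l j s by rewrite ler_pM2l.
    by move: h1 h2; rewrite !ler_norml; lra.
  have := flip k s ks; rewrite ler_norml => /andP[h1 _].
  have : C * drift k s <= C * (N0 * (4 * d)) by rewrite ler_wpM2l.
  lra.
have h1 : e / 2 * ((l i t - l i k) / l i t) <= \sum_(k <= s < t) step_size i s * f s.
  apply: (@le_trans _ _ (\sum_(k <= s < t) step_size i s * (e / 2))).
    rewrite -mulr_suml mulrC ler_wpM2r ?step_size_tail //; lra.
  by apply: ler_sum_nat => s sI; rewrite ler_wpM2l ?step_size_ge0 ?small.
have h2 : d / 3 <= (l i t - l i k) / l i t.
  have lt0 := af_l_gt0 i t; rewrite ler_pdivlMr //.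
  have lk0 := af_l_gt0 i k.
  have : l i k <= (1 - d / 2) * l i t by nra.
  nra.
have h3 : e / 2 * (d / 3) <= e / 2 * ((l i t - l i k) / l i t) by rewrite ler_pM2l //; lra.
have h4 : S t <= sup (range S) by apply: ub_le_sup; [exact: S_sup.2|exists t].
have h5 := Smono k t kt; have h6 := Smono N k Nk; have h7 := pos N k.
lra.
Unshelve. all: by end_near. Qed.

End Basics.
End Async.

Arguments af_best {R n Y u x l c q y0} _ i k _.

(** * Potential games *)

Section PotentialGame.
Context {R : realType} {n : nat} {Y : 'I_n -> finType}.
Implicit Types (u : payoffs R Y).

(** The game in which everyone is paid [phi]: the results on [expected_payoff] then apply to the
    multilinear extension of [phi]. *)
Definition common_payoff (phi : profile Y -> R) : payoffs R Y := fun z => phi z.2.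

Definition update (z : profile Y) (i : 'I_n) (y : Y i) : profile Y :=
  [ffun k => dfwith (fun j => z j) i y k].

Lemma update_in z i (y : Y i) : update z y i = y.
Proof. by rewrite ffunE dfwithin. Qed.

Lemma update_out z i (y : Y i) k : k != i -> update z y k = z k.
Proof. by move=> ki; rewrite ffunE dfwithout // eq_sym. Qed.

Lemma update_update z i (y y' : Y i) : update (update z y) y' = update z y'.
Proof.
apply/ffunP => k; have [ki|ki] := eqVneq i k.
  by move: y y'; rewrite ki => y y'; rewrite !update_in.
by rewrite !update_out // eq_sym.
Qed.

Lemma update_self z i : update z (z i) = z.
Proof.
by apply/ffunP => k; rewrite ffunE; case: dfwithP.
Qed.

Lemma expected_payoff_pure u i (p : mixed R Y) (y : Y i) :
  expected_payoff u i (dfwith p i (pure y)) =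
  \sum_(z : profile Y | z i == y) u (i, z) * \prod_(k < n | k != i) p k (z k).
Proof.
rewrite /expected_payoff [RHS]big_mkcond; apply: eq_bigr => z _.
rewrite (bigD1 i) //= dfwithin /pure; case: ifP => zy; last by rewrite mul0r mulr0.
rewrite mul1r; congr (_ * _); apply: eq_bigr => k ki.
by rewrite dfwithout // eq_sym.
Qed.

Lemma potential_pure_diff u phi i (p : mixed R Y) (y y' : Y i) :
  (forall i (z z' : profile Y), (forall j, j != i -> z j = z' j) ->
    u (i, z) - u (i, z') = phi z - phi z') ->
  expected_payoff u i (dfwith p i (pure y)) - expected_payoff u i (dfwith p i (pure y')) =
  expected_payoff (common_payoff phi) i (dfwith p i (pure y)) -
  expected_payoff (common_payoff phi) i (dfwith p i (pure y')).
Proof.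
move=> pot; rewrite !expected_payoff_pure.
have reindexed (w : payoffs R Y) :
    \sum_(z : profile Y | z i == y') w (i, z) * \prod_(k < n | k != i) p k (z k) =
    \sum_(z : profile Y | z i == y) w (i, update z y') * \prod_(k < n | k != i) p k (z k).
  rewrite (reindex_onto (fun z => update z y') (fun z => update z y)) /=.
    apply: eq_big => [z|z /andP[_ /eqP zE]].
      rewrite update_in eqxx update_update /=; apply/eqP/eqP => [<-|<-].
        by rewrite update_in.
      by rewrite update_self.
    congr (_ * _); apply: eq_bigr => k ki; by rewrite update_out.
  by move=> z /eqP <-; rewrite update_update update_self.
rewrite !reindexed -!sumrB; apply: eq_bigr => z _; rewrite -!mulrBl; congr (_ * _).
by apply: pot => j ji; rewrite update_out.
Qed.

(** The difference of the two expected payoffs is the same for all pure actions of [i], hence for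
    all their mixtures. *)
Lemma potential_diff u phi i (p : mixed R Y) (x x' : Y i -> R) :
  (forall i (z z' : profile Y), (forall j, j != i -> z j = z' j) ->
    u (i, z) - u (i, z') = phi z - phi z') ->
  simplex x -> simplex x' ->
  expected_payoff u i (dfwith p i x) - expected_payoff u i (dfwith p i x') =
  expected_payoff (common_payoff phi) i (dfwith p i x) -
  expected_payoff (common_payoff phi) i (dfwith p i x').
Proof.
move=> pot [x0 x1] [x'0 x'1].
have [y0 _] : exists y0 : Y i, True.
  apply: contrapT => N; have : 0 = 1 :> R.
    by rewrite -x1 big1 // => y; exfalso; apply: N; exists y.
  by move/eqP; rewrite eq_sym oner_eq0.
pose D y := expected_payoff u i (dfwith p i (pure y))
  - expected_payoff (common_payoff phi) i (dfwith p i (pure y)).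
have DE y : D y = D y0.
  by have := potential_pure_diff p y y0 pot; rewrite /D; lra.
have mix (w : Y i -> R) : \sum_y w y = 1 ->
    expected_payoff u i (dfwith p i w) -
    expected_payoff (common_payoff phi) i (dfwith p i w) = D y0.
  move=> w1; rewrite !(expected_payoff_expand _ _ _ w) -sumrB -[RHS]mul1r -w1 mulr_suml.
  by apply: eq_bigr => y _; rewrite -mulrBr -(DE y).
by have := mix x x1; have := mix x' x'1; lra.
Qed.

Section Convergence.
Context {u : payoffs R Y} {x : 'I_n -> nat -> bool} {l : 'I_n -> nat -> R}
  {c : forall i, nat -> Y i} {q : nat -> mixed R Y} {y0 : forall i, Y i}.
Arguments q _ _ _ : clear implicits.
Hypothesis H : async_fp u x l c q y0.
Context (phi : profile Y -> R).
Hypothesis pot : forall i (z z' : profile Y), (forall j, j != i -> z j = z' j) ->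
  u (i, z) - u (i, z') = phi z - phi z'.

Let Phi i p := expected_payoff (common_payoff phi) i p.

Lemma reply_gap_potential i k :
  reply_gap u c q i k = Phi i (dfwith (q k) i (pure (c i k))) - Phi i (q k).
Proof.
rewrite /reply_gap -[in X in _ - X](dfwith_self (q k) i).
rewrite (potential_diff (q k) pot) ?dfwith_self //; first exact: simplex_pure.
exact: af_simplex H k i.
Qed.

Let gam i k := @step_size R n x l i k.

(* All players move at once; changing the coordinates one at a time makes the
   multilinear potential exact up to second order in the step sizes. *)
Lemma potential_step i0 : exists2 C : R, 0 <= C & forall k,
  \sum_i gam i k * reply_gap u c q i k - C * \sum_i gam i k ^+ 2 <=
  Phi i0 (q k.+1) - Phi i0 (q k).
Proof.
have [C C0 HC] := expected_payoff_lip (common_payoff phi) i0.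
pose N0 : R := \sum_j #|Y j|%:R; have N00 : 0 <= N0 by apply: sumr_ge0.
exists (2 * C * N0 * n%:R) => [|k]; first by rewrite !mulr_ge0.
have g0 i : 0 <= gam i k by exact: step_size_ge0 H i k.
have g1 i : gam i k <= 1.
  rewrite /gam /step_size ler_pdivrMr ?(af_l_gt0 H) // mul1r.
  by apply: le_trans (af_l_ge1 H i k.+1); rewrite lern1 leq_b1.
have qk := af_simplex H k; have qk1 := af_simplex H k.+1.
have qE i y : q k.+1 i y = (1 - gam i k) * q k i y + gam i k * pure (c i k) y.
  have l1 := af_l_gt0 H i k.+1; apply: (mulfI (lt0r_neq0 l1)).
  rewrite (af_q H) /gam /step_size; have E := af_l H i k.
  have -> : l i k = l i k.+1 - (x i k)%:R by rewrite E; ring.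
  by field; rewrite gt_eqF.
(* The hybrid profile in which players below [m] have already moved. Player [i] then replies to
   [P i], not to [q k]; both values in her gap shift by at most [C * (N0 * \sum_i gam i k)], hence
   the factor 2. *)
pose P (m : nat) : mixed R Y := fun i => if (i < m)%N then q k.+1 i else q k i.
have Ps m i : simplex (P m i) by rewrite /P; case: ifP.
have sumg : \sum_j \sum_(y : Y j) gam j k = \sum_j #|Y j|%:R * gam j k.
  by apply: eq_bigr => j _; rewrite sumr_const mulr_natl.
have distP m : \sum_j \sum_y `|P m j y - q k j y| <= N0 * \sum_i gam i k.
  rewrite mulr_suml; apply: ler_sum => j _.
  apply: (@le_trans _ _ (\sum_(y : Y j) gam j k)).
    apply: ler_sum => y _; rewrite /P; case: ifP => _; last by rewrite subrr normr0.
    have -> : q k.+1 j y - q k j y = gam j k * (pure (c j k) y - q k j y) by rewrite qE; ring.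
    rewrite normrM (ger0_norm (g0 j)) ler_piMr //.
    have := simplex_le1 y (qk j); have [/(_ y) h _] := qk j.
    by rewrite /pure ler_norml; case: (y == _) => /=; lra.
  rewrite sumr_const -[leLHS]mulr_natl ler_wpM2l //.
  by rewrite (bigD1 j) //= lerDl sumr_ge0.
have telesc : Phi i0 (q k.+1) - Phi i0 (q k) =
    \sum_(i < n) (Phi i0 (P i.+1) - Phi i0 (P i)).
  have -> : q k.+1 = P n by apply: functional_extensionality_dep => i; rewrite /P ltn_ord.
  have -> : q k = P 0%N by [].
  by rewrite -(telescope_sumr (fun m => Phi i0 (P m))) // big_mkord.
have sq : (\sum_i gam i k) ^+ 2 <= n%:R * \sum_i gam i k ^+ 2.
  rewrite expr2 big_distrl /=.
  apply: (@le_trans _ _ (\sum_i \sum_j (gam i k ^+ 2 + gam j k ^+ 2) / 2)).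
    apply: ler_sum => i _; rewrite mulr_sumr; apply: ler_sum => j _.
    by have := sqr_ge0 (gam i k - gam j k); rewrite sqrrB; lra.
  pose S := \sum_i gam i k ^+ 2.
  rewrite (eq_bigr (fun i => (n%:R * gam i k ^+ 2 + S) / 2)) => [|i _].
    rewrite -mulr_suml big_split /= -mulr_sumr sumr_const card_ord -[S *+ n]mulr_natl -/S.
    by lra.
  by rewrite -mulr_suml big_split /= sumr_const card_ord mulr_natl.
rewrite telesc.
apply: (@le_trans _ _ (\sum_i gam i k * (reply_gap u c q i k - 2 * (C * (N0 * \sum_i gam i k))))).
  rewrite [leRHS](eq_bigr (fun i => gam i k * reply_gap u c q i k -
    gam i k * (2 * (C * (N0 * \sum_i gam i k))))); last by move=> i _; ring.
  rewrite sumrB -mulr_suml lerD2l lerN2.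
  have : 2 * C * N0 * (\sum_i gam i k) ^+ 2 <= 2 * C * N0 * (n%:R * \sum_i gam i k ^+ 2).
    by rewrite ler_wpM2l // !mulr_ge0.
  by rewrite expr2; lra.
apply: ler_sum => i _.
have PE : P i.+1 = dfwith (P i) i (q k.+1 i).
  apply: functional_extensionality_dep => j; rewrite /P; case: dfwithP => [|j' ij].
    by rewrite ltnSn.
  rewrite ltnS leq_eqVlt; have -> // : (j' == i :> nat) = false.
  by apply/negbTE; apply: contra ij => /eqP/val_inj ->.
have Pi : P i i = q k i by rewrite /P ltnn.
have linear : Phi i0 (P i.+1) - Phi i0 (P i) =
    gam i k * (Phi i0 (dfwith (P i) i (pure (c i k))) - Phi i0 (P i)).
  rewrite PE /Phi (expected_payoff_expand _ _ _ (q k.+1 i)).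
  under eq_bigr do rewrite qE mulrDl -!mulrA.
  rewrite big_split /= -!mulr_sumr -!expected_payoff_expand -Pi dfwith_self.
  by rewrite /gam /step_size; ring.
have gapE : reply_gap u c q i k =
    Phi i0 (dfwith (q k) i (pure (c i k))) - Phi i0 (q k) by exact: reply_gap_potential.
rewrite linear ler_wpM2l // gapE.
have b1 := le_trans (HC _ _ (Ps i) qk) (ler_wpM2l C0 (distP i)).
have b2 : `|Phi i0 (dfwith (P i) i (pure (c i k))) - Phi i0 (dfwith (q k) i (pure (c i k)))| <=
    C * (N0 * \sum_i gam i k).
  apply: le_trans (HC _ _ _ _) (ler_wpM2l C0 (le_trans _ (distP i))).
  - by apply: simplex_dfwith => //; exact: simplex_pure.
  - by apply: simplex_dfwith => //; exact: simplex_pure.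
  - apply: ler_sum => j _; apply: ler_sum => z _.
    have [ij|ij] := eqVneq i j; last by rewrite !dfwithout.
    by move: z; rewrite -ij => z; rewrite !dfwithin subrr normr0.
by move: b1 b2; rewrite /Phi !ler_norml; lra.
Qed.

(** Summing [potential_step] bounds the weighted series of all gaps, because the potential is
    bounded and the squared steps are summable; the gaps are nonnegative, so the series of player
    [i] alone is bounded. *)
Lemma potential_gap_to0 i (e : R) : 0 < e ->
  \forall k \near \oo, reply_gap u c q i k <= e.
Proof.
have [C C0 HC] := potential_step i.
have [L L0 HL] := reply_gap_lip H i.
have [B B0 HB] := expected_payoff_lip (common_payoff phi) i.
pose M := B * \sum_j \sum_(y : Y j) 1 + C * n%:R.
apply: (slow_summable_to0 (M := M) H L0 _ HL); first exact: reply_gap_ge0 H i.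
move=> t; apply: (@le_trans _ _ (\sum_(0 <= k < t) \sum_j gam j k * reply_gap u c q j k)).
  apply: ler_sum => k _; rewrite (bigD1 i) //= -[leLHS]addr0; apply: lerD => //.
  apply: sumr_ge0 => j _; by rewrite mulr_ge0 ?(reply_gap_ge0 H) // (step_size_ge0 H).
have tele : \sum_(0 <= k < t) (\sum_j gam j k * reply_gap u c q j k -
    C * \sum_j gam j k ^+ 2) <= Phi i (q t) - Phi i (q 0%N).
  by rewrite -(telescope_sumr (fun k => Phi i (q k))) //; apply: ler_sum => k _; exact: HC.
have sq : \sum_(0 <= k < t) \sum_j gam j k ^+ 2 <= n%:R.
  rewrite exchange_big /= -[X in _ <= X%:R]card_ord -sum1_card natr_sum.
  by apply: ler_sum => j _; exact: (sum_sqr_step_size H).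
have bd : Phi i (q t) - Phi i (q 0%N) <= B * \sum_j \sum_(y : Y j) 1.
  apply: le_trans (ler_norm _) _; apply: le_trans (HB _ _ _ _) _; try exact: (af_simplex H).
  rewrite ler_wpM2l //; apply: ler_sum => j _; apply: ler_sum => y _.
  have h1 := simplex_le1 y (af_simplex H t j); have [/(_ y) h2 _] := af_simplex H t j.
  have h3 := simplex_le1 y (af_simplex H 0 j); have [/(_ y) h4 _] := af_simplex H 0 j.
  by rewrite ler_norml; lra.
move: tele; rewrite sumrB -mulr_sumr => tele.
have : C * \sum_(0 <= k < t) \sum_j gam j k ^+ 2 <= C * n%:R by rewrite ler_wpM2l.
rewrite /M; lra.
Qed.

End Convergence.
End PotentialGame.

(** * Zero-sum and 2 x m games *)

Section TwoPlayers.
Context {R : realType} {n : nat} {Y : 'I_n -> finType} (i j : 'I_n).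
Hypothesis ij : i != j.
Hypothesis cover : forall k, k = i \/ k = j.

(** The zero profile is a placeholder: [i] and [j] are the only players, and both of its coordinates
    are overwritten. *)
Definition bimatrix (u : payoffs R Y) (h : 'I_n) (y : Y i) (z : Y j) : R :=
  expected_payoff u h (dfwith (dfwith (fun _ _ => 0 : R) i (pure y)) j (pure z)).

Lemma two_dfwith (p p' : mixed R Y) (x : Y i -> R) (x' : Y j -> R) :
  dfwith (dfwith p i x) j x' = dfwith (dfwith p' i x) j x'.
Proof.
apply: functional_extensionality_dep => k; have [->|->] := cover k; last by rewrite !dfwithin.
have ji : j != i by rewrite eq_sym.
by rewrite dfwithout // dfwithin [RHS]dfwithout // dfwithin.
Qed.

Lemma two_dfwithC (p p' : mixed R Y) (x : Y i -> R) (x' : Y j -> R) :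
  dfwith (dfwith p j x') i x = dfwith (dfwith p' i x) j x'.
Proof.
apply: functional_extensionality_dep => k; have [->|->] := cover k.
  have ji : j != i by rewrite eq_sym.
  by rewrite dfwithin dfwithout // dfwithin.
by rewrite dfwithout // !dfwithin.
Qed.

Lemma two_dev_i u h (p : mixed R Y) (y : Y i) :
  expected_payoff u h (dfwith p i (pure y)) = \sum_z p j z * bimatrix u h y z.
Proof.
rewrite (expected_payoff_mix _ _ _ j); apply: eq_bigr => z _.
by rewrite dfwithout // /bimatrix (two_dfwith _ p).
Qed.

Lemma two_dev_j u h (p : mixed R Y) (z : Y j) :
  expected_payoff u h (dfwith p j (pure z)) = \sum_y p i y * bimatrix u h y z.
Proof.
rewrite (expected_payoff_mix _ _ _ i); apply: eq_bigr => y _.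
by rewrite dfwithout 1?eq_sym // /bimatrix (two_dfwithC _ (fun _ _ => 0)).
Qed.

(** Identifies an entry with a coordinate of the payoff vector, so that genericity applies to it. *)
Lemma bimatrix_value u h (z0 : forall k, Y k) y z : exists2 w : profile Y,
  w i = y /\ w j = z & bimatrix u h y z = u (h, w).
Proof.
pose w : profile Y := update (update [ffun k => z0 k] y) z.
have wi : w i = y by rewrite /w update_out // update_in.
have wj : w j = z by rewrite /w update_in.
exists w => //; rewrite /bimatrix /expected_payoff (bigD1 w) //=.
rewrite [X in _ * X]big1 => [|k _]; last first.
  have [->|->] := cover k; last by rewrite dfwithin /pure wj eqxx.
  by rewrite dfwithout 1?eq_sym // dfwithin /pure wi eqxx.
rewrite mulr1 big1 ?addr0 // => v vw.
have [vi|vi] := eqVneq (v i) y; last first.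
  rewrite (bigD1 i) //= dfwithout 1?eq_sym // dfwithin /pure (negbTE vi).
  by rewrite mul0r mulr0.
have [vj|vj] := eqVneq (v j) z; last first.
  by rewrite (bigD1 j) //= dfwithin /pure (negbTE vj) mul0r mulr0.
case/eqP: vw; apply/ffunP => k; have [->|->] := cover k.
  by rewrite vi wi.
by rewrite vj wj.
Qed.

Lemma zero_sum_payoff (u : payoffs R Y) : (forall y : profile Y, \sum_(k < n) u (k, y) = 0) ->
  forall p, expected_payoff u j p = - expected_payoff u i p.
Proof.
move=> zs p; have : \sum_k expected_payoff u k p = 0.
  rewrite /expected_payoff exchange_big big1 // => y _.
  by rewrite -mulr_suml zs mul0r.
rewrite (bigD1 i) //= (bigD1 j) 1?eq_sym //= big1 => [|k /andP[ki kj]].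
  by rewrite addr0 => /eqP; rewrite addrC addr_eq0 => /eqP.
by case: (cover k) => E; move: ki kj; rewrite E eqxx.
Qed.

End TwoPlayers.

Section ZeroSum.
Context {R : realType} {n : nat} {Y : 'I_n -> finType} (i j : 'I_n).
Hypothesis ij : i != j.
Hypothesis cover : forall k, k = i \/ k = j.
Context {u : payoffs R Y} {x : 'I_n -> nat -> bool} {l : 'I_n -> nat -> R}
  {c : forall i, nat -> Y i} {q : nat -> mixed R Y} {y0 : forall i, Y i}.
Arguments q _ _ _ : clear implicits.
Hypothesis H : async_fp u x l c q y0.
Hypothesis zs : forall y : profile Y, \sum_(k < n) u (k, y) = 0.

(** The two values cancel, so the sum of the gaps is, up to the difference of the clocks, Robinson's
    gap divided by [l i]. The desynchronization up to [T] is only bounded by a constant plus a small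
    multiple of [l i T]; this suffices because the constant [C] of [robinson] is fixed before it. *)
Lemma zero_sum_gap_to0 (e : R) : 0 < e ->
  \forall k \near \oo, reply_gap u c q i k + reply_gap u c q j k <= e.
Proof.
move=> e0; pose A (y : Y i) (z : Y j) := bimatrix u i y z.
pose K := \sum_y \sum_z `|A y z|.
have AK y z : `|A y z| <= K.
  rewrite /K (bigD1 y) //= (bigD1 z) //= -addrA lerDl.
  by rewrite addr_ge0 ?sumr_ge0 // => y' _; rewrite sumr_ge0.
have K0 : 0 <= K by apply: le_trans (AK (y0 i) (y0 j)).
pose V k (y : Y i) := l j k * \sum_z q k j z * A y z.
pose U k (z : Y j) := l i k * \sum_y q k i y * A y z.
have VE k y : V k y = l j k * expected_payoff u i (dfwith (q k) i (pure y)).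
  by rewrite (two_dev_i ij cover).
have UE k z : U k z = - (l i k * expected_payoff u j (dfwith (q k) j (pure z))).
  by rewrite (zero_sum_payoff ij cover zs) (two_dev_j ij cover) mulrN opprK.
have pick (T : finType) (w : T) (g : T -> R) : \sum_z (pure w z : R) * g z = g w.
  rewrite (bigD1 w) //= big1 ?addr0 /pure ?eqxx ?mul1r // => z zw.
  by rewrite (negbTE zw) mul0r.
have path T : fp_path A [set: Y i]%SET [set: Y j]%SET 0 T (c i) (c j) (x i) (x j) (l i) (l j) V U.
  split=> // [t _|t _|t y _|t z _|t _|t _].
  - exact: af_l H i t.
  - exact: af_l H j t.
  - have -> : A y (c j t) = \sum_z pure (c j t) z * A y z by rewrite pick.
    rewrite /V !mulr_sumr -big_split.
    by apply: eq_bigr => z _ /=; rewrite !mulrA -mulrDl (af_q H).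
  - have -> : A (c i t) z = \sum_y pure (c i t) y * A y z.
      by rewrite (pick _ _ (fun y => A y z)).
    rewrite /U !mulr_sumr -big_split.
    by apply: eq_bigr => y _ /=; rewrite !mulrA -mulrDl (af_q H).
  - split; [by rewrite inE|move=> y _]; rewrite !VE ler_pM2l ?(af_l_gt0 H) //.
    exact: (af_best H i t y).
  - split; [by rewrite inE|move=> z _]; rewrite !UE lerN2 ler_pM2l ?(af_l_gt0 H) //.
    exact: (af_best H j t z).
have [C HC] := robinson AK [set: Y i]%SET [set: Y j]%SET (divr_gt0 e0 (ltr0n _ 4)).
pose h := Num.min (e / (4 * (K + 1))) (e / (16 * (`|C| + 1))).
have C1 : 0 < `|C| + 1 by rewrite ltr_wpDl.
have K1 : 0 < K + 1 by rewrite ltr_wpDl.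
have h0 : 0 < h by rewrite lt_min !divr_gt0 ?mulr_gt0.
have hK : h * (4 * (K + 1)) <= e by rewrite -ler_pdivlMr ?mulr_gt0 // ge_min lexx.
have hC : h * (16 * (`|C| + 1)) <= e.
  by rewrite -ler_pdivlMr ?mulr_gt0 // ge_min lexx orbT.
have [N _ HN] := af_sync H i j h0.
pose B := l i N + l j N.
have sync t : `|l i t - l j t| <= B + h * l i t.
  have l1 := af_l_gt0 H i t; have l2 := af_l_gt0 H j t.
  have hl : 0 < h * l i t by rewrite mulr_gt0.
  have B0 : 0 < B by rewrite addr_gt0 ?(af_l_gt0 H).
  have [Nt|tN] := leqP N t; first by have /= := HN t Nt; lra.
  have m1 := af_mono H i (ltnW tN); have m2 := af_mono H j (ltnW tN).
  by rewrite ler_norml /B; lra.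
pose G0 := V 0%N (c i 0%N) - U 0%N (c j 0%N).
near=> T; have lT := af_l_gt0 H i T; have lT' := af_l_gt0 H j T.
have D_ok t t' : (0 <= t <= T)%N -> (0 <= t' <= T)%N ->
    `|(l i t - l i t') - (l j t - l j t')| <= 2 * (B + h * l i T).
  move=> /andP[_ tT] /andP[_ t'T].
  have s1 := sync t; have s2 := sync t'.
  have m1 : h * l i t <= h * l i T by rewrite ler_pM2l // (af_mono H).
  have m2 : h * l i t' <= h * l i T by rewrite ler_pM2l // (af_mono H).
  by move: s1 s2; rewrite !ler_norml; lra.
have := HC _ _ _ _ _ _ _ _ _ _ _ (path T) D_ok; rewrite -/G0 => main.
have big : (8 / e) * (`|G0| + `|C| * (2 * B + 1)) <= l i T by near: T; exact: af_oo H i _.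
have {}big : `|G0| + `|C| * (2 * B + 1) <= e / 8 * l i T.
  have -> : `|G0| + `|C| * (2 * B + 1) =
      e / 8 * ((8 / e) * (`|G0| + `|C| * (2 * B + 1))) by field; rewrite gt_eqF.
  by rewrite ler_pM2l // divr_gt0.
have syncT : `|l i T - l j T| <= h * l i T by near: T; exact (af_sync H i j h0).
have B0 : 0 <= B by rewrite addr_ge0 // ltW ?(af_l_gt0 H).
have hlT : 0 <= h * l i T by rewrite mulr_ge0 // ltW.
have Cle : C * (2 * (B + h * l i T) + 1) <= `|C| * (2 * (B + h * l i T) + 1).
  by rewrite ler_wpM2r ?ler_norm //; lra.
have hC' : `|C| * (h * l i T) <= e / 16 * l i T.
  rewrite mulrA ler_pM2r //; have := h0; lra.
have mainle : V T (c i T) - U T (c j T) <= e / 2 * l i T.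
  have := ler_norm G0; rewrite (af_l0 H) in main; lra.
have devK : `|expected_payoff u i (dfwith (q T) i (pure (c i T)))| <= K.
  rewrite (two_dev_i ij cover); apply: le_trans (ler_norm_sum _ _ _) _.
  rewrite -[leRHS]mul1r -(af_simplex H T j).2 mulr_suml; apply: ler_sum => z _.
  have [q0 _] := af_simplex H T j; rewrite normrM (ger0_norm (q0 z)) ler_wpM2l //.
rewrite VE UE opprK in mainle.
set di := expected_payoff u i (dfwith _ i _) in mainle devK.
set dj := expected_payoff u j (dfwith _ j _) in mainle.
have -> : reply_gap u c q i T + reply_gap u c q j T = di + dj.
  by rewrite /reply_gap (zero_sum_payoff ij cover zs (q T)) -/di -/dj; ring.
rewrite -(ler_pM2r lT).
have : `|(l i T - l j T) * di| <= (h * l i T) * K.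
  by rewrite normrM; apply: ler_pM.
have : (h * l i T) * K <= e / 4 * l i T.
  by rewrite mulrAC ler_pM2r //; have := h0; lra.
rewrite ler_norml; lra.
Unshelve. all: by end_near. Qed.

End ZeroSum.

Section TwoByM.
Context {R : realType} {n : nat} {Y : 'I_n -> finType} (i j : 'I_n) (y1 y2 : Y i).
Hypothesis ij : i != j.
Hypothesis cover : forall k, k = i \/ k = j.
Hypothesis two : forall y, y = y1 \/ y = y2.
Hypothesis y12 : y1 != y2.
Context {u : payoffs R Y} {x : 'I_n -> nat -> bool} {l : 'I_n -> nat -> R}
  {c : forall i, nat -> Y i} {q : nat -> mixed R Y} {y0 : forall i, Y i}.
Arguments q _ _ _ : clear implicits.
Hypothesis H : async_fp u x l c q y0.
Hypothesis generic : forall a b : 'I_n * profile Y, u a = u b -> a = b.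

Let bu (z : Y j) : R := bimatrix u j y2 z.
Let bv (z : Y j) : R := bimatrix u j y1 z - bimatrix u j y2 z.
Let alpha (z : Y j) : R := bimatrix u i y1 z - bimatrix u i y2 z.
Let p k : R := q k i y1.
Let xi k : R := l j k * \sum_z q k j z * alpha z.

Let sum2 (g : Y i -> R) : \sum_y g y = g y1 + g y2.
Proof.
rewrite (bigD1 y1) //= (bigD1 y2) 1?eq_sym //= big1 ?addr0 // => y /andP[h1 h2].
by case: (two y) => E; move: h1 h2; rewrite E eqxx.
Qed.

Let q2 k : q k i y2 = 1 - p k.
Proof. by have [_] := af_simplex H k i; rewrite sum2 /p => <-; ring. Qed.

Let dev_j k z : expected_payoff u j (dfwith (q k) j (pure z)) = bu z + bv z * p k.
Proof. by rewrite (two_dev_j ij cover) sum2 q2 /bu /bv /p; ring. Qed.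

Let payoff_j k : expected_payoff u j (q k) = \sum_z q k j z * (bu z + bv z * p k).
Proof.
by rewrite (expected_payoff_mix _ _ _ j); apply: eq_bigr => z _; rewrite dev_j.
Qed.

Let dev_i k y : expected_payoff u i (dfwith (q k) i (pure y)) =
  \sum_z q k j z * bimatrix u i y z.
Proof. exact: (two_dev_i ij cover). Qed.

Let advantage k : expected_payoff u i (dfwith (q k) i (pure y1)) -
  expected_payoff u i (dfwith (q k) i (pure y2)) = xi k / l j k.
Proof.
rewrite !dev_i -sumrB /xi mulrAC divff ?gt_eqF ?(af_l_gt0 H) // mul1r.
by apply: eq_bigr => z _; rewrite -mulrBr.
Qed.

Let pick (T : finType) (w : T) (g : T -> R) : \sum_z (pure w z : R) * g z = g w.
Proof.
rewrite (bigD1 w) //= big1 ?addr0 /pure ?eqxx ?mul1r // => z zw.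
by rewrite (negbTE zw) mul0r.
Qed.

Let tbm_play : play bu bv alpha (x i) (x j) (fun k => c i k == y1) (c j)
  (l i) (l j) p xi (y0 i == y1).
Proof.
split.
- exact: af_l H i.
- exact: af_l H j.
- move=> k; rewrite /p (af_q H) /pure eq_sym.
  by case: (x i k); rewrite ?mul1r ?mul0r.
- move=> k; have -> : alpha (c j k) = \sum_z (pure (c j k) z : R) * alpha z by rewrite pick.
  rewrite /xi !mulr_sumr -big_split.
  by apply: eq_bigr => z _ /=; rewrite !mulrA -mulrDl (af_q H).
- exact: af_l0 H i.
- by rewrite /p (af_q0 H) /pure eq_sym.
- move=> k; have adv := advantage k; have lj := af_l_gt0 H j k.
  have sg (r : R) : (0 <= xi k / l j k) = (0 <= xi k) by rewrite pmulr_lge0 ?invr_gt0.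
  have sg' : (xi k / l j k <= 0) = (xi k <= 0) by rewrite pmulr_lle0 ?invr_gt0.
  case: eqP => ck.
    rewrite -(sg 0) -adv subr_ge0 -ck; exact: (af_best H i k y2).
  have ck2 : c i k = y2 by case: (two (c i k)).
  rewrite -sg' -adv subr_le0 -ck2; exact: (af_best H i k y1).
- move=> k; split.
    have qs := af_simplex H k i; rewrite /p simplex_le1 // andbT; by case: qs.
  by move=> z; rewrite -!dev_j; exact: (af_best H j k z).
- exact: af_oo H i.
- exact: af_sync H i j.
Qed.

Let tbm_settles : settles (l i) p xi.
Proof.
(* Distinct payoffs enter twice: two replies of player 2 already differ in their value at [p = 0],
   and no reply makes player 1 indifferent. *)
apply: play_settles tbm_play => [z z' buE _|z].
  have [w [wi wj] wE] := bimatrix_value ij cover u j y0 y2 z.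
  have [w' [w'i w'j] w'E] := bimatrix_value ij cover u j y0 y2 z'.
  have := buE; rewrite /bu wE w'E => /generic [E].
  by rewrite -wj -w'j E.
have [w [wi wj] wE] := bimatrix_value ij cover u i y0 y1 z.
have [w' [w'i w'j] w'E] := bimatrix_value ij cover u i y0 y2 z.
rewrite /alpha wE w'E subr_eq0; apply/eqP => /generic [E].
by move: y12; rewrite -wi -w'i E eqxx.
Qed.

(** Her gain from either action is one of the two products controlled by [settles], divided by
    player 2's clock, which is comparable to hers. *)
Lemma tbm_gap_i (e : R) : 0 < e -> \forall k \near \oo, reply_gap u c q i k <= e.
Proof.
move=> e0; have [_ Hx] := tbm_settles.
have e20 : 0 < e / 2 by rewrite divr_gt0.
have half : (0 : R) < 1 / 2 by rewrite divr_gt0.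
near=> k.
have [h1 h2] : xi k * (1 - p k) <= e / 2 * l i k /\ - xi k * p k <= e / 2 * l i k.
  by near: k; exact: Hx.
have sync : `|l j k - l i k| <= 1 / 2 * l j k by near: k; exact (af_sync H j i half).
have lj := af_l_gt0 H j k; have li := af_l_gt0 H i k.
have adv := advantage k.
have h3 : e / 2 * l i k <= e * l j k.
  have : e / 2 * l i k <= e / 2 * (2 * l j k).
    by rewrite ler_pM2l //; move: sync; rewrite ler_norml; lra.
  lra.
have payE : expected_payoff u i (q k) =
    p k * expected_payoff u i (dfwith (q k) i (pure y1)) +
    (1 - p k) * expected_payoff u i (dfwith (q k) i (pure y2)).
  by rewrite [LHS](expected_payoff_mix _ _ _ i) sum2 q2.
rewrite /reply_gap payE -(ler_pM2r lj).
have xiE : xi k = (expected_payoff u i (dfwith (q k) i (pure y1)) -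
  expected_payoff u i (dfwith (q k) i (pure y2))) * l j k by rewrite adv divfK // gt_eqF.
rewrite xiE in h1 h2.
by have [->|->] := two (c i k); lra.
Unshelve. all: by end_near. Qed.

(** Once [p] is close to its limit [p0], each new reply loses at most [e / 4] against [p0]. The
    cumulative loss [Del] then grows at that rate, and the initial part is averaged out. *)
Lemma tbm_gap_j (e : R) : 0 < e -> \forall k \near \oo, reply_gap u c q j k <= e.
Proof.
move=> e0; have [[p0 Hp] _] := tbm_settles.
pose b (z : Y j) := bu z + bv z * p0.
have [z0 z0max] : exists z0, forall z, b z <= b z0.
  have [z _ zmax] := @arg_maxP _ _ _ (y0 j) xpredT b isT.
  by exists z => z'; apply: zmax.
pose dl z := b z0 - b z.
have dl0 z : 0 <= dl z by rewrite subr_ge0.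
pose K := \sum_z `|bv z|.
have bK z : `|bv z| <= K by rewrite /K (bigD1 z) //= lerDl sumr_ge0.
have K0 : 0 <= K by apply: le_trans (bK z0).
pose d := e / (8 * (K + 1)).
have K1 : 0 < K + 1 by lra.
have d0 : 0 < d by rewrite divr_gt0 // mulr_gt0.
have dK : K * d <= e / 8.
  have : (K + 1) * d = e / 8 by rewrite /d; field; rewrite gt_eqF.
  lra.
have var k z : `|p k - p0| <= d -> `|bu z + bv z * p k - b z| <= e / 8.
  move=> pk; have -> : bu z + bv z * p k - b z = bv z * (p k - p0) by rewrite /b; ring.
  by apply: le_trans dK; rewrite normrM ler_pM.
have cl k : `|p k - p0| <= d -> dl (c j k) <= e / 4.
  move=> pk; have := var k (c j k) pk; have := var k z0 pk.
  have := af_best H j k z0; rewrite !dev_j /dl !ler_norml; lra.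
pose Del k := l j k * \sum_z q k j z * dl z.
have DelS k : Del k.+1 = Del k + (x j k)%:R * dl (c j k).
  have -> : dl (c j k) = \sum_z (pure (c j k) z : R) * dl z by rewrite pick.
  rewrite /Del !mulr_sumr -big_split.
  by apply: eq_bigr => z _ /=; rewrite !mulrA -mulrDl (af_q H).
have [N _ HN] := Hp d d0.
have Dle k : (N <= k)%N -> Del k <= Del N + e / 4 * (l j k - l j N).
  elim: k => [|k IH]; first by rewrite leqn0 => /eqP ->; rewrite subrr mulr0 addr0.
  rewrite leq_eqVlt => /predU1P[<-|Nk]; first by rewrite subrr mulr0 addr0.
  rewrite DelS (af_l H); have := IH Nk; have := cl k (HN k Nk).
  by case: (x j k) => /=; lra.
near=> k.
have Nk : (N <= k)%N by near: k; exact: nbhs_infty_ge.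
have lj := af_l_gt0 H j k.
have big : Del N * (4 / e) <= l j k by near: k; exact: af_oo H j _.
have Dk : \sum_z q k j z * dl z <= e / 2.
  rewrite -(ler_pM2l lj) -/(Del k).
  have h1 := Dle k Nk.
  have h2 : Del N <= e / 4 * l j k.
    have -> : Del N = e / 4 * (Del N * (4 / e)) by field; rewrite gt_eqF.
    by rewrite ler_pM2l // divr_gt0.
  have h3 : 0 < e / 4 * l j N by rewrite mulr_gt0 ?divr_gt0 ?(af_l_gt0 H).
  lra.
have pk : `|p k - p0| <= d by near: k; exact: Hp.
have [qk0 qk1] := af_simplex H k j.
have lower : b z0 - \sum_z q k j z * dl z - e / 8 <= expected_payoff u j (q k).
  rewrite payoff_j.
  have -> : b z0 - \sum_z q k j z * dl z - e / 8 = \sum_z q k j z * (b z - e / 8).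
    rewrite [RHS](eq_bigr (fun z => q k j z * (b z0 - e / 8) - q k j z * dl z)); last first.
      by move=> z _; rewrite /dl; ring.
    by rewrite sumrB -mulr_suml qk1; ring.
  apply: ler_sum => z _; rewrite ler_wpM2l //.
  by have := var k z pk; rewrite ler_norml; lra.
rewrite /reply_gap dev_j.
have := var k (c j k) pk; have := z0max (c j k); rewrite ler_norml; lra.
Unshelve. all: by end_near. Qed.

End TwoByM.

(** * The three classes of games together *)

Section Classes.
Context {R : realType}.

Lemma two_players (n : nat) (i : 'I_n) : n = 2%N ->
  exists j : 'I_n, i != j /\ forall k, k = i \/ k = j.
Proof.
move=> n2; subst n; exists (rev_ord i); split.
  by case: i => [[|[|i]] Hi].
move=> k; case: k i => [[|[|k]] Hk] [[|[|i]] Hi] //; by [left; apply/val_inj|right; apply/val_inj].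
Qed.

Definition generic_payoffs (n : nat) (Y : 'I_n -> finType) : set (payoffs R Y) :=
  [set u | forall a b, u a = u b -> a = b].

Lemma async_fp_gap_to0 (n : nat) (Y : 'I_n -> finType) (u : payoffs R Y)
    (x : 'I_n -> nat -> bool) (l : 'I_n -> nat -> R) (c : forall i, nat -> Y i)
    (q : nat -> mixed R Y) (y0 : forall i, Y i) :
  async_fp u x l c q y0 ->
  two_player_zero_sum u \/ potential_game u \/ (two_by_m Y /\ generic_payoffs u) ->
  forall i (e : R), 0 < e -> \forall k \near \oo, reply_gap u c q i k <= e.
Proof.
move=> H [[n2 zs]|[[phi pot]|[[n2 [i card2]] gen]]] i' e e0.
- have [j [ij cover]] := two_players i' n2.
  apply: filterS (zero_sum_gap_to0 ij cover H zs e0) => k.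
  by have := reply_gap_ge0 H j k; lra.
- exact: (potential_gap_to0 H pot).
- have [j [ij cover]] := two_players i n2.
  have c2 : #|[set: Y i]%SET| == 2%N by rewrite cardsT card2.
  have /cards2P[y1 [y2 [y12 /setP Yi]]] := c2.
  have two y : y = y1 \/ y = y2.
    by have := Yi y; rewrite !inE => /esym/orP[/eqP ->|/eqP ->]; [left|right].
  have [->|->] := cover i'; first exact: (tbm_gap_i ij cover two y12 H gen e0).
  exact: (tbm_gap_j ij cover two y12 H gen e0).
Qed.

Lemma async_fp_near_nash (n : nat) (Y : 'I_n -> finType) (u : payoffs R Y)
    (x : 'I_n -> nat -> bool) (l : 'I_n -> nat -> R) (c : forall i, nat -> Y i)
    (q : nat -> mixed R Y) (y0 : forall i, Y i) :
  async_fp u x l c q y0 ->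
  two_player_zero_sum u \/ potential_game u \/ (two_by_m Y /\ generic_payoffs u) ->
  forall e : R, 0 < e -> \forall k \near \oo,
    exists2 p', nash_equilibria u p' & euclidean_dist (q k) p' < e.
Proof.
move=> H cls e e0; have [d d0 Hd] := approximate_nash_near_nash u e0.
have gaps : \forall k \near \oo, forall i, reply_gap u c q i k <= d.
  by apply: filter_forall => i; exact: async_fp_gap_to0 H cls i d d0.
apply: filterS gaps => k gk; apply: Hd => [i|i y]; first exact: af_simplex H k i.
by have := gk i; have := af_best H i k y; rewrite /reply_gap; lra.
Qed.

End Classes.

(** * From trajectories of the process to asynchronous fictitious play, and from q to g *)

Section Trajectory.
Context {R : realType} {n : nat} {Y : 'I_n -> finType}.

Lemma deliberate_roundsS (x : nat -> bool) t :
  deliberate_rounds x t.+1 = (deliberate_rounds x t + x t.+1)%N.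
Proof. by rewrite /deliberate_rounds big_nat_recr. Qed.

Lemma empirical_clock (T : finType) (a : nat -> T) (x : nat -> bool) k y :
  x 1%N ->
  (deliberate_rounds x k.+2)%:R * empirical a x k.+2 y =
  (deliberate_rounds x k.+1)%:R * empirical a x k.+1 y + (x k.+2)%:R * pure (a k.+2) y :> R.
Proof.
move=> x1; have l0 : 0 < (deliberate_rounds x k.+2)%:R :> R.
  rewrite ltr0n; elim: k.+1 => [|t IH]; rewrite deliberate_roundsS ?x1 ?addn_gt0 ?IH //.
  by rewrite orbT.
have E : (deliberate_rounds x k.+1)%:R = (deliberate_rounds x k.+2)%:R - (x k.+2)%:R :> R.
  by rewrite (deliberate_roundsS x k.+1) natrD addrK.
rewrite E [empirical a x k.+2 y]/=.
case: (x k.+2) => /=; last by rewrite mulr0 addr0 subr0 mul0r addr0.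
by field; rewrite gt_eqF.
Qed.

(** Step [k] corresponds to round [k.+1]: the profile is q(k+1), the reply to it is b(k+1), and the
    update takes place in round [k.+2]. The clocks are compared with each other through the sums
    [S]. *)
Lemma trajectory_async_fp (u : payoffs R Y) (a b : forall i, nat -> Y i)
    (X : 'I_n -> nat -> bool) (S : 'I_n -> nat -> R) :
  (forall i, X i 1%N) ->
  (forall i t, (2 <= t)%N -> best_replies u i (fun i => empirical (a i) (X i) t.-1) (b i t.-1)) ->
  (forall i t, (2 <= t)%N -> X i t -> a i t = b i t.-1) ->
  (forall i (M : R), \forall t \near \oo, M <= S i t) ->
  (forall i (e : R), 0 < e -> \forall t \near \oo,
     `|(deliberate_rounds (X i) t)%:R - S i t| <= e * S i t) ->
  (forall i j (e : R), 0 < e -> \forall t \near \oo, `|S i t - S j t| <= e * S j t) ->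
  async_fp u (fun i k => X i k.+2) (fun i k => (deliberate_rounds (X i) k.+1)%:R)
    (fun i k => b i k.+1) (fun k i => empirical (a i) (X i) k.+1) (fun i => a i 1%N).
Proof.
move=> X1 best del Soo lS SS.
have shift (P : nat -> Prop) : (\forall t \near \oo, P t) -> \forall k \near \oo, P k.+1.
  by case=> N _ HN; exists N => // k /= Nk; apply: HN; exact: leqW.
have half : (0 : R) < 1 / 2 by rewrite divr_gt0.
split=> //.
- by move=> i; rewrite /deliberate_rounds big_nat1 X1.
- by move=> i k; rewrite deliberate_roundsS natrD.
- move=> i k y; rewrite empirical_clock //; congr (_ + _).
  by have [xk|] := boolP (X i k.+2); rewrite ?mul0r // (del i k.+2).
- by move=> i k; exact: (best i k.+2).
- move=> i M; apply: (shift (fun t => M <= (deliberate_rounds (X i) t)%:R)).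
  near=> t; have h1 : `|M| * 2 <= S i t by near: t.
  have h2 : `|(deliberate_rounds (X i) t)%:R - S i t| <= 1 / 2 * S i t by near: t; exact: lS.
  by have := ler_norm M; move: h2; rewrite ler_norml; lra.
- move=> i j e e0.
  apply: (shift (fun t => `|(deliberate_rounds (X i) t)%:R - (deliberate_rounds (X j) t)%:R| <=
    e * (deliberate_rounds (X i) t)%:R)).
  pose h := Num.min (1 / 2) (e / 10).
  have h0 : 0 < h by rewrite lt_min half divr_gt0.
  have hh : h <= 1 / 2 by rewrite ge_min lexx.
  have he : h <= e / 10 by rewrite ge_min lexx orbT.
  near=> t.
  have li : `|(deliberate_rounds (X i) t)%:R - S i t| <= h * S i t by near: t; exact: lS.
  have lj : `|(deliberate_rounds (X j) t)%:R - S j t| <= h * S j t by near: t; exact: lS.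
  have ss : `|S i t - S j t| <= h * S j t by near: t; exact: SS.
  have Si : 0 <= S i t by near: t.
  have Sj : 0 <= S j t by near: t.
  move: li lj ss; set A := (_%:R : R); set B := (deliberate_rounds (X j) t)%:R.
  rewrite !ler_norml => li lj ss.
  have k1 : h * S j t <= 1 / 2 * S j t by rewrite ler_wpM2r.
  have k2 : h * S i t <= 1 / 2 * S i t by rewrite ler_wpM2r.
  have k3 : h * S j t <= h * (2 * S i t) by rewrite ler_pM2l //; lra.
  have k4 : h * S i t <= h * (2 * A) by rewrite ler_pM2l //; lra.
  have k5 : h * (10 * A) <= e * A.
    by rewrite mulrA ler_wpM2r //; lra.
  lra.
Unshelve. all: by end_near. Qed.

Lemma euclidean_dist_sqr (p p' : mixed R Y) :
  euclidean_dist p p' ^+ 2 = \sum_(i < n) \sum_(y : Y i) (p i y - p' i y) ^+ 2.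
Proof.
rewrite /euclidean_dist sqr_sqrtr // ; apply: sumr_ge0 => i _.
by apply: sumr_ge0 => y _; exact: sqr_ge0.
Qed.

(** A squared form of the triangle inequality with constant 2, checked coordinate by coordinate; it
    replaces Minkowski's inequality. *)
Lemma euclidean_dist_via (p' p p'' : mixed R Y) :
  euclidean_dist p p'' ^+ 2 <= 2 * euclidean_dist p p' ^+ 2 + 2 * euclidean_dist p' p'' ^+ 2.
Proof.
rewrite !euclidean_dist_sqr !mulr_sumr -big_split; apply: ler_sum => i _.
rewrite !mulr_sumr -big_split; apply: ler_sum => y _ /=.
have := sqr_ge0 ((p i y - p' i y) - (p' i y - p'' i y)).
have -> : p i y - p'' i y = (p i y - p' i y) + (p' i y - p'' i y) by ring.
by rewrite sqrrB sqrrD; lra.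
Qed.

Lemma dist_to_cvg0 (g : nat -> mixed R Y) (S : set (mixed R Y)) :
  (forall e : R, 0 < e -> \forall t \near \oo, exists2 p', S p' & euclidean_dist (g t) p' <= e) ->
  dist_to (g t) S @[t --> \oo] --> 0%E.
Proof.
move=> H; have pos t : (0 <= dist_to (g t) S)%E.
  by apply: le_ereal_inf_tmp => _ [p' _ <-]; rewrite lee_fin sqrtr_ge0.
have up (e : R) : 0 < e -> \forall t \near \oo, (dist_to (g t) S <= e%:E)%E.
  move=> /H; apply: filterS => t [p' Sp' le]; apply: (@le_trans _ _ (euclidean_dist (g t) p')%:E).
    by apply: ereal_inf_lbound; exists p'.
  by rewrite lee_fin.
apply/fine_cvgP; split.
  apply: filterS (up 1 ltr01) => t le1.
  by rewrite ge0_fin_numE //; apply: le_lt_trans le1 (ltry _).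
apply/cvgrPdist_le => e e0; apply: filterS (up e e0) => t le.
rewrite /= sub0r normrN ger0_norm ?fine_ge0 // -lee_fin fineK //.
by rewrite ge0_fin_numE //; apply: le_lt_trans le (ltry _).
Qed.

Lemma period_strategy_near_nash (u : payoffs R Y) (q : nat -> mixed R Y)
    (b : forall i, nat -> Y i) (rho : 'I_n -> nat -> R) :
  (forall k i, simplex (q k i)) ->
  (forall e : R, 0 < e -> \forall k \near \oo,
    exists2 p', nash_equilibria u p' & euclidean_dist (q k) p' < e) ->
  (forall i (e : R), 0 < e -> \forall t \near \oo, `|rho i t| <= e) ->
  forall e : R, 0 < e -> \forall k \near \oo, exists2 p', nash_equilibria u p' &
    euclidean_dist (fun i y => rho i k.+2 * pure (b i k.+1) y + (1 - rho i k.+2) * q k i y) p' <= e.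
Proof.
move=> qs near_nash rho0 e e0.
pose K : R := \sum_(i < n) \sum_(y : Y i) 1.
have K0 : 0 <= K by apply: sumr_ge0 => i _; apply: sumr_ge0.
have e20 : 0 < e / 2 by rewrite divr_gt0.
(* Chosen so that [2 * (d * K) + 2 * (e / 2) ^ 2 <= e ^ 2]. *)
pose d := Num.min 1 (e ^+ 2 / (4 * (K + 1))).
have d0 : 0 < d by rewrite lt_min ltr01 divr_gt0 ?exprn_gt0 // mulr_gt0 //; lra.
have small : \forall k \near \oo, forall i, `|rho i k.+2| <= d.
  apply: filter_forall => i; have [N _ HN] := rho0 i d d0.
  by exists N => // k /= Nk; apply: HN; rewrite /= !leqW.
apply: filterS2 small (near_nash _ e20) => k rk [p' Np' dist]; exists p' => //.
set g : mixed R Y := fun i => _.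
have gq : euclidean_dist g (q k) ^+ 2 <= d * K.
  rewrite euclidean_dist_sqr mulr_sumr; apply: ler_sum => i _.
  rewrite mulr_sumr; apply: ler_sum => y _; rewrite mulr1.
  have -> : g i y - q k i y = rho i k.+2 * (pure (b i k.+1) y - q k i y) by rewrite /g; ring.
  have q1 := simplex_le1 y (qs k i); have [/(_ y) q0 _] := qs k i.
  rewrite -[leLHS]ger0_norm ?sqr_ge0 // normrX normrM expr2.
  have n1 : `|pure (b i k.+1) y - q k i y| <= 1.
    by rewrite /pure ler_norml; case: (y == _) => /=; lra.
  have n2 : `|rho i k.+2| * `|pure (b i k.+1) y - q k i y| <= d.
    by rewrite -[d]mulr1 ler_pM.
  have d1 : d <= 1 by rewrite ge_min lexx.
  rewrite -[d]mulr1; apply: ler_pM => //; exact: le_trans n2 d1.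
have dK : d * K <= e ^+ 2 / 4.
  have : d * (4 * (K + 1)) <= e ^+ 2.
    rewrite -ler_pdivlMr ?ge_min ?lexx ?orbT //; rewrite mulr_gt0 //; lra.
  lra.
have qp : euclidean_dist (q k) p' ^+ 2 <= (e / 2) ^+ 2.
  by rewrite ler_pXn2r ?nnegrE ?sqrtr_ge0 ?ltW.
rewrite -(ler_pXn2r (n := 2)) ?nnegrE ?sqrtr_ge0 ?(ltW e0) //.
have := euclidean_dist_via (q k) g p'; rewrite exprMn in qp; lra.
Qed.

End Trajectory.

(** * Coinciding payoffs form a closed null set *)

Section NullSet.
Context {R : realType}.
Implicit Types (I : finType).

(** Allows covers indexed by any countable type; codes of no index lie outside the index set and may
    get an arbitrary box. *)
Lemma null_of_countable_boxes (T : countType) I (E : set (I -> R)) :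
  (forall e : R, 0 < e -> exists (D : set T) (lo hi : T -> I -> R),
    [/\ forall x i, lo x i <= hi x i,
        E `<=` \bigcup_(x in D) [set v | forall i, lo x i <= v i <= hi x i]
      & (\esum_(x in D) (\prod_(i : I) (hi x i - lo x i))%:E <= e%:E)%E]) ->
  lebesgue_null E.
Proof.
move=> H e e0; have [D [lo [hi [le cov vol]]]] := H e e0.
pose at_ (f : T -> I -> R) k := if @unpickle T k is Some x then f x else fun=> 0.
have atE f x : at_ f (pickle x) = f x by rewrite /at_ pickleK.
exists (pickle @` D), (at_ lo), (at_ hi); split.
- by move=> k i; rewrite /at_; case: unpickle.
- by move=> v /cov[x Dx Hx]; exists (pickle x); [exists x|rewrite /= !atE].
- rewrite esum_image; last by move=> x y _ _; exact: (pcan_inj (@pickleK T)).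
  by under eq_esum do rewrite !atE.
Qed.

Definition coordinate_collision I : set (I -> R) :=
  [set v | exists a b, a != b /\ v a = v b].

(* Inside each unit cube of the integer lattice the diagonal [v a = v b] is
   covered by [N] boxes with two sides of length [1 / N], hence of total volume
   [1 / N]. *)
Lemma lebesgue_null_collision I : lebesgue_null (@coordinate_collision I).
Proof.
apply: (@null_of_countable_boxes (((I * I) * {ffun I -> int}) * nat)%type) => e e0.
pose K := ((I * I) * {ffun I -> int})%type.
(* Cube and pair number [pickle x] may use volume [e / 2 ^ (pickle x).+1], so that the total is at
   most [e]. *)
pose N (x : K) : nat := (Num.truncn ((2 ^ (pickle x).+1)%:R / e)).+1.
have N0 x : 0 < (N x)%:R :> R by rewrite ltr0n.
have N_le x : (N x)%:R^-1 <= e / (2 ^ (pickle x).+1)%:R :> R.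
  have p0 : 0 < (2 ^ (pickle x).+1)%:R :> R by rewrite ltr0n expn_gt0.
  rewrite -[leRHS]invf_div lef_pV2 ?posrE ?divr_gt0 //.
  by rewrite ltW // /N truncnS_gt.
pose side (x : K) i := (i == x.1.1) || (i == x.1.2).
(* Both thin sides start from the lattice coordinate of the first member of the pair: as
   [v a = v b], the interval containing [v a] also contains [v b]. *)
pose lo (xc : K * nat) i : R :=
  if side xc.1 i then (xc.1.2 xc.1.1.1)%:~R + xc.2%:R / (N xc.1)%:R else (xc.1.2 i)%:~R.
pose hi (xc : K * nat) i : R :=
  if side xc.1 i then lo xc i + (N xc.1)%:R^-1 else lo xc i + 1.
pose A : set K := [set x | x.1.1 != x.1.2].
pose C (x : K) : set nat := `I_(N x).
exists (A `*`` C), lo, hi; split.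
- by move=> x i; rewrite /hi; case: ifP => _; rewrite lerDl // invr_ge0 ltW.
- move=> v [a [b [ab vab]]].
  pose z : {ffun I -> int} := [ffun i => Num.floor (v i)].
  pose x : K := ((a, b), z); pose r := (v a - (z a)%:~R) * (N x)%:R.
  have zi i : (z i)%:~R <= v i < (z i)%:~R + 1.
    by have := floor_itv (v i); rewrite intrD ffunE.
  have za := zi a.
  have r0 : 0 <= r by rewrite mulr_ge0 ?(ltW (N0 x)) // subr_ge0; case/andP: za.
  have /andP[c1 c2] := truncn_itv r0.
  have ca : (z a)%:~R + (Num.truncn r)%:R / (N x)%:R <= v a <=
      (z a)%:~R + (Num.truncn r)%:R / (N x)%:R + (N x)%:R^-1.
    have vE : v a = (z a)%:~R + r / (N x)%:R by rewrite /r mulfK ?gt_eqF //; ring.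
    rewrite vE -addrA !lerD2l ler_pM2r ?invr_gt0 // c1 /=.
    by rewrite -[X in _ + X]mul1r -mulrDl ler_pM2r ?invr_gt0 // natr1 ltW.
  exists (x, Num.truncn r).
    split=> //=; rewrite /C /= -(ltr_nat R); apply: le_lt_trans c1 _.
    by rewrite /r -[ltRHS]mul1r ltr_pM2r // ltrBlDl; case/andP: za.
  move=> i; rewrite /hi /lo /side /=; case: ifP => [/orP[/eqP ->|/eqP ->]|_].
  + exact: ca.
  + by rewrite -vab.
  + by case/andP: (zi i) => -> /ltW.
- have vol x c : A x -> \prod_i (hi (x, c) i - lo (x, c) i) = (N x)%:R^-1 * (N x)%:R^-1.
    rewrite /A /= => ab; rewrite (bigD1 x.1.1) //= (bigD1 x.1.2) 1?eq_sym //= mulrA big1.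
      rewrite mulr1; congr (_ * _); rewrite /hi /side /= eqxx ?orbT /= addrAC subrr add0r //.
    move=> i /andP[i1 i2]; rewrite /hi /side /= (negbTE i1) (negbTE i2) /=.
    by rewrite addrAC subrr add0r.
  have vol0 x c : (0 <= (\prod_i (hi (x, c) i - lo (x, c) i))%:E)%E.
    rewrite lee_fin; apply: prodr_ge0 => i _; rewrite subr_ge0 /hi.
    by case: ifP => _; rewrite lerDl // invr_ge0 ltW.
  rewrite -(@esum_esum _ _ _ A C (fun x c => (\prod_i (hi (x, c) i - lo (x, c) i))%:E)) //.
  apply: (@le_trans _ _ (\esum_(x in A) (e / (2 ^ (pickle x).+1)%:R)%:E)%E).
    apply: le_esum => x Ax; rewrite esum_fset //; last exact: finite_II.
    rewrite -fsbig_ord sumEFin lee_fin.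
    under eq_bigr do rewrite vol //.
    have -> : \sum_(i < N x) ((N x)%:R^-1 * (N x)%:R^-1) = (N x)%:R^-1 :> R.
      by rewrite sumr_const card_ord -[LHS]mulr_natl mulrA divff ?gt_eqF // mul1r.
    exact: N_le.
  rewrite -(@esum_image _ _ _ A pickle (fun k => (e / (2 ^ k.+1)%:R)%:E)); last first.
    by move=> x y _ _; exact: (pcan_inj (@pickleK K)).
  have e20 k : (0 <= (e / (2 ^ k.+1)%:R)%:E)%E by rewrite lee_fin divr_ge0 // ltW.
  rewrite esum_mkcond; apply: (@le_trans _ _ (\esum_(k in [set: nat]) (e / (2 ^ k.+1)%:R)%:E)%E).
    by apply: le_esum => k _; case: ifP.
  rewrite -nneseries_esumT //; apply: epsilon_trick0; exact: ltW.
Qed.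

Lemma closed_collision (n : nat) (Y : 'I_n -> finType) :
  closed [set u : payoffs R Y | exists a b, a != b /\ u a = u b].
Proof.
have coord (a : 'I_n * profile Y) : continuous (fun u : payoffs R Y => u a).
  exact: (@proj_continuous _ (fun=> R) a).
rewrite (_ : [set u | _] = \bigcup_(ab in [set ab : ('I_n * profile Y) * ('I_n * profile Y) | ab.1 != ab.2])
    [set u : payoffs R Y | u ab.1 - u ab.2 = 0]).
  apply: closed_bigcup; first exact: finite_finset.
  move=> [a b] _ /=; apply: (@preimage_closed _ _ (fun u : payoffs R Y => u a - u b) [set x | x = 0]).
    move=> u _; exact: (cvgB (coord a u) (coord b u)).
  exact: closed_eq.
apply/seteqP; split=> u /=.
  by move=> [a [b [ab uab]]]; exists (a, b) => //=; rewrite uab subrr.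
by move=> [[a b] /= ab /eqP]; rewrite subr_eq0 => /eqP uab; exists a, b.
Qed.

End NullSet.

(** * The number of deliberate rounds and its compensator *)

Section Interpolation.
Context {R : realType} (S N : nat -> R) (C : R).

(* [C * (m + 1) ^ 5] bounds the square of the deviation at the last time
   the clock [S] is at most [(m + 1) ^ 3]; monotonicity fills in the other
   times. *)
Lemma clocks_asymptotic :
  (forall t, S t <= S t.+1) -> (forall t, N t <= N t.+1) ->
  (\forall t \near \oo, S t.+1 - S t <= 1) ->
  (forall M : R, \forall t \near \oo, M <= S t) ->
  (forall m : nat, exists T, [/\ S T <= m.+1%:R ^+ 3, m.+1%:R ^+ 3 < S T.+1 &
    (N T - S T) ^+ 2 <= C * m.+1%:R ^+ 5]) ->
  forall e : R, 0 < e -> \forall t \near \oo, `|N t - S t| <= e * S t.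
Proof.
move=> Sm Nm St Soo stop e e0.
have Smono s t : (s <= t)%N -> S s <= S t.
  by elim: t => [|t IH]; [rewrite leqn0 => /eqP ->|rewrite leq_eqVlt => /predU1P[->//|/IH h]; exact: le_trans h (Sm t)].
have Nmono s t : (s <= t)%N -> N s <= N t.
  by elim: t => [|t IH]; [rewrite leqn0 => /eqP ->|rewrite leq_eqVlt => /predU1P[->//|/IH h]; exact: le_trans h (Nm t)].
pose d := e / 20; have d0 : 0 < d by rewrite divr_gt0.
have [t1 _ Ht1] := St.
(* Three demands on [m]: the deviation at the cubes is a small fraction of m^3, so is the distance
   between consecutive cubes, and the steps of [S] are already at most 1. *)
pose k1 := Num.truncn (C / d ^+ 2); pose k2 := Num.truncn (7 / d).
pose k3 := Num.truncn (S t1).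
have [m0 [h1 h2 h3]] : exists m0, [/\ (k1 < m0)%N, (k2 < m0)%N & (k3 < m0)%N].
  by exists (k1 + k2 + k3).+1; split; lia.
have m0_gt (x : R) : (Num.truncn x < m0)%N -> x < m0%:R.
  by move=> h; apply: lt_le_trans (truncnS_gt _) _; rewrite ler_nat.
have m0C : C <= d ^+ 2 * m0%:R.
  by rewrite mulrC -ler_pdivrMr ?exprn_gt0 //; apply: ltW; exact: m0_gt.
have m07 : 7 <= d * m0%:R by rewrite mulrC -ler_pdivrMr //; apply: ltW; exact: m0_gt.
have m0S : S t1 < m0%:R by exact: m0_gt.
near=> t.
have tbig : m0.+1%:R ^+ 3 < S t.
  by apply: (@lt_le_trans _ _ (m0.+1%:R ^+ 3 + 1)); [rewrite ltrDl|near: t; exact: Soo].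
have exm : exists m : nat, S t <= m.+2%:R ^+ 3.
  exists (Num.truncn (S t)); apply: le_trans (ltW (truncnS_gt _)) _.
  rewrite -natrX ler_nat; set k := Num.truncn _.
  by apply: (@leq_trans (k.+2 ^ 1)%N); [rewrite expn1|rewrite leq_pexp2l].
(* The cubes around [S t]: [m.+1 ^ 3 < S t <= m.+2 ^ 3]. *)
case: (ex_minnP exm) => m mS mmin.
have m_ge : (m0 <= m)%N.
  rewrite leqNgt; apply/negP => lt; have : S t <= m0.+1%:R ^+ 3.
    by apply: le_trans mS _; rewrite lerXn2r ?nnegrE ?ler0n // ler_nat.
  by rewrite leNgt tbig.
have mlow : m.+1%:R ^+ 3 < S t.
  rewrite ltNge; apply/negP => h.
  have m1 : (0 < m)%N by apply: leq_trans m_ge; exact: leq_ltn_trans h1.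
  have := mmin m.-1; rewrite prednK // h => /(_ isT).
  by rewrite leqNgt prednK // leqnn.
have [T [T1 T2 T3]] := stop m; have [T' [T'1 T'2 T'3]] := stop m.+1.
have Tt : (T <= t)%N.
  by rewrite leqNgt; apply/negP => /ltnW/Smono; have := lt_le_trans mlow; lra.
have tT' : (t <= T')%N.
  by rewrite leqNgt; apply/negP => /Smono; lra.
pose r : R := m.+1%:R.
have r1 : 1 <= r by rewrite ler1n.
have rE : m.+2%:R = r + 1 :> R by rewrite -natr1.
have mr : m0%:R <= r by rewrite ler_nat leqW.
have t1T : (t1 <= T)%N.
  rewrite leqNgt; apply/negP => /Smono h.
  have : r <= r ^+ 3 by rewrite -[leLHS]expr1 ler_weXn2l.
  rewrite -/r in T2; lra.
have /= step := Ht1 T t1T.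
have Cr : C <= d ^+ 2 * r by apply: le_trans m0C _; rewrite ler_pM2l ?exprn_gt0.
have dr : 7 <= d * r by apply: le_trans m07 _; rewrite ler_pM2l.
have dev (x : R) (s : R) : 1 <= s -> r <= s -> x ^+ 2 <= C * s ^+ 5 -> `|x| <= d * s ^+ 3.
  move=> s1 rs h; have s0 : 0 < s by lra.
  have ds : 0 <= d * s ^+ 3 by apply: mulr_ge0; [exact: ltW|apply: exprn_ge0; exact: ltW].
  rewrite -(ler_pXn2r (n := 2)) ?nnegrE ?normr_ge0 //.
  rewrite real_normK ?num_real //; apply: le_trans h _.
  have -> : (d * s ^+ 3) ^+ 2 = d ^+ 2 * s * s ^+ 5 by ring.
  rewrite ler_pM2r ?exprn_gt0 //; apply: le_trans Cr _.
  by rewrite ler_pM2l ?exprn_gt0.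
have dT := dev _ _ r1 (lexx _) T3; have dT' : `|N T' - S T'| <= d * (r + 1) ^+ 3.
  by apply: dev; rewrite -?rE //; rewrite rE; lra.
rewrite rE in T'1 T'2 mS; rewrite -/r in T1 T2 mlow.
have N1 := Nmono _ _ Tt; have N2 := Nmono _ _ tT'.
have cube : (r + 1) ^+ 3 <= 8 * r ^+ 3.
  have -> : 8 * r ^+ 3 = (2 * r) ^+ 3 by ring.
  by rewrite lerXn2r ?nnegrE; lra.
have inc : (r + 1) ^+ 3 - r ^+ 3 <= 7 * r ^+ 2.
  have r2 : r <= r ^+ 2 by rewrite -[leLHS]expr1 ler_weXn2l.
  have -> : (r + 1) ^+ 3 - r ^+ 3 = 3 * r ^+ 2 + 3 * r + 1 by ring.
  lra.
have inc' : 7 * r ^+ 2 <= d * r ^+ 3.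
  have -> : d * r ^+ 3 = d * r * r ^+ 2 by ring.
  by rewrite ler_pM2r // exprn_gt0 //; lra.
have one : 1 <= d * r ^+ 3.
  apply: le_trans inc'; have : 1 <= r ^+ 2 by rewrite exprn_ege1.
  lra.
have dc : d * (r + 1) ^+ 3 <= d * (8 * r ^+ 3) by rewrite ler_pM2l.
have fin : 20 * d * r ^+ 3 <= e * S t.
  have -> : 20 * d = e by rewrite /d; field.
  by rewrite ler_pM2l // ltW.
have dpos : 0 < d * r ^+ 3 by lra.
move: dT dT'; rewrite !ler_norml; lra.
Unshelve. all: by end_near. Qed.

End Interpolation.

Lemma limn_einf_ge {R : realType} (u : (\bar R)^nat) v :
  (\forall t \near \oo, (v <= u t)%E) -> (v <= limn_einf u)%E.
Proof.
move=> vu; rewrite limn_einf_lim; apply: lime_ge; first exact: is_cvg_einfs.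
have [N _ HN] := vu; near=> t; apply: le_ereal_inf_tmp => _ [s /= ts <-].
by apply: HN => /=; apply: leq_trans ts; near: t; exact: nbhs_infty_ge.
Unshelve. all: by end_near. Qed.

Section FiniteFiltration.
Context {R : realType} {d : measure_display} {Omega : measurableType d}.
Context (P : probability Omega R) (H : nat -> finType) (code : forall t, Omega -> H t).
Hypothesis code_measurable : forall t h, measurable [set w | code t w = h].
Hypothesis code_refines : forall t w w', code t.+1 w = code t.+1 w' -> code t w = code t w'.

(* [f] is measurable for the finite sigma-algebra generated by [code t]. *)
Definition adapted (T : Type) t (f : Omega -> T) : Prop :=
  forall w w', code t w = code t w' -> f w = f w'.

Lemma adapted_leq (T : Type) s t (f : Omega -> T) : (s <= t)%N -> adapted s f -> adapted t f.
Proof.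
move=> + fs; elim: t => [|t IH]; first by rewrite leqn0 => /eqP <-.
by rewrite leq_eqVlt => /predU1P[<-//|/IH ft] w w' /code_refines/ft.
Qed.

Lemma adapted_preimage (T : Type) t (f : Omega -> T) (B : set T) :
  adapted t f -> measurable (f @^-1` B).
Proof.
move=> ft; rewrite (_ : _ @^-1` _ =
    \bigcup_(h in [set h | exists2 w, code t w = h & B (f w)]) [set w | code t w = h]).
  by apply: fin_bigcup_measurable => //; exact: finite_finset.
apply/seteqP; split=> [w Bw|w [h [w' <- Bw'] /= E]]; first by exists (code t w) => //; exists w.
by rewrite /= (ft _ _ E).
Qed.

Lemma adapted_measurable t (f : Omega -> R) : adapted t f -> measurable_fun setT f.
Proof. by move=> ft _ B mB; rewrite setTI; exact: adapted_preimage ft. Qed.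

Lemma adapted_bounded t (f : Omega -> R) : adapted t f -> exists M, forall w, `|f w| <= M.
Proof.
move=> ft; have /choice[g Hg] : forall h : H t, exists r : R, forall w, code t w = h -> f w = r.
  move=> h; have [[w wh]|N] := pselect (exists w, code t w = h).
    by exists (f w) => w' w'h; apply: ft; rewrite wh.
  by exists 0 => w wh; exfalso; apply: N; exists w.
exists (\sum_h `|g h|) => w; rewrite (Hg (code t w)) // (bigD1 (code t w)) //= lerDl.
exact: sumr_ge0.
Qed.

Lemma adapted_integrable t (f : Omega -> R) : adapted t f -> P.-integrable setT (EFin \o f).
Proof.
move=> ft; apply: measurable_bounded_integrable => //.
- by apply: le_lt_trans (probability_le1 P measurableT) _; rewrite ltry.
- exact: adapted_measurable ft.
- have [M HM] := adapted_bounded ft; exists M; split; first exact: num_real.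
  by move=> x Mx w _ /=; apply: le_trans (HM w) (ltW Mx).
Qed.

Definition mean (f : Omega -> R) : R := \int[P]_w f w.

Lemma meanD t f g : adapted t f -> adapted t g ->
  mean (fun w => f w + g w) = mean f + mean g.
Proof. by move=> ft gt; apply: RintegralD => //; [exact: adapted_integrable ft|exact: adapted_integrable gt]. Qed.

Lemma meanZ t r f : adapted t f -> mean (fun w => r * f w) = r * mean f.
Proof. by move=> ft; apply: RintegralZl => //; exact: adapted_integrable ft. Qed.

Lemma mean_le t f g : adapted t f -> adapted t g -> (forall w, f w <= g w) ->
  mean f <= mean g.
Proof.
move=> ft gt fg; apply: le_Rintegral => //; [exact: adapted_integrable ft|exact: adapted_integrable gt].
Qed.

Lemma mean_cst (r : R) : mean (fun=> r) = r.
Proof.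
rewrite /mean Rintegral_cst // (_ : fine _ = 1) ?mulr1 //.
by rewrite (_ : _ setT = 1%E) //; exact: probability_setT.
Qed.

Lemma mean_sum t (I : Type) (r : seq I) (f : I -> Omega -> R) : (forall i, adapted t (f i)) ->
  mean (fun w => \sum_(i <- r) f i w) = \sum_(i <- r) mean (f i).
Proof.
move=> ft; elim: r => [|i r IH].
  by rewrite big_nil -[RHS](mean_cst 0); congr mean; apply/funext => w; rewrite big_nil.
rewrite big_cons -IH -(meanD (t := t)) //.
  by congr mean; apply/funext => w; rewrite big_cons.
by move=> w w' E; apply: eq_bigr => k _; exact: ft.
Qed.

Context (X : nat -> Omega -> bool) (rho : nat -> Omega -> R).
Hypothesis X_adapted : forall t, adapted t.+1 (X t.+1).
Hypothesis rho_adapted : forall t, adapted t (rho t.+1).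
Hypothesis rho_conditional : forall t h,
  (\int[P]_(w in [set w | code t w = h]) (rho t.+1 w)%:E =
   P ([set w | code t w = h] `&` [set w | X t.+1 w]))%E.

Let D t w : R := (X t w)%:R - rho t w.

Let D_adapted t : adapted t.+1 (D t.+1).
Proof.
move=> w w' E; rewrite /D (X_adapted E); congr (_ - _).
by apply: rho_adapted; exact: code_refines.
Qed.

Let atom_mean0 t h : mean (fun w => (code t w == h)%:R * D t.+1 w) = 0.
Proof.
have atom_ad : adapted t (fun w => (code t w == h)%:R : R) by move=> w w' ->.
have m1 : measurable [set w | code t w = h] by exact: code_measurable.
have mX : measurable [set w | X t.+1 w].
  exact: (adapted_preimage [set b | is_true b] (@X_adapted t)).
have aX : adapted t.+1 (fun w => (code t w == h)%:R * (X t.+1 w)%:R : R).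
  by move=> w w' E; rewrite (X_adapted E) (code_refines E).
have aR : adapted t.+1 (fun w => (code t w == h)%:R * rho t.+1 w).
  by move=> w w' E; rewrite (code_refines E) (rho_adapted (code_refines E)).
have -> : (fun w => (code t w == h)%:R * D t.+1 w) =
    (fun w => (code t w == h)%:R * (X t.+1 w)%:R + -1 * ((code t w == h)%:R * rho t.+1 w)).
  by apply/funext => w; rewrite /D; ring.
rewrite (meanD (t := t.+1)) //; last by move=> w w' E; rewrite (aR _ _ E).
rewrite (meanZ _ aR) mulN1r; apply/eqP; rewrite subr_eq0; apply/eqP.
rewrite /mean /Rintegral; congr fine.
transitivity (P ([set w | code t w = h] `&` [set w | X t.+1 w])).
  rewrite -[in RHS](setIT (_ `&` _)) -integral_indic //; last exact: measurableI.
  apply: eq_integral => w _; rewrite indicI /= !indicE; congr (_%:R * _%:R)%:E; congr nat_of_bool.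
    by apply/eqP/idP; rewrite inE.
  by apply/idP/idP; rewrite inE.
rewrite -rho_conditional [LHS]integral_mkcond.
apply: eq_integral => w _.
rewrite patchE; case: ifPn; rewrite ?inE ?notin_setE /= => E.
  by rewrite E eqxx mul1r.
by move/eqP/negbTE: E => ->; rewrite mul0r.
Qed.

(** [Z] is a combination of the finitely many indicators of histories, and on each of them the
    increment has mean 0 by the definition of [rho]. *)
Lemma mean_increment0 t Z : adapted t Z -> mean (fun w => Z w * D t.+1 w) = 0.
Proof.
move=> Zt; have /choice[g Hg] : forall h : H t, exists r : R, forall w, code t w = h -> Z w = r.
  move=> h; have [[w wh]|N] := pselect (exists w, code t w = h).
    by exists (Z w) => w' w'h; apply: Zt; rewrite wh.
  by exists 0 => w wh; exfalso; apply: N; exists w.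
have -> : (fun w => Z w * D t.+1 w) =
    (fun w => \sum_h g h * ((code t w == h)%:R * D t.+1 w)).
  apply/funext => w; rewrite (bigD1 (code t w)) //= eqxx mul1r -(Hg _ w erefl).
  by rewrite big1 ?addr0 // => h /negbTE hn; rewrite eq_sym hn mul0r mulr0.
have ad h : adapted t.+1 (fun w => (code t w == h)%:R * D t.+1 w).
  by move=> w w' E; rewrite (code_refines E) (D_adapted E).
rewrite (mean_sum (t := t.+1)) => [|h w w' E]; last by rewrite (ad h _ _ E).
by rewrite big1 // => h _; rewrite (meanZ _ (ad h)) atom_mean0 mulr0.
Qed.

Let S t w : R := \sum_(1 <= k < t.+1) rho k w.

Let SS t w : S t.+1 w = S t w + rho t.+1 w.
Proof. by rewrite /S big_nat_recr. Qed.

Let S_adapted t : adapted t (S t.+1).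
Proof.
move=> w w' E; apply: eq_big_nat => -[//|k] /andP[_ kt].
by apply: (adapted_leq _ (@rho_adapted k)) E.
Qed.

Section Stopped.
Context (c : R).
Hypothesis c_ge0 : 0 <= c.

(* Stopping before the clock exceeds [c]; requiring the earlier [rho] to be
   nonnegative, which holds almost surely, keeps the bounds pointwise. *)
Let active t w : bool :=
  (S t w <= c) && all (fun k => 0 <= rho k.+1 w) (iota 0 t).

Definition stopped t w : R := \sum_(1 <= k < t.+1) (active k w)%:R * D k w.

Let stoppedS t w : stopped t.+1 w = stopped t w + (active t.+1 w)%:R * D t.+1 w.
Proof. by rewrite /stopped big_nat_recr. Qed.

Let active_adapted t : adapted t (active t.+1).
Proof.
move=> w w' E; rewrite /active (S_adapted E); congr andb.
apply: eq_in_all => k; rewrite mem_iota add0n => /andP[_ kt].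
by rewrite (adapted_leq _ (@rho_adapted k) E).
Qed.

Lemma stopped_adapted t : adapted t (stopped t).
Proof.
move=> w w' E; apply: eq_big_nat => -[//|k] /andP[_ kt].
have ak := adapted_leq (leq_trans (leqnSn k) kt) (@active_adapted k).
by rewrite (ak _ _ E) (@adapted_leq _ k.+1 t _ kt (@D_adapted k) _ _ E).
Qed.

Let spent t w : R := \sum_(1 <= k < t.+1) (active k w)%:R * rho k w.

Let spentS t w : spent t.+1 w = spent t w + (active t.+1 w)%:R * rho t.+1 w.
Proof. by rewrite /spent big_nat_recr. Qed.

Let spent_adapted t : adapted t (spent t).
Proof.
move=> w w' E; apply: eq_big_nat => -[//|k] /andP[_ kt].
have ak := adapted_leq (leq_trans (leqnSn k) kt) (@active_adapted k).
have rk := adapted_leq (leq_trans (leqnSn k) kt) (@rho_adapted k).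
by rewrite (ak _ _ E) (rk _ _ E).
Qed.

Let spent_le t w : spent t w <= c.
Proof.
elim: t => [|t IH]; first by rewrite /spent big_geq.
rewrite spentS; case: (boolP (active t.+1 w)) => [/andP[Sc /allP pos]|_]; last by rewrite mul0r addr0.
rewrite mul1r; apply: le_trans Sc; rewrite SS lerD2r.
apply: ler_sum_nat => -[//|k] /andP[_ kt]; case: (active _ w); rewrite ?mul1r // mul0r.
by apply: pos; rewrite mem_iota; lia.
Qed.

(** The square minus the part [spent] of the compensator has nonincreasing mean, and [spent] never
    exceeds [c]. Activity in a round is decided by the preceding history, because [rho] is. *)
Lemma mean_stopped_sqr t : mean (fun w => stopped t w ^+ 2) <= c.
Proof.
suff : mean (fun w => stopped t w ^+ 2 + -1 * spent t w) <= 0.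
  have a2 : adapted t (fun w => stopped t w ^+ 2) by move=> w w' E; rewrite (stopped_adapted E).
  have a1 : adapted t (fun w => -1 * spent t w) by move=> w w' E; rewrite (spent_adapted E).
  rewrite (meanD a2 a1) (meanZ _ (@spent_adapted t)) mulN1r subr_le0 => /le_trans; apply.
  rewrite -[leRHS]mean_cst; apply: (@mean_le t) => //; exact: spent_adapted.
elim: t => [|t IH].
  rewrite -[leRHS]mean_cst; apply: (@mean_le 0) => //.
    by move=> w w' E; rewrite /stopped /spent !big_geq.
  by move=> w; rewrite /stopped /spent !big_geq // expr2; lra.
(* As [X] is an indicator, [D ^ 2 - rho = (1 - 2 * rho) * D - rho ^ 2]; [Z] collects the known
   factors of [D] in the increment of the square minus [spent]. *)
pose Z w := 2 * stopped t w * (active t.+1 w)%:R + (active t.+1 w)%:R * (1 - 2 * rho t.+1 w).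
have aZ : adapted t Z.
  by move=> w w' E; rewrite /Z (stopped_adapted E) (active_adapted E) (rho_adapted E).
have aB : adapted t (fun w => stopped t w ^+ 2 + -1 * spent t w).
  by move=> w w' E; rewrite (stopped_adapted E) (spent_adapted E).
apply: le_trans IH; rewrite -[leRHS]addr0 -(mean_increment0 aZ).
have aZD : adapted t.+1 (fun w => Z w * D t.+1 w).
  by move=> w w' E; rewrite (aZ _ _ (code_refines E)) (D_adapted E).
have aB1 : adapted t.+1 (fun w => stopped t w ^+ 2 + -1 * spent t w).
  by move=> w w' E; rewrite (aB _ _ (code_refines E)).
rewrite -(meanD aB1 aZD); apply: (@mean_le t.+1).
- by move=> w w' E; rewrite (stopped_adapted E) (spent_adapted E).
- by move=> w w' E; rewrite (aB1 _ _ E) (aZD _ _ E).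
move=> w; rewrite stoppedS spentS /Z /D -subr_ge0.
have r2 := sqr_ge0 (rho t.+1 w).
by case: (active _ w); case: (X t.+1 w) => /=; rewrite ?mulr1n ?mulr0n; nra.
Qed.

End Stopped.

(** On an atom [rho] is constant, and its product with the probability of the atom is a probability;
    so an atom with negative [rho] is null. *)
Let rho_ge0_ae : {ae P, forall w, forall t, 0 <= rho t.+1 w}.
Proof.
apply: ae_foralln => t.
have neg_atom h : P.-negligible [set w | code t w = h /\ rho t.+1 w < 0].
  have [[w0 [w0h neg]]|N] := pselect (exists w, code t w = h /\ rho t.+1 w < 0); last first.
    rewrite (_ : [set w | _] = set0); first exact: negligible_set0.
    by apply/seteqP; split=> // w hw; apply: N; exists w.
  apply: (@negligibleS _ _ _ _ [set w | code t w = h]); first by move=> w [].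
  have mA := code_measurable h.
  apply/negligibleP => //.
  suff : P [set w | code t w = h] = 0%E by exact.
  have := rho_conditional h.
  rewrite (eq_integral (cst (rho t.+1 w0)%:E)); last first.
    by move=> w; rewrite inE /= => wh; rewrite (rho_adapted (w' := w0)) // w0h.
  rewrite integral_cst // => E.
  have : (0 <= (rho t.+1 w0)%:E * P [set w | code t w = h])%E by rewrite E; exact: measure_ge0.
  have fA : P [set w | code t w = h] \is a fin_num by exact: fin_num_measure.
  have PA : (0 <= P [set w | code t w = h])%E by exact: measure_ge0.
  move=> le0; apply/eqP; rewrite eq_le PA andbT; move: le0 PA fA.
  case: (P _) => [r| |] //=; rewrite -EFinM !lee_fin nmulr_rge0 //.
suff : P.-negligible (\bigcup_(h in [set: H t]) [set w | code t w = h /\ rho t.+1 w < 0]).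
  by apply: negligibleS => w /= /negP; rewrite -ltNge => neg; exists (code t w).
rewrite (_ : \bigcup_(h in _) _ = \big[setU/set0]_(h <- enum (H t)) [set w | code t w = h /\ rho t.+1 w < 0]).
  by elim/big_ind: _ => //; [exact: negligible_set0|move=> ? ?; exact: negligibleU].
by rewrite -bigcup_seq; apply: eq_bigcupl; split=> h //= _; rewrite mem_enum.
Qed.

(** After [T] the clock has passed [c] and the stopped sum is frozen, while up to [T] every term is
    active. *)
Lemma stopped_eventually c w T t : 0 <= c -> (forall k, 0 <= rho k.+1 w) ->
  S T w <= c -> c < S T.+1 w -> (T <= t)%N ->
  stopped c t w = (deliberate_rounds (X^~ w) T)%:R - S T w.
Proof.
move=> c0 pos ST cST Tt.
have Smono s r : (s <= r)%N -> S s w <= S r w.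
  elim: r => [|r IH]; first by rewrite leqn0 => /eqP ->.
  rewrite leq_eqVlt => /predU1P[->//|/IH h]; apply: le_trans h _.
  by rewrite SS lerDl.
rewrite /stopped (@big_cat_nat _ _ _ T.+1) //= [X in _ + X]big1_seq ?addr0; last first.
  move=> k /andP[_]; rewrite mem_index_iota => /andP[Tk _].
  by rewrite lt_geF ?mul0r // (lt_le_trans cST) // Smono.
rewrite /deliberate_rounds natr_sum /S -sumrB; apply: eq_big_nat => k /andP[_ kT].
rewrite (le_trans (Smono _ _ _) ST) // (_ : all _ _) ?mul1r //.
by apply/allP.
Qed.

(** With weights m^(-5) against second moments m^3, the mean is at most the sum of 1/m^2, which is
    below 2. *)
Let total t w : R := \sum_(m < t) stopped (m.+1%:R ^+ 3) t w ^+ 2 / m.+1%:R ^+ 5.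

Let mean_total t : mean (total t) <= 2.
Proof.
have ad m : adapted t (fun w => stopped (m.+1%:R ^+ 3) t w ^+ 2).
  by move=> w w' E; rewrite (stopped_adapted _ E).
have -> : total t = fun w => \sum_(m < t) (m.+1%:R ^+ 5)^-1 * stopped (m.+1%:R ^+ 3) t w ^+ 2.
  by apply/funext => w; apply: eq_bigr => m _; rewrite mulrC.
rewrite (mean_sum (t := t)) => [|m w w' E]; last by rewrite (ad m _ _ E).
apply: (@le_trans _ _ (\sum_(m < t) (m.+1%:R ^+ 2)^-1)).
  apply: ler_sum => m _; rewrite (meanZ _ (@ad m)).
  have -> : (m.+1%:R ^+ 2)^-1 = (m.+1%:R ^+ 5)^-1 * m.+1%:R ^+ 3 :> R.
    have : m.+1%:R != 0 :> R by rewrite pnatr_eq0.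
    by move: m.+1%:R => x x0; field.
  by apply: ler_wpM2l; rewrite ?invr_ge0 ?exprn_ge0 //; apply: mean_stopped_sqr; exact: exprn_ge0.
case: t {ad} => [|t]; first by rewrite big_ord0.
apply: (@le_trans _ _ (2 - t.+1%:R^-1)); last by rewrite gerBl.
elim: t => [|t IH]; first by rewrite big_ord1 expr1n invr1; lra.
rewrite big_ord_recr /=; apply: le_trans (lerD IH (lexx _)) _.
have x0 : 0 < t.+1%:R :> R by rewrite ltr0Sn.
rewrite -[t.+2%:R]natr1; set x := t.+1%:R in x0 *.
rewrite -subr_ge0 (_ : _ - _ = (x * (x + 1) ^+ 2)^-1); last by field; rewrite !gt_eqF //; lra.
by rewrite invr_ge0; apply: mulr_ge0; [exact: ltW|exact: sqr_ge0].
Qed.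

Let total_bounded_ae : {ae P, forall w, exists C : R, forall m v,
  (\forall t \near \oo, v = stopped (m.+1%:R ^+ 3) t w) -> v ^+ 2 <= C * m.+1%:R ^+ 5}.
Proof.
have tot_ad t : adapted t (total t).
  by move=> w w' E; apply: eq_bigr => m _; rewrite (stopped_adapted _ E).
have tot_meas t := measurable_int _ (adapted_integrable (tot_ad t)).
have tot0 t w : 0 <= total t w.
  by apply: sumr_ge0 => m _; rewrite divr_ge0 ?sqr_ge0 ?exprn_ge0.
have einf0 w : (0 <= limn_einf (fun t => (total t w)%:E))%E.
  by apply: limn_einf_ge; apply: nearW => t; rewrite lee_fin.
have int : P.-integrable setT (fun w => limn_einf (fun t => (total t w)%:E)).
  apply/integrableP; split.
    apply: (emeasurable_fun_cvg (fun t w => einfs (fun s => (total s w)%:E) t)).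
      by move=> t; apply: measurable_fun_einfs => s; exact: tot_meas.
    by move=> w _; rewrite limn_einf_lim; exact: is_cvg_einfs.
  under eq_integral do rewrite gee0_abs //.
  apply: le_lt_trans (fatou P measurableT (fun t => @tot_meas t) _) _.
    by move=> t w _; rewrite lee_fin.
  apply: (@le_lt_trans _ _ 2%:E); last exact: ltry.
  rewrite limn_einf_lim; apply: lime_le; first exact: is_cvg_einfs.
  apply: nearW => t; apply: le_trans (ereal_inf_lbound _) _.
    by exists t => /=.
  rewrite -(fineK (integrable_fin_num _ (adapted_integrable (tot_ad t)))) //.
  by rewrite lee_fin; exact: mean_total.
have := integrable_ae measurableT int; apply: filterS => w /(_ I) fin.
exists (fine (limn_einf (fun t => (total t w)%:E))) => m v ev.
rewrite -ler_pdivrMr ?exprn_gt0 // -lee_fin fineK //.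
apply: limn_einf_ge; near=> t; rewrite lee_fin.
have mt : (m < t)%N by near: t; exact: nbhs_infty_gt.
rewrite /total (bigD1 (Ordinal mt)) //= (_ : v = stopped (m.+1%:R ^+ 3) t w); last by near: t.
by rewrite lerDl; apply: sumr_ge0 => k _; rewrite divr_ge0 ?sqr_ge0 ?exprn_ge0.
Unshelve. all: by end_near. Qed.

Lemma deliberate_rounds_asymptotic : {ae P, forall w,
  rho t w @[t --> \oo] --> (0 : R) ->
  (forall M : R, \forall t \near \oo, M <= \sum_(1 <= k < t.+1) rho k w) ->
  forall e : R, 0 < e -> \forall t \near \oo,
    `|(deliberate_rounds (X^~ w) t)%:R - \sum_(1 <= k < t.+1) rho k w| <=
    e * \sum_(1 <= k < t.+1) rho k w}.
Proof.
apply: filterS2 rho_ge0_ae total_bounded_ae => w pos [C HC] rho0 Soo e e0.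
apply: (@clocks_asymptotic _ (S^~ w) (fun t => (deliberate_rounds (X^~ w) t)%:R) C) => //.
- by move=> t; rewrite SS lerDl.
- by move=> t; rewrite ler_nat /deliberate_rounds [leqRHS]big_nat_recr //; exact: leq_addr.
- have [t0 _ H0] := cvgr_lt 0 rho0 1 ltr01.
  exists t0 => // t /= t0t; rewrite SS addrC addKr; apply: ltW; apply: H0 => /=; lia.
- move=> m; set c := m.+1%:R ^+ 3; have c0 : 0 <= c by exact: exprn_ge0.
  have ex : exists t, c < S t.+1 w.
    have [t0 _ Ht] := Soo (c + 1); exists t0.
    by apply: lt_le_trans (Ht t0.+1 _) => //=; rewrite ltrDl.
  case: (ex_minnP ex) => T cT Tmin.
  have ST : S T w <= c.
    case: T {cT} Tmin => [_|T Tmin]; first by rewrite /S big_geq.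
    by rewrite leNgt; apply/negP => /Tmin; rewrite ltnn.
  exists T; split=> //; apply: HC; exists T => // t Tt.
  by rewrite (stopped_eventually c0 pos ST cT Tt).
Qed.

End FiniteFiltration.

(** * Almost sure convergence *)

Section HistoryCode.
Context {n : nat} {Y : 'I_n -> finType} {d : measure_display} {Omega : measurableType d}.
Context (a b : actions Y Omega) (X : indicators n Omega).

Definition history_code t (w : Omega) : {dffun forall i : 'I_n, {ffun 'I_t -> Y i * bool * Y i}} :=
  [ffun i => [ffun s : 'I_t => (a i s.+1 w, X i s.+1 w, b i s.+1 w)]].

Lemma history_codeP t w w' : history_code t w = history_code t w' <->
  forall i s, (1 <= s <= t)%N -> [/\ a i s w = a i s w', X i s w = X i s w' & b i s w = b i s w'].
Proof.
split=> [/ffunP E i [//|s] /= st|E].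
  have := E i; rewrite !ffunE => /ffunP/(_ (Ordinal st)); rewrite !ffunE /=.
  by case.
apply/ffunP => i; rewrite !ffunE; apply/ffunP => s; rewrite !ffunE.
by have [-> -> ->] := E i s.+1 (ltn_ord s).
Qed.

Lemma history_code_refines t w w' :
  history_code t.+1 w = history_code t.+1 w' -> history_code t w = history_code t w'.
Proof.
move=> /history_codeP E; apply/history_codeP => i s /andP[s0 st]; apply: E.
by rewrite s0 leqW.
Qed.

(** Together with [history_atom], this identifies the history with the finite sigma-algebra whose
    atoms are the fibres of [history_code]. *)
Lemma history_saturated t A w w' : history a b X t A ->
  history_code t w = history_code t w' -> A w -> A w'.
Proof.
move=> hA; pose sat := [set B : set Omega | forall w w',
  history_code t w = history_code t w' -> B w -> B w'].
suff : sat A by move=> s; exact: s.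
move: A hA; apply: smallest_sub.
  split=> [//|B sB w1 w2 E [_ nB]|F sF w1 w2 E [k _ Fk]].
    by split=> // B2; apply: nB; exact: sB (esym E) B2.
  by exists k => //; exact: sF E Fk.
move=> _ [s /= st [i _ [[]|]]] [B _ <-] w1 w2 /history_codeP/(_ i s st)[e1 e2 e3];
  rewrite !setTI /=; by rewrite ?e1 ?e2 ?e3.
Qed.

Lemma history_atom t h : history a b X t [set w | history_code t w = h].
Proof.
pose G := \bigcup_(s in [set s | (1 <= s <= t)%N]) \bigcup_(i in [set: 'I_n])
       (preimage_set_system setT (a i s) setT `|`
        preimage_set_system setT (X i s) setT `|`
        preimage_set_system setT (b i s) setT).
have -> : [set w | history_code t w = h] =
   \bigcap_(i in [set: 'I_n]) \bigcap_(s in [set: 'I_t])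
     ((a i s.+1 @^-1` [set (h i s).1.1] `&` X i s.+1 @^-1` [set (h i s).1.2]) `&`
      b i s.+1 @^-1` [set (h i s).2]).
  apply/seteqP; split=> [w <- i _ s _|w Hw]; first by rewrite !ffunE.
  apply/ffunP => i; rewrite !ffunE; apply/ffunP => s; rewrite !ffunE.
  have [[/= -> ->] ->] := Hw i I s I.
  by case: (h i s) => [[]].
suff : @measurable _ (g_sigma_algebraType G) (\bigcap_(i in [set: 'I_n]) \bigcap_(s in [set: 'I_t])
     ((a i s.+1 @^-1` [set (h i s).1.1] `&` X i s.+1 @^-1` [set (h i s).1.2]) `&`
      b i s.+1 @^-1` [set (h i s).2])) by [].
apply: fin_bigcap_measurable => [|i _]; first exact: finite_finset.
apply: fin_bigcap_measurable => [|s _]; first exact: finite_finset.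
have in_G (C : set Omega) :
    (preimage_set_system setT (a i s.+1) setT `|`
     preimage_set_system setT (X i s.+1) setT `|`
     preimage_set_system setT (b i s.+1) setT) C -> @measurable _ (g_sigma_algebraType G) C.
  by move=> HC; apply: sub_sigma_algebra; exists s.+1 => /=; [exact: ltn_ord|exists i].
apply: measurableI; [apply: measurableI|]; apply: in_G.
- by left; left; eexists; last exact: setTI.
- by left; right; eexists; last exact: setTI.
- by right; eexists; last exact: setTI.
Qed.

End HistoryCode.

Lemma deliberate_rounds_ae {R : realType} {n : nat} {Y : 'I_n -> finType}
    {d : measure_display} {Omega : measurableType d} (P : probability Omega R)
    (u : payoffs R Y) (a b : actions Y Omega) (X : indicators n Omega)
    (rho : 'I_n -> nat -> Omega -> R) (i : 'I_n) :
  strongly_convergent_fp P u a b X ->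
  (forall t, (1 <= t)%N ->
     is_conditional_probability P (history a b X t.-1) [set w | X i t w = true] (rho i t)) ->
  {ae P, forall w, rho i t w @[t --> \oo] --> (0 : R) ->
    (forall M : R, \forall t \near \oo, M <= \sum_(1 <= k < t.+1) rho i k w) ->
    forall e : R, 0 < e -> \forall t \near \oo,
      `|(deliberate_rounds (X i ^~ w) t)%:R - \sum_(1 <= k < t.+1) rho i k w| <=
      e * \sum_(1 <= k < t.+1) rho i k w}.
Proof.
move=> fp cond; apply: (deliberate_rounds_asymptotic (code := history_code a b X)).
- by move=> t h; apply: (fp_measurable fp (t := t)); exact: history_atom.
- exact: history_code_refines.
- by move=> t w w' /history_codeP/(_ i t.+1); rewrite ltnSn => /(_ isT)[].
(* The set where [rho] takes its value at [w] belongs to the history, so it contains the whole atom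
   of [w]. *)
- move=> t w w' E; have [/(_ [set rho i t.+1 w] (measurable_set1 _)) hist _ _] := cond t.+1 isT.
  exact/esym/(history_saturated hist E).
- by move=> t h; have [_ _ ->] := cond t.+1 isT; last exact: history_atom.
Qed.

Lemma cvg_ratio1_dist {R : realType} (f g : nat -> R) :
  f t / g t @[t --> \oo] --> (1 : R) -> (forall M : R, \forall t \near \oo, M <= g t) ->
  forall e : R, 0 < e -> \forall t \near \oo, `|f t - g t| <= e * g t.
Proof.
move=> /cvgrPdist_le fg goo e e0; apply: filterS2 (fg e e0) (goo 1) => t /= close g1.
have g0 : 0 < g t by exact: lt_le_trans ltr01 g1.
have -> : f t - g t = (f t / g t - 1) * g t by field; rewrite gt_eqF.
by rewrite normrM (gtr0_norm g0) ler_pM2r // distrC.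
Qed.

Theorem corollary1 (R : realType) (n : nat) (Y : 'I_n -> finType) :
  exists E : set (payoffs R Y),
    [/\ closed E, lebesgue_null E &
      forall u : payoffs R Y,
        two_player_zero_sum u \/ potential_game u \/ (two_by_m Y /\ ~ E u) ->
      forall (d : measure_display) (Omega : measurableType d)
        (P : probability Omega R) (a b : actions Y Omega)
        (X : indicators n Omega) (rho : 'I_n -> nat -> Omega -> R),
        strongly_convergent_fp P u a b X ->
        (forall i t, (1 <= t)%N ->
           is_conditional_probability P (history a b X t.-1)
             [set w | X i t w = true] (rho i t)) ->
        (forall i, {ae P, forall w, rho i t w @[t --> \oo] --> (0 : R)}) ->
        (forall i, {ae P, forall w,
           \sum_(1 <= k < t.+1) rho i k w @[t --> \oo] --> +oo}) ->
        (forall i j, {ae P, forall w,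
           (\sum_(1 <= k < t.+1) rho i k w) / (\sum_(1 <= k < t.+1) rho j k w)
             @[t --> \oo] --> (1 : R)}) ->
        {ae P, forall w,
           dist_to (period_strategy a b X rho t w) (nash_equilibria u)
             @[t --> \oo] --> 0%E}].
Proof.
(* Off this set all payoffs are distinct, also those of different players; one set thus serves
   whichever player has two actions. *)
exists [set u | exists a b, a != b /\ u a = u b]; split.
- exact: closed_collision.
- exact: lebesgue_null_collision.
move=> u cls d Omega P a b X rho fp cond rho0 Soo ratio.
have gen : two_player_zero_sum u \/ potential_game u \/ (two_by_m Y /\ generic_payoffs u).
  case: cls => [|[|[c2 nE]]]; [by left|by right; left|right; right; split=> // x y uxy].
  by apply/eqP; apply: contra_notT nE => xy; exists x, y.
have all_i (Q : 'I_n -> Omega -> Prop) : (forall i, {ae P, forall w, Q i w}) ->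
    {ae P, forall w i, Q i w} by move=> HQ; exact: filter_forall.
have A1 := all_i _ rho0; have A2 := all_i _ Soo.
have A3 := all_i _ (fun i => all_i _ (ratio i)).
have A4 := all_i _ (fun i => deliberate_rounds_ae fp (cond i)).
apply: filterS2 (filterI A1 A2) (filterI A3 A4) => w [r0 Sw] [rw dw].
pose S i t := \sum_(1 <= k < t.+1) rho i k w.
have SM i (M : R) : \forall t \near \oo, M <= S i t by exact: (cvgryPge _).1 (Sw i) M.
have H : async_fp u (fun i k => X i k.+2 w) (fun i k => (deliberate_rounds (X i ^~ w) k.+1)%:R)
    (fun i k => b i k.+1 w) (fun k i => empirical (a i ^~ w) (X i ^~ w) k.+1) (fun i => a i 1%N w).
  apply: (@trajectory_async_fp _ _ _ u (fun i k => a i k w) (fun i k => b i k w)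
    (fun i k => X i k w) S) => //.
  - by move=> i; exact: fp_init fp i w.
  - by move=> i t; exact: fp_best_reply fp i t w.
  - by move=> i t t2; exact: fp_deliberate fp i t w t2.
  - by move=> i; exact: dw i (r0 i) (SM i).
  - by move=> i j; exact: cvg_ratio1_dist (rw i j) (SM j).
apply: dist_to_cvg0 => e e0.
have [i|k0 _ Hk] := @period_strategy_near_nash _ _ _ u
  (fun k i => empirical (a i ^~ w) (X i ^~ w) k.+1) (fun i k => b i k w) (fun i k => rho i k w)
  (fun k i => af_simplex H k i) (async_fp_near_nash H gen) _ e e0.
  by move=> d' d0; have /cvgrPdist_le/(_ d' d0) := r0 i; apply: filterS => t; rewrite sub0r normrN.
(* g(t) is built from q(t-1), which is step t-2; the first two values are dropped. *)
exists k0.+2 => // -[//|[//|t]] /= tk; exact: Hk.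
Qed.
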